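(* Let $\mathbb{F}$ be an algebraically closed field of characteristic $0$, $G$ an abelian group, and $m,n\ge 0$ integers, not both zero. If a $G$-grading of Type I on the Lie superalgebra $A(m,n)$ is even, then it is isomorphic to some $\Gamma_A(T,\beta,\gamma_0,\gamma_1)$. Two such gradings, $\Gamma_A(T,\beta,\gamma_0,\gamma_1)$ and $\Gamma_A(T',\beta',\gamma_0',\gamma_1')$, are isomorphic if, and only if, $T=T'$ and there are $\delta\in\{\pm1\}$ and $g\in G$ such that $\beta^\delta=\beta'$ and (i) for $m\neq n$: $g\,\Xi(\gamma_0^\delta)=\Xi(\gamma_0')$ and $g\,\Xi(\gamma_1^\delta)=\Xi(\gamma_1')$; (ii) for $m=n$: either $g\,\Xi(\gamma_0^\delta)=\Xi(\gamma_0')$ and $g\,\Xi(\gamma_1^\delta)=\Xi(\gamma_1')$, or $g\,\Xi(\gamma_0^\delta)=\Xi(\gamma_1')$ and $g\,\Xi(\gamma_1^\delta)=\Xi(\gamma_0')$.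
   Context: $M(r,s)$ is the associative superalgebra $M_{r+s}(\mathbb{F})=\mathrm{End}(\mathbb{F}^r\oplus\mathbb{F}^s)$ whose even (odd) part consists of the block-diagonal (block-off-diagonal) matrices. $\mathfrak{gl}(r|s)$ is the same superspace with the supercommutator $[a,b]=ab-(-1)^{|a||b|}ba$, and $\mathfrak{sl}(r|s)$ is its derived superalgebra, the matrices with zero supertrace ($\mathrm{tr}$ of the first diagonal block minus $\mathrm{tr}$ of the second). $\mathfrak{psl}(r|r)=\mathfrak{sl}(r|r)/\mathbb{F}I_{2r}$. The Lie superalgebra $A(m,n)$ is $\mathfrak{sl}(m+1|n+1)$ if $m\ne n$ and $\mathfrak{psl}(n+1|n+1)$ if $m=n$. A $G$-grading on a (Lie or associative) superalgebra is an algebra grading $A=\bigoplus_{g\in G}A_g$ whose components are $\mathbb{Z}_2$-graded subspaces. Two $G$-gradings on $A$ are isomorphic if some superalgebra automorphism of $A$ maps each component of the first onto the component of the second of the same degree. Type I. Any $G$-grading on $M(m+1,n+1)$ is a grading on $\mathfrak{gl}(m+1|n+1)$, restricts to $\mathfrak{sl}(m+1|n+1)$ and, if $m=n$, induces a grading on $\mathfrak{psl}(n+1|n+1)$; the gradings on $A(m,n)$ obtained in this way are said to be of Type I. A $G$-grading corresponds to the action of $\widehat{G}=\mathrm{Hom}(G,\mathbb{F}^\times)$ by $\chi\cdot x=\chi(g)x$ for $x$ of degree $g$. A Type I grading on $A(m,n)$ is even if $\widehat{G}$ acts by automorphisms belonging to $\mathcal{E}$, the group of automorphisms of $A(m,n)$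 induced by conjugations by invertible even (i.e. block-diagonal) matrices of $M(m+1,n+1)$; otherwise it is odd. The grading $\Gamma_A(T,\beta,\gamma_0,\gamma_1)$. Let $T\subseteq G$ be a finite subgroup and $\beta:T\times T\to\mathbb{F}^\times$ a nondegenerate alternating bicharacter. Let $D$ be the $G$-graded division algebra (every nonzero homogeneous element invertible) with support $T$, one-dimensional components $\mathbb{F}X_t$ and $X_uX_v=\beta(u,v)X_vX_u$ (unique up to isomorphism; a matrix algebra of size $\sqrt{|T|}$). Let $\gamma_0=(g_1,\dots,g_{k_0})$, $\gamma_1=(g_{k_0+1},\dots,g_{k_0+k_1})$ be tuples of elements of $G$ with $k_0\sqrt{|T|}=m+1$, $k_1\sqrt{|T|}=n+1$. Identify $M(m+1,n+1)=M_{k_0+k_1}(\mathbb{F})\otimes D$ via the Kronecker product; the grading $\Gamma(T,\beta,\gamma_0,\gamma_1)$ on $M(m+1,n+1)$ is $\deg(E_{ij}\otimes d)=g_i(\deg d)g_j^{-1}$, and $\Gamma_A(T,\beta,\gamma_0,\gamma_1)$ is the induced grading on $A(m,n)$. For a tuple $\gamma=(g_1,\dots,g_k)$, $\gamma^\delta=(g_1^\delta,\dots,g_k^\delta)$, and $\Xi(\gamma)$ is the multiset of cosets $g_1T,\dots,g_kT$ in $G/T$ counted with multiplicity; $G$ acts on such multisets by multiplication. *)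

(* Defs.v *)
From HB Require Import structures.
From mathcomp Require Import all_boot all_order all_algebra.
From mathcomp Require Import generic_quotient ring_quotient.
From mathcomp Require Import ring finmap multiset mxtens.

Set Implicit Arguments.
Unset Strict Implicit.
Unset Printing Implicit Defensive.

Import GRing.Theory VectorInternalTheory.

Local Open Scope ring_scope.
Local Open Scope quotient_scope.

Section QuotientSpace.
Variables (K : fieldType) (V : vectType K) (U : {vspace V}).

Definition quotv : Type := Quotient.quot (pred_of_vspace U).

HB.instance Definition _ := GRing.Zmodule.on quotv.

Definition quotv_pi (x : V) : quotv := \pi_(Quotient.quot (pred_of_vspace U)) x.
Definition quotv_repr (x : quotv) : V := repr (x : Quotient.quot (pred_of_vspace U)).

Lemma quotv_reprK : cancel quotv_repr quotv_pi.
Proof. exact: reprK. Qed.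

Lemma quotv_pi_eq x y : (quotv_pi x == quotv_pi y) = (x - y \in U).
Proof. exact/esym/(Quotient.idealrBE (pred_of_vspace U)). Qed.

Fact quotv_pi_zmod : zmod_morphism quotv_pi.
Proof. by move=> x y; apply: (raddfB (\pi_(Quotient.quot (pred_of_vspace U)))). Qed.
HB.instance Definition _ :=
  GRing.isZmodMorphism.Build V quotv quotv_pi quotv_pi_zmod.

Definition quotv_scale (a : K) (x : quotv) := quotv_pi (a *: quotv_repr x).

Fact quotv_scale_pi a x : quotv_scale a (quotv_pi x) = quotv_pi (a *: x).
Proof.
apply/eqP; rewrite quotv_pi_eq -scalerBr memvZ //.
by rewrite -quotv_pi_eq quotv_reprK.
Qed.

Fact quotv_scaleA a b x :
  quotv_scale a (quotv_scale b x) = quotv_scale (a * b) x.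
Proof. by rewrite -(quotv_reprK x) !quotv_scale_pi scalerA. Qed.
Fact quotv_scale1 : left_id 1 quotv_scale.
Proof. by move=> x; rewrite -(quotv_reprK x) quotv_scale_pi scale1r. Qed.
Fact quotv_scaleDr : right_distributive quotv_scale +%R.
Proof.
move=> a x y; rewrite -(quotv_reprK x) -(quotv_reprK y) -raddfD /=.
by rewrite !quotv_scale_pi scalerDr raddfD.
Qed.
Fact quotv_scaleDl x : {morph quotv_scale^~ x : a b / a + b}.
Proof.
by move=> a b; rewrite -(quotv_reprK x) !quotv_scale_pi scalerDl raddfD.
Qed.

HB.instance Definition _ := GRing.Zmodule_isLmodule.Build K quotv
  quotv_scaleA quotv_scale1 quotv_scaleDr quotv_scaleDl.

Fact quotv_pi_linear : linear quotv_pi.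
Proof.
move=> a x y; rewrite raddfD /=; congr (_ + _).
by rewrite -quotv_scale_pi.
Qed.
HB.instance Definition _ := GRing.isSemilinear.Build K V quotv _ quotv_pi
  (GRing.semilinear_linear quotv_pi_linear).

Lemma quotv_pi_eq0 x : (quotv_pi x == 0) = (x \in U).
Proof. by rewrite -(raddf0 quotv_pi) quotv_pi_eq subr0. Qed.

Let W := (U^C)%VS.
Definition quotv_v2r (x : quotv) :=
  v2r (vsproj W (daddv_pi W U (quotv_repr x))).

Let WU0 : (W :&: U = 0)%VS. Proof. by rewrite capvC capv_compl. Qed.
Let memWU x : (x \in W + U)%VS. Proof. by rewrite addvC addv_complf memvf. Qed.

Let piWU0 x : x \in U -> daddv_pi W U x = 0.
Proof.
move=> Ux; have := daddv_pi_add WU0 (memWU x).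
rewrite (daddv_pi_id (V := W)) ?capv_compl // => e.
by apply: (addIr x); rewrite e add0r.
Qed.

Let quotv_pi_daddv x : quotv_pi (daddv_pi W U x) = quotv_pi x.
Proof.
apply/eqP; rewrite quotv_pi_eq -{2}(daddv_pi_add WU0 (memWU x)).
by rewrite opprD addrA subrr add0r memvN memv_pi.
Qed.

Fact quotv_v2r_pi x : quotv_v2r (quotv_pi x) = v2r (vsproj W (daddv_pi W U x)).
Proof.
rewrite /quotv_v2r; congr (v2r (vsproj _ _)); apply/eqP.
by rewrite -subr_eq0 -linearB /= piWU0 // -quotv_pi_eq quotv_reprK.
Qed.

Fact quotv_vect_iso : Vector.axiom (dim (subvs_of W)) quotv.
Proof.
exists quotv_v2r => [a x y|].
  rewrite -(quotv_reprK x) -(quotv_reprK y) -linearP !quotv_v2r_pi.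
  by rewrite !linearP.
exists (fun r => quotv_pi (vsval (r2v r : subvs_of W))) => [x|r].
  by rewrite /quotv_v2r v2rK vsprojK ?memv_pi // quotv_pi_daddv quotv_reprK.
by rewrite quotv_v2r_pi daddv_pi_id ?subvsP // vsvalK r2vK.
Qed.
HB.instance Definition _ :=
  Lmodule_hasFinDim.Build K quotv quotv_vect_iso.

End QuotientSpace.

Lemma quotv_pi_surj (K : fieldType) (V : vectType K) (U : {vspace V})
    (y : quotv U) : exists x, quotv_pi U x = y.
Proof. by exists (quotv_repr y); apply: quotv_reprK. Qed.

(* Only the data of a superalgebra; the parity index false is the even part. *)
Record superalg (F : fieldType) := Superalg {
  scar :> vectType F;
  smul : scar -> scar -> scar;
  spar : bool -> {vspace scar} }.

Section SuperalgConstructions.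
Variables (F : fieldType) (S : superalg F).

Definition sub_superalg (U : {vspace S}) : superalg F :=
  @Superalg F (subvs_of U)
    (fun x y => vsproj U (smul (vsval x) (vsval y)))
    (fun i => linfun vsval @^-1: spar S i)%VS.

Definition quot_superalg (Z : {vspace S}) : superalg F :=
  @Superalg F (quotv Z)
    (fun x y => quotv_pi Z (smul (quotv_repr x) (quotv_repr y)))
    (fun i => linfun (quotv_pi Z) @: spar S i)%VS.

Definition is_superaut (f : 'End(S)) : Prop :=
  [/\ lker f = 0%VS,
      forall x y, f (smul x y) = smul (f x) (f y)
    & forall i, (f @: spar S i)%VS = spar S i].

End SuperalgConstructions.

Section Gradings.
Variables (F : fieldType) (G : zmodType).

(* V is the direct sum of the V_ g; as V is finite-dimensional, only finitely
   many V_ g are nonzero. *)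
Definition is_decomposition (V : vectType F) (V_ : G -> {vspace V}) : Prop :=
  exists S : {fset G},
    [/\ forall g, g \notin S -> V_ g = 0%VS,
        directv (\sum_(g <- S) V_ g)
      & (\sum_(g <- S) V_ g)%VS = fullv].

Definition is_grading (V : vectType F) (mul : V -> V -> V)
    (V_ : G -> {vspace V}) : Prop :=
  is_decomposition V_ /\
  forall g h x y, x \in V_ g -> y \in V_ h -> mul x y \in V_ (g + h).

Definition is_supergrading (S : superalg F) (S_ : G -> {vspace S}) : Prop :=
  is_grading (@smul F S) S_ /\
  forall g, S_ g = (S_ g :&: spar S false + S_ g :&: spar S true)%VS.

Definition isomorphic_gradings (S : superalg F) (S_ S'_ : G -> {vspace S}) :
    Prop :=
  exists2 f : 'End(S), is_superaut f & forall g, (f @: S_ g)%VS = S'_ g.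

Definition is_character (chi : G -> F) : Prop :=
  (forall g, chi g != 0) /\ (forall g h, chi (g + h) = chi g * chi h).

End Gradings.

Section MatrixSuperalgebras.
Variables (F : fieldType) (r s : nat).
Local Notation M := 'M[F]_(r + s).

Definition mxpar (i : bool) (x : M) : M :=
  if i then block_mx 0 (ursubmx x) (dlsubmx x) 0
  else block_mx (ulsubmx x) 0 0 (drsubmx x).

Fact mxpar_linear i : linear (mxpar i).
Proof.
move=> a x y; rewrite -[x]submxK -[y]submxK /mxpar !scale_block_mx !add_block_mx.
by case: i; rewrite !(block_mxKul, block_mxKur, block_mxKdl, block_mxKdr)
  scale_block_mx add_block_mx ?scaler0 ?addr0.
Qed.
HB.instance Definition _ i := GRing.isSemilinear.Build F M M _ (mxpar i)
  (GRing.semilinear_linear (mxpar_linear i)).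

Definition Mpar (i : bool) : {vspace M} := limg (linfun (mxpar i)).

Definition Msuper : superalg F := @Superalg F M (@mulmx F _ _ _) Mpar.

(* [a, b] = ab - (-1)^(|a||b|) ba, extended bilinearly *)
Definition sbracket (a b : M) : M :=
  a *m b - \sum_(i : bool) \sum_(j : bool)
             (-1) ^+ (i && j) *: (mxpar j b *m mxpar i a).

Definition gl : superalg F := @Superalg F M sbracket Mpar.

Definition supertrace (x : M) : F^o := \tr (ulsubmx x) - \tr (drsubmx x).

Fact supertrace_linear : linear supertrace.
Proof.
move=> a x y; rewrite /supertrace -[x]submxK -[y]submxK scale_block_mx.
rewrite add_block_mx !block_mxKul !block_mxKdr !linearP /=.
by rewrite scalerBr opprD addrACA.
Qed.
HB.instance Definition _ := GRing.isSemilinear.Build F M F^o _ supertrace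
  (GRing.semilinear_linear supertrace_linear).

Definition slspace : {vspace M} := lker (linfun supertrace).

Definition sl : superalg F := sub_superalg (slspace : {vspace gl}).

Lemma mem_Mpar i (x : M) : (x \in Mpar i) = (mxpar i x == x).
Proof.
apply/memv_imgP/eqP => [[y _ ->]|<-]; last first.
  by exists x; rewrite ?memvf ?lfunE.
rewrite lfunE /= /mxpar.
by case: i; rewrite !(block_mxKul, block_mxKur, block_mxKdl, block_mxKdr).
Qed.

Lemma mem_slspace (x : M) : (x \in slspace) = (supertrace x == 0).
Proof. by rewrite memv_ker lfunE. Qed.

Lemma sbracketE a b :
  sbracket a b = a *m b - mxpar false b *m mxpar false a
    - mxpar true b *m mxpar false a - mxpar false b *m mxpar true a
    + mxpar true b *m mxpar true a.
Proof.
rewrite /sbracket !big_bool /= !expr0 expr1 !scale1r scaleN1r !opprD opprK.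
by rewrite (AC (1*(2*2)) (1*5*4*3*2)).
Qed.

Lemma mxparD (x : M) : mxpar false x + mxpar true x = x.
Proof. by rewrite add_block_mx !addr0 !add0r submxK. Qed.

Lemma mxpar_scalar i (k : F) : mxpar i k%:M = if i then 0 else k%:M.
Proof.
rewrite /mxpar scalar_mx_block.
case: i; rewrite ?(block_mxKul, block_mxKur, block_mxKdl, block_mxKdr) //.
exact: block_mx0.
Qed.

Lemma sbracket_scalarr (x : M) (k : F) : sbracket x k%:M = 0.
Proof.
rewrite sbracketE !mxpar_scalar !mul0mx subr0 addr0 mul_mx_scalar !mul_scalar_mx.
by rewrite -addrA -opprD -scalerDr mxparD subrr.
Qed.

Lemma sbracket_scalarl (x : M) (k : F) : sbracket k%:M x = 0.
Proof.
rewrite sbracketE !mxpar_scalar !mulmx0 subr0 addr0 mul_scalar_mx !mul_mx_scalar.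
by rewrite -addrA -opprD -scalerDr mxparD subrr.
Qed.

Lemma sbracketBr (x y z : M) : sbracket x (y - z) = sbracket x y - sbracket x z.
Proof.
rewrite /sbracket mulmxBr.
rewrite [in RHS]opprD [in RHS]addrACA -[in RHS]opprD; congr (_ - _).
rewrite -sumrB; apply: eq_bigr => i _; rewrite -sumrB; apply: eq_bigr => j _.
by rewrite linearB mulmxBl scalerBr.
Qed.

Lemma sbracketBl (x y z : M) : sbracket (x - y) z = sbracket x z - sbracket y z.
Proof.
rewrite /sbracket mulmxBl.
rewrite [in RHS]opprD [in RHS]addrACA -[in RHS]opprD; congr (_ - _).
rewrite -sumrB; apply: eq_bigr => i _; rewrite -sumrB; apply: eq_bigr => j _.
by rewrite linearB mulmxBr scalerBr.
Qed.

Lemma supertrace_sbracket (x y : M) : supertrace (sbracket x y) = 0.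
Proof.
rewrite -[x]submxK -[y]submxK sbracketE /mxpar.
rewrite !(block_mxKul, block_mxKur, block_mxKdl, block_mxKdr).
move: (ulsubmx x) (ursubmx x) (dlsubmx x) (drsubmx x) => x1 x2 x3 x4.
move: (ulsubmx y) (ursubmx y) (dlsubmx y) (drsubmx y) => y1 y2 y3 y4.
rewrite !mulmx_block !mulmx0 !mul0mx !addr0 !add0r.
rewrite !opp_block_mx !add_block_mx !oppr0 !addr0.
rewrite /supertrace block_mxKul block_mxKdr !mxtraceD.
rewrite !(raddfN (@mxtrace F r)) !(raddfN (@mxtrace F s)) /=.
rewrite (mxtrace_mulC y1) (mxtrace_mulC y2) (mxtrace_mulC y3) (mxtrace_mulC y4).
ring.
Qed.

End MatrixSuperalgebras.

Section LieSuperalgebraA.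
Variables (F : fieldType) (m n : nat).

(* sl(m+1|n+1) is divided by F I if m = n, and by 0 otherwise. *)
Definition Acenter : {vspace sl F m.+1 n.+1} :=
  if m == n then <[vsproj (slspace F m.+1 n.+1) 1%:M]>%VS else 0%VS.

Definition Alie : superalg F := quot_superalg Acenter.

(* meaningful on slspace only *)
Definition Acls (x : 'M[F]_(m.+1 + n.+1)) : Alie :=
  quotv_pi Acenter (vsproj (slspace F m.+1 n.+1) x).

Fact Acls_linear : linear Acls.
Proof. by move=> a x y; rewrite /Acls !linearP. Qed.
HB.instance Definition _ := GRing.isSemilinear.Build F _ Alie _ Acls
  (GRing.semilinear_linear Acls_linear).

Lemma Acls_surj (a : Alie) : exists2 x, x \in slspace F m.+1 n.+1 & Acls x = a.
Proof.
have [x <-] := quotv_pi_surj a.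
by exists (vsval x); rewrite ?subvsP // /Acls vsvalK.
Qed.

Lemma Acls_eq0 x : x \in slspace F m.+1 n.+1 ->
  (Acls x == 0) = (if m == n then x \in <[1%:M]>%VS else x == 0).
Proof.
move=> slx; rewrite /Acls quotv_pi_eq0 /Acenter.
have -> : (x == 0) = (vsproj (slspace F m.+1 n.+1) x == 0).
  by apply/eqP/eqP => [->|x0]; rewrite ?linear0 // -(vsprojK slx) x0.
case: eqP => [e|_]; last by rewrite memv0.
have sl1 : 1%:M \in slspace F m.+1 n.+1.
  rewrite mem_slspace /supertrace (@scalar_mx_block _ m.+1 n.+1).
  by rewrite block_mxKul block_mxKdr !mxtrace1 e subrr.
apply/vlineP/vlineP => [[k xk]|[k ->]]; exists k; last by rewrite linearZ.
by rewrite -[LHS](vsprojK slx) xk linearZ /= vsprojK.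
Qed.

Lemma quotv_repr_Acls x : x \in slspace F m.+1 n.+1 ->
  exists k, vsval (quotv_repr (Acls x)) = x - k%:M.
Proof.
move=> slx; set u := quotv_repr _.
have : Acls (x - vsval u) == 0.
  rewrite linearB subr_eq0 eq_sym; apply/eqP.
  by rewrite /= {1}/Acls vsvalK; apply: quotv_reprK.
rewrite Acls_eq0; last by rewrite memvB // subvsP.
case: ifP => _.
  move=> /vlineP[k e]; exists k.
  have -> : k%:M = k *: 1%:M :> 'M_(m.+1 + n.+1) by rewrite scalemx1.
  by rewrite -e opprB addrCA subrr addr0.
by rewrite subr_eq0 => /eqP <-; exists 0; rewrite raddf0 subr0.
Qed.

Lemma smul_Acls : {in slspace F m.+1 n.+1 &, forall x y,
  smul (Acls x) (Acls y) = Acls (sbracket x y)}.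
Proof.
move=> x y slx sly /=; rewrite /Acls; congr quotv_pi.
have [k ek] := quotv_repr_Acls slx; have [l el] := quotv_repr_Acls sly.
rewrite /Acls in ek el; rewrite ek el sbracketBl !sbracketBr.
by rewrite !(sbracket_scalarl, sbracket_scalarr) !subr0.
Qed.

Definition is_conj_even (f : 'End(Alie)) : Prop :=
  exists P : 'M[F]_(m.+1 + n.+1),
    [/\ P \in unitmx, P \in Mpar F m.+1 n.+1 false
      & {in slspace F m.+1 n.+1,
          forall x, f (Acls x) = Acls (P *m x *m invmx P)}].

Section AGradings.
Variable G : zmodType.

Definition induced_grading (M_ : G -> {vspace 'M[F]_(m.+1 + n.+1)}) (g : G) :
    {vspace Alie} :=
  (linfun Acls @: (slspace F m.+1 n.+1 :&: M_ g))%VS.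

Definition is_typeI (A_ : G -> {vspace Alie}) : Prop :=
  exists2 M_ : G -> {vspace Msuper F m.+1 n.+1},
    is_supergrading M_ & forall g, A_ g = induced_grading M_ g.

Definition is_even_typeI (A_ : G -> {vspace Alie}) : Prop :=
  is_typeI A_ /\
  forall chi : G -> F, is_character chi ->
    exists2 f : 'End(Alie), is_superaut f /\ is_conj_even f
      & forall g x, x \in A_ g -> f x = chi g *: x.

End AGradings.
End LieSuperalgebraA.

Section Bicharacters.
Variables (F : fieldType) (G : zmodType) (T : {fset G}) (beta : G -> G -> F).

Definition is_subgroup : Prop :=
  0 \in T /\ {in T &, forall u v, u - v \in T}.

(* Only the values of beta on T x T matter. *)
Definition is_nondeg_alt_bichar : Prop :=
  [/\ {in T &, forall u v, beta u v != 0},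
      {in T & &, forall u v w, beta (u + v) w = beta u w * beta v w},
      {in T & &, forall u v w, beta u (v + w) = beta u v * beta u w},
      {in T, forall u, beta u u = 1}
    & {in T, forall u, {in T, forall v, beta u v = 1} -> u = 0}].

End Bicharacters.

(* M_l(F) as a graded division algebra with support T, one-dimensional
   components and commutation factor beta *)
Definition is_graded_division (F : fieldType) (G : zmodType) (T : {fset G})
    (beta : G -> G -> F) (l : nat) (D : G -> {vspace 'M[F]_l}) : Prop :=
  [/\ is_grading (@mulmx F l l l) D,
      forall g x, x \in D g -> x != 0 -> x \in unitmx,
      forall g, \dim (D g) = (g \in T)
    & {in T &, forall u v, forall x y,
        x \in D u -> y \in D v -> x *m y = beta u v *: (y *m x)}].

Record gammaData (F : fieldType) (G : zmodType) (m n : nat) := GammaData {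
  gT : {fset G};
  gbeta : G -> G -> F;
  gell : nat;
  (* D is unique up to isomorphism given T and beta; it is kept as data. *)
  gD : G -> {vspace 'M[F]_gell};
  gk0 : nat;
  gk1 : nat;
  ggamma0 : gk0.-tuple G;
  ggamma1 : gk1.-tuple G;
  gT_subgroup : is_subgroup gT;
  gbetaP : is_nondeg_alt_bichar gT gbeta;
  gell_sqr : (gell * gell = #|` gT|)%N;
  gDP : is_graded_division gT gbeta gD;
  gk0P : (gk0 * gell = m.+1)%N;
  gk1P : (gk1 * gell = n.+1)%N }.

Section GammaGrading.
Variables (F : fieldType) (G : zmodType) (m n : nat) (p : gammaData F G m n).
Local Notation k0 := (gk0 p).
Local Notation k1 := (gk1 p).
Local Notation l := (gell p).

Fact gammaData_dim : ((k0 + k1) * l = m.+1 + n.+1)%N.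
Proof. by rewrite mulnDl gk0P gk1P. Qed.

(* E_ij (x) d; the index (i, a) of the Kronecker product is i * l + a, so the
   rows with i < k0 are the first m+1 ones. *)
Definition Etens (i j : 'I_(k0 + k1)) (d : 'M[F]_l) : 'M[F]_(m.+1 + n.+1) :=
  castmx (gammaData_dim, gammaData_dim) (tensmx (delta_mx i j) d).

Fact Etens_linear i j : linear (Etens i j).
Proof.
move=> a x y; apply/matrixP => u v.
by rewrite /Etens !(castmxE, mxE) mulrDr mulrCA.
Qed.
HB.instance Definition _ i j := GRing.isSemilinear.Build F _ _ _ (Etens i j)
  (GRing.semilinear_linear (Etens_linear i j)).

Definition ggamma (i : 'I_(k0 + k1)) : G :=
  tnth [tuple of ggamma0 p ++ ggamma1 p] i.

(* deg (E_ij (x) d) = g_i + deg d - g_j *)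
Definition GammaM (g : G) : {vspace 'M[F]_(m.+1 + n.+1)} :=
  (\sum_i \sum_j linfun (Etens i j) @: gD p (g - ggamma i + ggamma j)%R)%VS.

Definition GammaA : G -> {vspace Alie F m n} := induced_grading GammaM.

End GammaGrading.

Section Cosets.
Variables (G : zmodType) (T : {fset G}).

Definition translate (g : G) (C : {fset G}) : {fset G} :=
  [fset (g + x)%R | x in C]%fset.

Definition Xi (gamma : seq G) : {mset {fset G}}%mset :=
  seq_mset [seq translate g T | g <- gamma].

Definition mtranslate (g : G) (X : {mset {fset G}}%mset) : {mset {fset G}}%mset :=
  seq_mset [seq translate g C | C <- X].

End Cosets.

Definition tuple_pow (G : zmodType) (gamma : seq G) (delta : int) : seq G :=
  [seq g *~ delta | g <- gamma].

(* Main.v *)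
(* A Type I grading is given by a grading W of the matrix superalgebra M; write
   upsilon = diag(1, -1).  Conjugation by upsilon preserves every component of
   W, so upsilon is homogeneous, of some degree t; if the grading is even, every
   character takes the value 1 at t, hence t = 0.  The identity component then
   contains both diagonal projections.  Splitting them into primitive
   idempotents of the identity component gives a homogeneous system of matrix
   units over a graded division algebra D, i.e. a grading Gamma(T, beta,
   gamma_0, gamma_1).

   For the isomorphism problem, only the upper off-diagonal block is used.  An
   automorphism f of A(m, n) induces a map k of this block, into itself or
   (after a transposition) into the lower block, which intertwines the actions
   of the even part.  As the operators E_ij with i != j square to zero, k must
   be x |-> P x Q or, for m = n, x |-> P x^T Q.  Conjugation by diag(P, Q^-1) is
   then a graded isomorphism of the matrix superalgebras, from which T, beta and
   the cosets are read off.  No knowledge of Aut A(m, n) is needed; in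
   particular the exceptional automorphisms of psl(2|2) need no special
   treatment. *)

From HB Require Import structures.
Require Import Defs.
From mathcomp Require Import all_boot all_order all_algebra.
From mathcomp Require Import finmap multiset mxtens ring ssrAC.
From mathcomp Require boolp classical_sets.

Set Implicit Arguments.
Unset Strict Implicit.
Unset Printing Implicit Defensive.

Import GRing.Theory.
Local Open Scope ring_scope.

(** * Decompositions and characters *)

Section Decompositions.
Variables (F : fieldType) (G : zmodType) (V : vectType F).
Implicit Types (W : G -> {vspace V}) (S : {fset G}).

(** A Type I grading lives on M, but a character's action or an automorphism f is given only on sl,
    and only up to scalars when m = n. The trace form bridges this gap: in characteristic 0 the
    trace vanishes on every component of nonzero degree, so the components of degrees g and -g are
    in duality. This yields the homogeneous inverses from which D is built, and later the lower
    off-diagonal block from the upper one. It also shows that the components of E_ij, i != j, lie in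
    sl; as E_ii = E_ij E_ji, the action of a character on sl fixes what the conjugation does to
    diagonal matrices, hence to upsilon, although upsilon has supertrace m + n + 2 and is not in sl.
    As upsilon^2 = 1, its degree has order at most 2; a nontrivial one is detected by a character
    because the multiplicative group of F is divisible. In the isomorphism problem two binary
    choices occur: which off-diagonal block receives the upper one injectively, and whether the
    induced map transposes. Transposing exchanges the tuples; delta = -1 when exactly one of
    [landing below] and [transposing] occurs. *)

Definition is_decomp_by W S (pr : G -> 'End(V)) : Prop :=
  [/\ forall g, g \notin S -> W g = 0%VS,
      forall g x, pr g x \in W g,
      forall g h x, x \in W g -> pr h x = if h == g then x else 0
    & forall x, \sum_(g <- S) pr g x = x].

Lemma directv_fsetP W S :
  reflect (forall x_ : G -> V, (forall g, g \in S -> x_ g \in W g) ->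
             \sum_(g <- S) x_ g = 0 -> forall g, g \in S -> x_ g = 0)
          (directv (\sum_(g <- S) W g)).
Proof.
rewrite directvE /= !big_seq_fsetE /= -directvE.
apply: (iffP directv_sum_independent) => indep x_ Vx.
  rewrite big_seq_fsetE /= => x0 g Sg.
  by have := indep (fun h => x_ (val h)) (fun h _ => Vx _ (valP h)) x0 [` Sg]%fset isT.
move=> x0 g _; pose y_ h := if insub h is Some h' then x_ h' else 0.
have yE (h : S) : y_ (val h) = x_ h by rewrite /y_ valK.
rewrite -yE; apply: (indep y_) => [h Sh||]; last exact: valP.
  by rewrite -[h]/(val [` Sh]%fset) yE Vx.
by rewrite big_seq_fsetE -[RHS]x0; apply: eq_bigr => h _.
Qed.

(** Trades the direct sum for a finite family of linear projections; later degree arguments are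
    computations with [pr], which vanishes outside [S]. *)
Lemma is_decomp_by_exists W :
  is_decomposition W -> exists S pr, is_decomp_by W S pr.
Proof.
case=> S [V0 /directv_fsetP dV fV]; exists S.
pose pr g := if g \in S then sumv_pi (\sum_(h <- S) W h)%VS g else 0%VF.
have prV g x : pr g x \in W g.
  by rewrite /pr; case: ifP; rewrite ?memv_sum_pi // lfunE mem0v.
have prS x : \sum_(g <- S) pr g x = x.
  rewrite -[RHS](@sumv_pi_uniq_sum _ _ _ S xpredT W _ erefl); last 2 first.
  - by rewrite filter_predT fset_uniq.
  - by rewrite fV memvf.
  by apply: eq_big_seq => g Sg; rewrite /pr Sg.
exists pr; split=> // g h x Vx.
have [Sh|nSh] := boolP (h \in S); last first.
  rewrite {1}/pr (negPf nSh) lfunE /=; case: eqP => // e.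
  by move: Vx; rewrite -e V0 // memv0 => /eqP.
have [Sg|nSg] := boolP (g \in S); last first.
  move: Vx; rewrite V0 // memv0 => /eqP ->.
  by rewrite linear0 if_same.
have sumx : \sum_(k <- S) (if k == g then x else 0) = x.
  rewrite -big_mkcond /= -big_filter.
  suff -> : [seq k <- S | k == g] = [:: g] by rewrite big_seq1.
  by apply: filter_pred1_uniq; rewrite ?fset_uniq.
apply: subr0_eq.
apply: (dV (fun k => pr k x - (if k == g then x else 0)) _ _ h Sh) => [k Sk|].
  by rewrite memvB //; case: eqP => [->//|_]; rewrite mem0v.
by rewrite sumrB prS sumx subrr.
Qed.

(** Converse direction, with [pr] merely additive: applying [pr g] to a vanishing sum of homogeneous
    elements isolates its g-th term. *)
Lemma is_decomposition_intro W S (pr : G -> V -> V) :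
    (forall g, {morph pr g : x y / x + y}) ->
    (forall g, g \notin S -> W g = 0%VS) ->
    (forall g x, pr g x \in W g) ->
    (forall g h x, x \in W g -> pr h x = if h == g then x else 0) ->
    (forall x, \sum_(g <- S) pr g x = x) ->
  is_decomposition W.
Proof.
move=> prD V0 prV prE prS; exists S; split=> //.
  apply/directv_fsetP => x_ Vx x0 g Sg.
  have pr0 h : pr h 0 = 0 by rewrite (prE h) ?mem0v // if_same.
  have := pr0 g; rewrite -[in pr g _]x0 (big_morph _ (prD g) (pr0 g)).
  rewrite big_seq (eq_bigr (fun h => if h == g then x_ h else 0)); last first.
    by move=> h Sh; rewrite (prE h) ?Vx // eq_sym.
  rewrite -big_seq -big_mkcond /= -big_filter.
  suff -> : [seq k <- S | k == g] = [:: g] by rewrite big_seq1.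
  by apply: filter_pred1_uniq; rewrite ?fset_uniq.
apply/eqP; rewrite eqEsubv subvf; apply/subvP => x _.
rewrite -(prS x) big_seq; apply: memv_suml => g Sg; rewrite (big_fsetD1 g) //=.
by apply: (subvP (addvSl _ _)); apply: prV.
Qed.

End Decompositions.

(** * Extension of characters from subgroups *)

Section CharacterExtension.
Variables (F : closedFieldType) (G : zmodType).
Implicit Types (R : G -> F -> Prop).

(** [R] is the graph of a homomorphism from a subgroup of G to the multiplicative group of F. As
    relations, the members of a nonempty chain have their union as upper bound. *)
Definition is_partial_character R : Prop :=
  [/\ forall x a b, R x a -> R x b -> a = b,
      forall x a, R x a -> a != 0,
      forall x y a b, R x a -> R y b -> R (x - y) (a / b)
    & exists x a, R x a].

Lemma partial_character0 R : is_partial_character R -> R 0 1.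
Proof.
case=> _ nz sub [x [a Rxa]].
by have := sub _ _ _ _ Rxa Rxa; rewrite subrr divff // (nz x).
Qed.

Lemma partial_characterMz R x a (n : int) :
  is_partial_character R -> R x a -> R (x *~ n) (a ^ n).
Proof.
move=> PR Rxa; have [_ _ sub _] := PR; have R0 := partial_character0 PR.
have RN y b : R y b -> R (- y) b^-1.
  by move=> Ryb; have := sub _ _ _ _ R0 Ryb; rewrite sub0r div1r.
have RD y z b c : R y b -> R z c -> R (y + z) (b * c).
  by move=> Ryb /RN Rzc; have := sub _ _ _ _ Ryb Rzc; rewrite opprK invrK.
have Rn k : R (x *+ k) (a ^+ k).
  by elim: k => [|k IH]; rewrite ?mulr0n // mulrS exprS; apply: RD.
by case: n => k; [exact: Rn | rewrite NegzE mulrNz; apply: RN; exact: Rn].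
Qed.

(* Divisibility of the multiplicative group of F gives the value at a new
   element g: a k-th root of the value at k g for the least k with k g in the
   domain. *)
Lemma partial_character_value R (g : G) : is_partial_character R ->
  exists2 a, a != 0 & forall (n : int) d, R (g *~ n) d -> d = a ^ n.
Proof.
move=> PR; have [fct nz sub _] := PR; have R0 := partial_character0 PR.
pose P k := boolp.asbool ((0 < k)%N /\ exists c, R (g *+ k) c).
have [exP|nP] := boolp.EM (exists k, P k); last first.
  (* No positive multiple of g lies in the domain, so any value is allowed; a constraint at n forces
     n = 0. *)
  exists 1; rewrite ?oner_eq0 // => n d Rd; rewrite exp1rz.
  have [n0|n0] := eqVneq n 0; first by move: Rd; rewrite n0 mulr0z => /fct; apply.
  case: nP; exists `|n|%N; apply/boolp.asboolP; rewrite absz_gt0; split=> //.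
  case: n n0 Rd => k _ Rd; first by exists d.
  exists (1 / d); have := sub _ _ _ _ R0 Rd.
  by rewrite sub0r -mulrNz NegzE opprK.
case: (ex_minnP exP) => k /boolp.asboolP[k_gt0 [c Rc]] kmin.
have [a ak] : exists a, a ^+ k = c.
  have [a] := @solve_monicpoly F k (fun i => if i == 0%N then c else 0) k_gt0.
  rewrite (bigD1 (Ordinal k_gt0)) //= expr0 mulr1 big1 ?addr0; first by exists a.
  by move=> i; rewrite -val_eqE /= => /negPf->; rewrite mul0r.
have c0 : c != 0 by apply: nz Rc.
have a0 : a != 0 by apply: contraNneq c0 => a0; rewrite -ak a0 expr0n gtn_eqF.
exists a => // n d Rd; rewrite (divz_eq n k).
have kZ0 : k%:Z != 0 by rewrite eqz_nat gtn_eqF.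
have Rq := partial_characterMz (n %/ k)%Z PR Rc.
have /gez0_abs nk : 0 <= (n %% k)%Z by apply: modz_ge0.
have [r0|r0] := posnP `|(n %% k)%Z|%N.
  have n0 : (n %% k)%Z = 0 by apply/eqP; rewrite -absz_eq0 r0.
  rewrite n0 addr0 mulrC -exprz_exp -[a ^ k%:Z]/(a ^+ k) ak; apply: fct Rd _.
  by rewrite {1}(divz_eq n k) n0 addr0 mulrC mulrzA.
(* A nonzero remainder modulo k would give a smaller positive multiple of g in the domain. *)
have /kmin : P `|(n %% k)%Z|%N.
  apply/boolp.asboolP; split=> //.
  exists (d / c ^ (n %/ k)%Z); have := sub _ _ _ _ Rd Rq.
  rewrite {1}(divz_eq n k) mulrzDr mulrC mulrzA addrAC subrr add0r.
  by rewrite -[X in _ *~ X]nk.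
by rewrite leqNgt -ltz_nat nk ltz_pmod.
Qed.

(** The extension sends h + n g to chi(h) a^n; the compatibility of a with the old domain is exactly
    what makes this independent of the expression h + n g. *)
Lemma partial_character_extend R (g : G) : is_partial_character R ->
  exists R', [/\ is_partial_character R', forall x a, R x a -> R' x a
               & exists a, R' g a].
Proof.
move=> PR; have [a a0 Ra] := partial_character_value g PR.
have [fct nz sub _] := PR; have R0 := partial_character0 PR.
exists (fun x b => exists h c (n : int), [/\ x = h + g *~ n, R h c & b = c * a ^ n]).
split; [split| |].
- move=> x _ _ [h [c [n [-> Rc ->]]]] [h' [c' [n' [e Rc' ->]]]].
  have c'0 := nz _ _ Rc'; have an (i : int) : a ^ i != 0 by rewrite expfz_neq0.
  have : R (g *~ (n' - n)) (c / c').
    have -> : g *~ (n' - n) = h - h'; last exact: sub.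
    by rewrite mulrzBr -[h](addrK (g *~ n)) e addrAC [h' + _]addrC addrK.
  by move/Ra/eqP; rewrite expfzDr // -invr_expz (eqr_div _ _ c'0 (an n)) => /eqP ->; exact: mulrC.
- by move=> _ _ [h [c [n [_ /nz c0 ->]]]]; rewrite mulf_neq0 // expfz_neq0.
- move=> _ _ _ _ [h [c [n [-> Rc ->]]]] [h' [c' [n' [-> Rc' ->]]]].
  exists (h - h'), (c / c'), (n - n'); split; last 1 first.
  + by rewrite expfzDr // -invr_expz invfM mulrACA.
  + by rewrite mulrzBr opprD addrACA.
  exact: sub.
- by exists 0, 1, 0, 1, 0; rewrite mulr0z addr0 expr0z mulr1.
- by move=> x b Rxb; exists x, b, 0; rewrite mulr0z addr0 expr0z mulr1.
by exists a, 0, 1, 1; rewrite mulr1z add0r expr1z mul1r.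
Qed.

(** Zorn's lemma on the extensions of [R]; a maximal one is total by the one-element extension. The
    empty chain is bounded by [R] itself. *)
Lemma character_extend R : is_partial_character R ->
  exists2 chi : G -> F, is_character chi & forall x a, R x a -> chi x = a.
Proof.
move=> PR; pose T := {R' | is_partial_character R' /\ forall x a, R x a -> R' x a}.
pose le (r s : T) := boolp.asbool (forall x a, sval r x a -> sval s x a).
have t0 : T by exists R.
have [] := @classical_sets.ZL_preorder T t0 le.
- by move=> r; apply/boolp.asboolP.
- move=> r s t /boolp.asboolP rs /boolp.asboolP st; apply/boolp.asboolP => x a.
  by move/rs/st.
- move=> A totA; have [[r0 Ar0]|nA] := boolp.EM (exists r, A r); last first.
    by exists t0 => s As; case: nA; exists s.
  pose U x a := exists2 r : T, A r & sval r x a.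
  have tot r s : A r -> A s -> exists q : T,
      [/\ A q, forall x a, sval r x a -> sval q x a
        & forall x a, sval s x a -> sval q x a].
    by move=> Ar As; have [/boolp.asboolP|/boolp.asboolP] := totA _ _ Ar As;
      [exists s | exists r].
  have PU : is_partial_character U.
    split.
    + move=> x a b [r Ar ra] [s As sb]; have [q [_ rq sq]] := tot _ _ Ar As.
      by have [[fct _ _ _] _] := svalP q; apply: fct (rq _ _ ra) (sq _ _ sb).
    + by move=> x a [r Ar ra]; have [[_ nz _ _] _] := svalP r; apply: nz ra.
    + move=> x y a b [r Ar ra] [s As sb]; have [q [Aq rq sq]] := tot _ _ Ar As.
      by exists q => //; have [[_ _ sub _] _] := svalP q; apply: sub (rq _ _ ra) (sq _ _ sb).
    have [_ _ _ [x [a Rxa]]] := PR; exists x, a, r0 => //.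
    by have [_] := svalP r0; apply.
  have RU x a : R x a -> U x a.
    by move=> Rxa; exists r0 => //; have [_] := svalP r0; apply.
  exists (exist _ U (conj PU RU)) => s As; apply/boolp.asboolP => x a sa /=.
  by exists s.
move=> [M [PM RM]] Mmax.
have Mtot x : exists a, M x a.
  have [M' [PM' MM' [a M'a]]] := partial_character_extend x PM.
  have RM' y b : R y b -> M' y b by move/RM/MM'.
  have := Mmax (exist _ M' (conj PM' RM')) (introT (boolp.asboolP _) MM').
  by move/boolp.asboolP => /= M'M; exists a; apply: M'M.
have [chi chiP] := boolp.choice Mtot; have [fct nz sub _] := PM.
have M0 := partial_character0 PM.
exists chi => [|x a /RM]; last by apply: fct.
split=> [g|g h]; first exact: nz (chiP g).
apply: fct (chiP _) _; have := sub _ _ _ _ (chiP g) (sub _ _ _ _ M0 (chiP h)).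
by rewrite sub0r opprK div1r invrK.
Qed.

(** An element of order 2 may take the value -1, which differs from 1 as 2 is nonzero in F; this
    character of {0, t} is then extended to G. *)
Lemma character_neq1 (t : G) : 2%:R != 0 :> F -> t != 0 -> t + t = 0 ->
  exists2 chi : G -> F, is_character chi & chi t != 1.
Proof.
move=> two0 t0 tt0; have m1 : -1 != 1 :> F.
  by rewrite -subr_eq0 -opprD oppr_eq0 -mulr2n.
have tN : - t = t by apply/eqP; rewrite eq_sym -addr_eq0 tt0.
pose R (x : G) (a : F) := (x = 0 /\ a = 1) \/ (x = t /\ a = -1).
have [] := @character_extend R; last first.
  by move=> chi chiP chiR; exists chi => //; rewrite (chiR t (-1)) //; right.
have e0 : 0 <> t by move=> /esym/eqP; apply/negP.
split.
- by move=> x a b [[-> ->]|[-> ->]] [[e ->]|[e ->]] //; case: e0.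
- by move=> x a [[_ ->]|[_ ->]]; rewrite ?oppr_eq0 oner_eq0.
- move=> x y a b [[-> ->]|[-> ->]] [[-> ->]|[-> ->]].
  + by left; rewrite subrr divff ?oner_eq0.
  + by right; rewrite sub0r tN invrN invr1 mulrN1.
  + by right; rewrite subr0 invr1 mulr1.
  by left; rewrite subrr divff // oppr_eq0 oner_eq0.
by exists 0, 1; left.
Qed.

End CharacterExtension.

(** * Gradings on matrix algebras *)

Section MatrixFacts.
Variable F : fieldType.

Lemma mxtrace_mul_delta m n (x : 'M[F]_(m, n)) i j : \tr (x *m delta_mx j i) = x i j.
Proof.
rewrite /mxtrace (bigD1 i) //= big1 ?addr0 => [|k /negPf ki].
  rewrite mxE (bigD1 j) //= big1 ?addr0 ?mxE ?eqxx ?mulr1 // => k /negPf kj.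
  by rewrite mxE kj mulr0.
by rewrite mxE big1 // => l _; rewrite mxE ki andbF mulr0.
Qed.

Lemma mul_delta_mxE m n p q (x : 'M[F]_(n, p)) (i : 'I_m) k l (j : 'I_q) :
  delta_mx i k *m x *m delta_mx l j = x k l *: delta_mx i j.
Proof.
have -> : delta_mx i k *m x = \matrix_(a, b) ((a == i)%:R * x k b).
  apply/matrixP => a b; rewrite !mxE (bigD1 k) //= big1 ?addr0 => [|c /negPf ck].
    by rewrite mxE eqxx andbT.
  by rewrite mxE ck andbF mul0r.
apply/matrixP => a b; rewrite !mxE (bigD1 l) //= big1 ?addr0 => [|c /negPf cl].
  by rewrite !mxE eqxx /= mulrAC mulrC; case: (a == i); rewrite ?mul1r ?mul0r.
by rewrite !mxE cl mulr0.
Qed.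

Lemma mx_neq0P m n (x : 'M[F]_(m, n)) : x != 0 -> exists i j, x i j != 0.
Proof.
move=> x0; case: (pickP (fun ij => x ij.1 ij.2 != 0)) => [[i j] /= xij|all0].
  by exists i, j.
case/eqP: x0; apply/matrixP => i j; rewrite mxE.
by have /negbFE/eqP := all0 (i, j).
Qed.

Lemma mx_prime m n p q (a : 'M[F]_(m, n)) (b : 'M[F]_(p, q)) :
  a != 0 -> b != 0 -> exists z, a *m z *m b != 0.
Proof.
move=> /mx_neq0P[i [k aik]] /mx_neq0P[l [j blj]]; exists (delta_mx k l).
apply: contraNneq (mulf_neq0 aik blj) => /(congr1 (fun x : 'M_(m, q) => x i j)).
rewrite !mxE (bigD1 l) //= big1 ?addr0 => [|c /negPf cl].
  rewrite mxE (bigD1 k) //= big1 ?addr0 => [|c /negPf ck].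
    by rewrite mxE !eqxx mulr1 => ->.
  by rewrite mxE ck mulr0.
rewrite mxE big1 ?mul0r // => d _; by rewrite mxE cl andbF mulr0.
Qed.

Lemma commutant_scalar n (x : 'M[F]_n) :
  (forall y, x *m y = y *m x) -> exists c, x = c%:M.
Proof.
case: n x => [|n] x xC; first by exists 0; apply/matrixP => -[[]].
exists (x 0 0); apply/matrixP => i j; rewrite mxE.
have : delta_mx 0 i *m x *m delta_mx j 0 = x *m delta_mx (0 : 'I_n.+1) i *m delta_mx j (0 : 'I_n.+1).
  by rewrite xC.
move/(congr1 (fun y : 'M_n.+1 => y 0 0)); rewrite mul_delta_mxE -mulmxA.
rewrite mul_delta_mx_cond !mxE eqxx mulr1 => ->.
rewrite (bigD1 0) //= big1 ?addr0 => [|k /negPf k0]; last first.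
  by rewrite mulmxnE mxE k0 mul0rn mulr0.
by rewrite mulmxnE mxE !eqxx mulrnAr mulr1.
Qed.

(** E_ij = E_i0 E_0j, while E_0j E_i0 is E_00 or 0 according to i = j; so f is determined by its
    value at E_00. *)
Lemma functional_trace n (f : 'M[F]_n -> F) :
    (forall a x y, f (a *: x + y) = a * f x + f y) ->
    (forall x y, f (x *m y) = f (y *m x)) ->
  exists c, forall x, f x = c * \tr x.
Proof.
move=> flin fC; case: n f flin fC => [|n] f flin fC.
  exists 0 => x; rewrite mul0r; have := flin (-1) 0 0.
  by rewrite scaler0 addr0 mulN1r addNr => f0; rewrite -[RHS]f0; congr f; apply/matrixP => -[[]].
have f0 : f 0 = 0 by have := flin (-1) 0 0; rewrite scaler0 addr0 mulN1r addNr.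
have fZ a x : f (a *: x) = a * f x by rewrite -[a *: x]addr0 flin f0 addr0.
have fD x y : f (x + y) = f x + f y by rewrite -[x]scale1r flin mul1r scale1r.
exists (f (delta_mx 0 0)) => x; rewrite {1}[x]matrix_sum_delta.
rewrite (big_morph f fD f0) mulrC /mxtrace mulr_suml; apply: eq_bigr => i _.
rewrite (big_morph f fD f0) (bigD1 i) //= big1 ?addr0 => [|j ji].
  by rewrite fZ -(mul_delta_mx (0 : 'I_n.+1)) fC mul_delta_mx.
rewrite fZ -(mul_delta_mx i) fC mul_delta_mx_cond.
by rewrite (negPf ji) mulr0n f0 mulr0.
Qed.

End MatrixFacts.

(* Away from its generalised kernel z is invertible, so a polynomial in z
   without constant term is the projection along that kernel. *)
Lemma idempotent_in_subalgebra (F : closedFieldType) n (z : 'M[F]_n)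
    (U : {vspace 'M[F]_n}) :
    z \in U -> {in U &, forall x y, x *m y \in U} -> \tr z != 0 ->
  exists e w, [/\ e \in U, w \in U, e = z *m w, e *m e = e & e != 0].
Proof.
case: n z U => [|n] z U Uz UM trz; first by rewrite /mxtrace big_ord0 eqxx in trz.
have UX k : z ^+ k.+1 \in U by elim: k => // k IH; rewrite exprS UM.
have Up (p : {poly F}) : horner_mx z (p * 'X) \in U.
  rewrite -[p]coefK poly_def mulr_suml rmorph_sum /= memv_suml // => i _.
  by rewrite -scalerAl -exprSr linearZ /= rmorphXn /= horner_mx_X memvZ // UX.
have [k [q qa chiE]] := multiplicity_XsubC (char_poly z) 0.
move: qa chiE; rewrite -size_poly_eq0 size_char_poly /= polyC0 subr0 => q0 chiE.
have q_nz : q != 0 by apply: contraNneq q0 => ->; rewrite root0.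
(* A constant q would make the characteristic polynomial a power of X, hence the trace of z zero.
   The eigenvalue a is used at the end to show that e is nonzero. *)
have [a qa] : exists a, root q a.
  apply/closed_rootP; apply/negP => /size_poly1P[c c0 qE].
  have qc : c = 1.
    have := char_poly_monic z; rewrite chiE qE monicE.
    by rewrite lead_coefM lead_coefC lead_coefXn mulr1 => /eqP.
  have kE : k = n.+1.
    apply: succn_inj; rewrite -(size_char_poly z) chiE qE qc mul1r.
    by rewrite size_polyXn.
  have := char_poly_trace z isT; rewrite chiE qE qc mul1r coefXn kE /=.
  by rewrite ltn_eqF // => /esym/eqP; rewrite oppr_eq0 (negPf trz).
(* The exponent is k + 1 rather than k so that u X^(k+1) has no constant term even when k = 0: [U]
   need not contain the identity. *)
have cop : coprimep ('X^(k.+1)) q.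
  by rewrite coprimep_pexpl // coprimep_sym coprimepX.
have [[u v] /= uvE] := Bezout_eq1_coprimepP _ _ cop.
set e := horner_mx z (u * 'X^(k.+1)).
have eC : e *m (1%:M - e) = 0.
  have -> : 1%:M - e = horner_mx z (v * q).
    by rewrite -[v * q](addKr (u * 'X^(k.+1))) uvE [- _ + 1]addrC rmorphB /= (rmorph1 (horner_mx z)).
  rewrite -[LHS]/(horner_mx z (u * 'X^(k.+1)) * horner_mx z (v * q)) -rmorphM /=.
  have -> : u * 'X^(k.+1) * (v * q) = u * v * 'X * char_poly z.
    by rewrite chiE exprS; ring.
  by rewrite rmorphM /= Cayley_Hamilton mulr0.
have ee : e *m e = e by apply/eqP; rewrite -subr_eq0 -[X in _ - X]mulmx1 -mulmxBr -opprB mulmxN eC oppr0.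
have Ue : e \in U by rewrite /e exprSr mulrA Up.
have zw : e = z *m horner_mx z (u * 'X^k).
  by rewrite {1}/e exprSr mulrA mulrC rmorphM /= horner_mx_X.
exists e, (horner_mx z (u * 'X^k) *m e); split=> //.
- case: (k) => [|k']; last by rewrite UM // exprSr mulrA Up.
  rewrite expr0 mulr1 /e exprSr mulrA.
  rewrite -[_ *m _]/(horner_mx z u * horner_mx z (u * 'X^k * 'X)) -rmorphM /=.
  by rewrite mulrA Up.
- by rewrite mulmxA -zw ee.
(* If e = 0 then v(z) q(z) = 1, although q(z) kills an eigenvector of z for a. *)
apply/eqP => e0; have vq1 : horner_mx z v *m horner_mx z q = 1%:M.
  rewrite -[LHS]/(horner_mx z v * horner_mx z q) -rmorphM /=.
  by rewrite -[v * q](addKr (u * 'X^(k.+1))) uvE [- _ + 1]addrC rmorphB /= (rmorph1 (horner_mx z)) -/e e0 subr0.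
have : eigenvalue z a by rewrite eigenvalue_root_char chiE rootM qa.
case/eigenvalueP => w wz w0; case/eqP: w0.
have wX (p : {poly F}) : w *m horner_mx z p = p.[a] *: w.
  elim/poly_ind: p => [|p c IH]; first by rewrite rmorph0 mulmx0 horner0 scale0r.
  rewrite rmorphD rmorphM /= horner_mx_X horner_mx_C mulmxDr mulmxA IH.
  by rewrite -scalemxAl wz mul_mx_scalar scalerA -scalerDl hornerMXaddC.
by rewrite -[w]mulmx1 -vq1 mulmxA wX -scalemxAl wX (rootP qa) scale0r scaler0.
Qed.

Lemma sum_fset_if (I : choiceType) (V : zmodType) (S : {fset I}) (a : I) (f : I -> V) :
  \sum_(g <- S) (if g == a then f g else 0) = if a \in S then f a else 0.
Proof.
rewrite -big_mkcond /= -big_filter; have [Sa|nSa] := boolP (a \in S).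
  by rewrite (@filter_pred1_uniq _ S a) ?fset_uniq // big_seq1.
rewrite (_ : [seq g <- S | g == a] = [::]) ?big_nil //.
by apply/eqP; rewrite -[_ == _]negbK -has_filter has_pred1.
Qed.

Section MatrixGradings.
Variables (F : fieldType) (G : zmodType) (N : nat).
Variable (W : G -> {vspace 'M[F]_N}).
Hypothesis Wgr : is_grading (@mulmx F N N N) W.

Lemma grading_mul g h x y : x \in W g -> y \in W h -> x *m y \in W (g + h).
Proof. by case: Wgr => _; apply. Qed.

Lemma grading_corner g a x b :
  a \in W 0 -> x \in W g -> b \in W 0 -> a *m x *m b \in W g.
Proof.
move=> Wa Wx Wb; have := grading_mul (grading_mul Wa Wx) Wb.
by rewrite add0r addr0.
Qed.

(** For y of degree h, the component of degree h of 1 y is 1_0 y; so the component 1_0 of degree 0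
    is a left identity on homogeneous elements, and equals 1. *)
Lemma grading_one : 1%:M \in W 0.
Proof.
have [S [pr [W0 prW prE prS]]] := is_decomp_by_exists Wgr.1.
suff e1 (x : 'M_N) : pr 0 1%:M *m x = x by rewrite -[1%:M]e1 mulmx1.
have e1W h y : y \in W h -> pr 0 1%:M *m y = y.
  move=> Wy; have := prE _ h _ Wy; rewrite eqxx -[in pr h y](mul1mx y).
  rewrite -[in 1%:M *m y](prS 1%:M) mulmx_suml linear_sum /=.
  rewrite (eq_bigr (fun g => if g == 0 then pr 0 1%:M *m y else 0)).
    rewrite sum_fset_if; case: ifP => // S0 <-.
    have := prW 0 1%:M; rewrite W0 ?S0 // memv0 => /eqP ->.
    by rewrite mul0mx.
  move=> g _; rewrite (prE (g + h)); last exact: grading_mul (prW _ _) Wy.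
  by rewrite -{1}[h]add0r (inj_eq (addIr h)) eq_sym; case: eqP => [->|].
rewrite -{2}(prS x) -{1}(prS x) mulmx_sumr.
by apply: eq_bigr => g _; apply: e1W (prW _ _).
Qed.

Hypothesis N_neq0 : N%:R != 0 :> F.

(** The functional x |-> tr(x_0) vanishes on commutators because G is abelian, so it is a multiple
    of the trace; evaluation at 1, of degree 0, gives the factor 1 since N is nonzero in F. *)
Lemma grading_trace0 g x : g != 0 -> x \in W g -> \tr x = 0.
Proof.
have [S [pr [W0 prW prE prS]]] := is_decomp_by_exists Wgr.1.
have [||c fE] := @functional_trace _ N (fun y => \tr (pr 0 y)).
- by move=> a y z; rewrite !linearP.
- move=> y z; rewrite -(prS y) -(prS z) mulmx_suml mulmx_sumr !linear_sum /=.
  apply: eq_bigr => h _; rewrite mulmx_sumr mulmx_suml !linear_sum /=.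
  apply: eq_bigr => k _.
  rewrite (prE (h + k) 0 (pr h y *m _)) ?(prE (k + h) 0 (pr k z *m _)); try exact: grading_mul (prW _ _) (prW _ _).
  by rewrite addrC; case: ifP => _; rewrite ?raddf0 // mxtrace_mulC.
move=> g0 Wx; have := fE 1%:M; rewrite (prE 0) ?grading_one // eqxx mxtrace1.
rewrite -{1}[N%:R]mul1r => /(mulIf N_neq0) c1.
by rewrite -[\tr x]mul1r c1 -fE (prE g) // eq_sym (negPf g0) mxtrace0.
Qed.

(** The trace form is nondegenerate and pairs W g only with W (- g): the partner of x is a component
    of the matrix unit dual to a nonzero entry of x. *)
Lemma grading_trace_pairing g x : x \in W g -> x != 0 ->
  exists2 y, y \in W (- g) & \tr (x *m y) != 0.
Proof.
move=> Wx /mx_neq0P[i [j xij]].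
have [S [pr [W0 prW prE prS]]] := is_decomp_by_exists Wgr.1.
exists (pr (- g) (delta_mx j i)) => //.
suff -> : \tr (x *m pr (- g) (delta_mx j i)) = x i j by [].
rewrite -[RHS]mxtrace_mul_delta -[in RHS](prS (delta_mx j i)) mulmx_sumr linear_sum /=.
rewrite [RHS](eq_bigr (fun h => if h == - g then \tr (x *m pr (- g) (delta_mx j i)) else 0)).
  rewrite sum_fset_if; case: ifP => // S0.
  have := prW (- g) (delta_mx j i); rewrite W0 ?S0 // memv0 => /eqP ->.
  by rewrite mulmx0 mxtrace0.
move=> h _; case: eqP => [->//|/eqP hg]; apply: (@grading_trace0 (g + h)).
  by rewrite addrC addr_eq0.
exact: grading_mul.
Qed.

End MatrixGradings.

(** * Primitive idempotents of the identity component *)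

Section PrimitiveIdempotents.
Variables (F : closedFieldType) (G : zmodType) (N : nat).
Variable (W : G -> {vspace 'M[F]_N}).
Hypothesis Wgr : is_grading (@mulmx F N N N) W.
Hypothesis N_neq0 : N%:R != 0 :> F.

Definition primitive (e : 'M[F]_N) : Prop :=
  [/\ e \in W 0, e *m e = e, e != 0
    & forall f, f \in W 0 -> f *m f = f -> e *m f = f -> f *m e = f ->
        f = 0 \/ f = e].

(** The trace pairing gives z = x (e' y0 e) in e W_0 e with nonzero trace, hence a nonzero
    idempotent of the form z w; by primitivity it is e, so x has a right inverse y. Then y x is a
    nonzero idempotent below e', hence e'. This is where graded division comes from. *)
Lemma primitive_inverse e e' g x : primitive e -> primitive e' ->
    x \in W g -> x != 0 -> e *m x = x -> x *m e' = x ->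
  exists y, [/\ y \in W (- g), e' *m y = y, y *m e = y, x *m y = e & y *m x = e'].
Proof.
move=> [W0e ee e0 eP] [W0e' e'e' e'0 e'P] Wx x0 ex xe'.
have [y0 Wy0 try0] := grading_trace_pairing Wgr N_neq0 Wx x0.
have mul0 u v : u \in W 0 -> v \in W 0 -> u *m v \in W 0.
  by move=> Wu Wv; rewrite -[0]addr0; apply: grading_mul.
pose U := (linfun (mulmxr e \o mulmx e) @: W 0)%VS.
have UP u : u \in U -> [/\ u \in W 0, e *m u = u & u *m e = u].
  case/memv_imgP => v Wv ->; rewrite lfunE /=.
  by split; rewrite ?mul0 // ?mulmxA ?ee // -!mulmxA ee.
have memU u : u \in W 0 -> e *m u = u -> u *m e = u -> u \in U.
  by move=> Wu eu ue; apply/memv_imgP; exists u; rewrite // lfunE /= eu ue.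
pose z := x *m (e' *m y0 *m e).
have Wy1 : e' *m y0 *m e \in W (- g).
  exact: grading_corner.
have Uz : z \in U.
  apply: memU; rewrite /z.
  - by rewrite -(subrr g) grading_mul.
  - by rewrite !mulmxA ex.
  - by rewrite -!mulmxA ee.
have UM : {in U &, forall u v, u *m v \in U}.
  move=> u v /UP[Wu eu _] /UP[Wv _ ve]; apply: memU; rewrite ?mul0 //.
    by rewrite mulmxA eu.
  by rewrite -mulmxA ve.
have trz : \tr z != 0.
  by rewrite /z !mulmxA xe' mxtrace_mulC mulmxA ex.
have [f [w [/UP[Wf ef fe] /UP[Ww ew we] fzw ff f0]]] := idempotent_in_subalgebra Uz UM trz.
have fE : f = e by case: (eP f) => // f00; rewrite f00 eqxx in f0.
exists (e' *m y0 *m e *m w).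
have Wy : e' *m y0 *m e *m w \in W (- g) by rewrite -[- g]addr0 grading_mul.
have xy : x *m (e' *m y0 *m e *m w) = e by rewrite mulmxA -/z -fzw.
split=> //; first by rewrite !mulmxA e'e'.
  by rewrite -[LHS]mulmxA we.
case: (e'P (e' *m y0 *m e *m w *m x)) => //.
- by rewrite -(addNr g) grading_mul.
- by rewrite -[in LHS](mulmxA _ x) [x *m (_ *m x)]mulmxA xy ex.
- by rewrite !mulmxA e'e'.
- by rewrite -[LHS]mulmxA xe'.
move/(congr1 (mulmx x)); rewrite mulmxA xy ex mulmx0 => x00.
by rewrite x00 eqxx in x0.
Qed.

Lemma sum_orthogonal_mul (s : seq 'M[F]_N) a : uniq s -> a \in s ->
    a *m a = a -> {in s &, forall b c, b != c -> b *m c = 0} ->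
  (\sum_(b <- s) b) *m a = a /\ a *m (\sum_(b <- s) b) = a.
Proof.
move=> us sa aa orth; rewrite mulmx_suml mulmx_sumr !(bigD1_seq a) //= aa.
by split; rewrite big_seq_cond big1 ?addr0 // => b /andP[sb ba];
  apply: orth => //; rewrite eq_sym.
Qed.

(** Induction on the rank: a non-primitive e splits as f + (e - f), and an idempotent h below e with
    the rank of e has the same row space, which forces h = e. *)
Lemma primitive_decomposition e : e \in W 0 -> e *m e = e ->
  exists s : seq 'M[F]_N,
    [/\ uniq s, forall a, a \in s -> primitive a,
        {in s &, forall a b, a != b -> a *m b = 0} & \sum_(a <- s) a = e].
Proof.
have [r] := ubnP (\rank e); elim: r e => // r IHr e rk W0e ee.
have [->|e0] := eqVneq e 0; first by exists [::]; split; rewrite ?big_nil.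
have [pe|npe] := boolp.EM (primitive e).
  exists [:: e]; split=> // [a|a b|]; rewrite ?inE ?big_seq1 // => /eqP-> //.
  by move=> /eqP->; rewrite eqxx.
have [f [[W0f ff ef fe] f0 f1]] : exists f,
    [/\ [/\ f \in W 0, f *m f = f, e *m f = f & f *m e = f], f != 0 & f != e].
  apply: boolp.contrapT => nf; apply: npe; split=> // f W0f ff ef fe.
  have [f0|f0] := eqVneq f 0; first by left.
  have [f1|f1] := eqVneq f e; first by right.
  by case: nf; exists f.
have rank_lt h : h *m h = h -> e *m h = h -> h *m e = h -> h != e ->
    (\rank h < \rank e)%N.
  move=> hh eh he; rewrite ltnNge; apply: contraNN => rk_le.
  have he_sub : (h <= e)%MS by rewrite -he submxMl.
  have := mxrank_leqif_sup he_sub => /leqifP; case: ifP => [eh_sub _|_]; last by rewrite ltnNge rk_le.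
  by case/submxP: eh_sub => D eD; rewrite -eh {1}eD -mulmxA hh -eD.
pose h := e - f.
have eh : e *m h = h by rewrite /h mulmxBr ee ef.
have he : h *m e = h by rewrite /h mulmxBl ee fe.
have fh : f *m h = 0 by rewrite /h mulmxBr fe ff subrr.
have hf : h *m f = 0 by rewrite /h mulmxBl ef ff subrr.
have hh : h *m h = h by rewrite {1}/h mulmxBl eh fh subr0.
have h1 : h != e by rewrite /h -subr_eq0 addrAC subrr add0r oppr_eq0.
have W0h : h \in W 0 by rewrite memvB.
have [s [us sP so sE]] := IHr f (leq_trans (rank_lt _ ff ef fe f1) rk) W0f ff.
have [t [ut tP to tE]] := IHr h (leq_trans (rank_lt _ hh eh he h1) rk) W0h hh.
have sf a : a \in s -> f *m a = a /\ a *m f = a.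
  by move=> sa; rewrite -sE; apply: sum_orthogonal_mul => //; have [] := sP _ sa.
have th a : a \in t -> h *m a = a /\ a *m h = a.
  by move=> ta; rewrite -tE; apply: sum_orthogonal_mul => //; have [] := tP _ ta.
exists (s ++ t); split.
- rewrite cat_uniq us ut andbT /=; apply/hasPn => a ta; apply/negP => sa.
  have [_ _ /eqP a0 _] := tP _ ta; apply: a0.
  by rewrite -(th _ ta).1 -(sf _ sa).1 mulmxA hf mul0mx.
- by move=> a; rewrite mem_cat => /orP[/sP|/tP].
- move=> a b; rewrite !mem_cat => /orP[sa|ta] /orP[sb|tb] ab.
  + exact: so.
  + by rewrite -(sf _ sa).2 -(th _ tb).1 mulmxA -(mulmxA a) fh mulmx0 mul0mx.
  + by rewrite -(th _ ta).2 -(sf _ sb).1 mulmxA -(mulmxA a) hf mulmx0 mul0mx.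
  + exact: to.
by rewrite big_cat /= sE tE /h addrC subrK.
Qed.

End PrimitiveIdempotents.

(** * The homogeneous matrix units of Gamma(T, beta, gamma_0, gamma_1) *)

Section ParityProjections.
Variables (F : fieldType) (r s : nat).
Local Notation M := 'M[F]_(r + s).

Definition eps (b : bool) : M :=
  if b then block_mx 0 0 0 1%:M else block_mx 1%:M 0 0 0.

Lemma eps_mul a b : eps a *m eps b = if a == b then eps a else 0.
Proof.
by case: a b => [] [] /=; rewrite mulmx_block !(mulmx0, mul0mx, mulmx1, addr0, add0r) ?block_mx0.
Qed.

Lemma eps_sum : eps false + eps true = 1%:M.
Proof. by rewrite add_block_mx !(addr0, add0r) -scalar_mx_block. Qed.

Lemma mxparE i (x : M) :
  mxpar i x = eps false *m x *m eps i + eps true *m x *m eps (~~ i).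
Proof.
rewrite -[x]submxK /mxpar !(block_mxKul, block_mxKur, block_mxKdl, block_mxKdr).
by case: i; rewrite /= !mulmx_block !(mulmx0, mul0mx, mul1mx, mulmx1, addr0, add0r)
  add_block_mx !(addr0, add0r).
Qed.

Lemma epsE b i j : eps b i j = ((i == j) && ((r <= i)%N == b))%:R.
Proof.
case: (splitP i) (splitP j) => i' ii [] j' jj; rewrite -val_eqE /= ii jj /eps.
- have -> : i = lshift s i' by apply: val_inj.
  have -> : j = lshift s j' by apply: val_inj.
  rewrite leqNgt ltn_ord /=; case: b; rewrite ?block_mxEul mxE ?andbF ?andbT //.
- have -> : i = lshift s i' by apply: val_inj.
  have -> : j = rshift r j' by apply: val_inj.
  rewrite ltn_eqF ?(leq_trans (ltn_ord i')) ?leq_addr //=.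
  by case: b; rewrite block_mxEur mxE.
- have -> : i = rshift r i' by apply: val_inj.
  have -> : j = lshift s j' by apply: val_inj.
  rewrite gtn_eqF ?(leq_trans (ltn_ord j')) ?leq_addr //=.
  by case: b; rewrite block_mxEdl mxE.
have -> : i = rshift r i' by apply: val_inj.
have -> : j = rshift r j' by apply: val_inj.
rewrite leq_addr eqn_add2l; case: b; rewrite ?block_mxEdr mxE ?andbF ?andbT //.
Qed.

Lemma mul_eps b k (u : 'M[F]_(r + s, k)) :
  (forall i j, u i j != 0 -> (r <= i)%N == b) -> eps b *m u = u.
Proof.
move=> ub; apply/matrixP => i j; rewrite mxE (bigD1 i) //= big1 ?addr0.
  rewrite epsE eqxx /=; have [->|/ub ->] := eqVneq (u i j) 0; rewrite ?mulr0 //.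
  by rewrite mul1r.
by move=> k' /negPf ki; rewrite epsE eq_sym ki mul0r.
Qed.

Lemma tr_eps b : (eps b)^T = eps b.
Proof.
apply/matrixP => i j; rewrite mxE !epsE eq_sym.
by case: eqP => // ->.
Qed.

End ParityProjections.
Arguments eps {F r s} b : simpl never.

Section GammaFrame.
Variables (F : fieldType) (G : zmodType) (m n : nat) (p : gammaData F G m n).
Local Notation k := (gk0 p + gk1 p)%N.
Local Notation l := (gell p).
Local Notation M := 'M[F]_(m.+1 + n.+1).
Implicit Types (i j : 'I_k).

Definition gidx (a : 'I_(m.+1 + n.+1)) : 'I_k * 'I_l :=
  mxtens_unindex (cast_ord (esym (gammaData_dim p)) a).

(** [gu i] and [gv i] are the injection and the projection of the i-th copy of F^l, so that E_ij (x)
    d is [gu i *m d *m gv j]; casts and Kronecker indices are confined to this encoding. *)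
Definition gu i : 'M[F]_(m.+1 + n.+1, l) := \matrix_(a, b) (gidx a == (i, b))%:R.

Definition gv i : 'M[F]_(l, m.+1 + n.+1) := (gu i)^T.

Definition gpar i : bool := (gk0 p <= i)%N.

Lemma gidx_bij : bijective gidx.
Proof.
exists (fun ib => cast_ord (gammaData_dim p) (mxtens_index ib)) => [a|ib].
  by rewrite /gidx mxtens_unindexK cast_ordKV.
by rewrite /gidx cast_ordK mxtens_indexK.
Qed.

Lemma gvu i j : gv i *m gu j = if i == j then 1%:M else 0.
Proof.
apply/matrixP => b c; rewrite mxE.
transitivity (\sum_ib ((ib == (i, b))%:R * (ib == (j, c))%:R : F)).
  rewrite [RHS](reindex gidx) /=; last exact: onW_bij gidx_bij.
  by apply: eq_bigr => a _; rewrite !mxE.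
rewrite (bigD1 (i, b)) //= big1 ?addr0 => [|ib /negPf ->]; last by rewrite mul0r.
by rewrite eqxx mul1r xpair_eqE; case: eqP; rewrite mxE.
Qed.

Lemma gu_sum : \sum_i gu i *m gv i = 1%:M.
Proof.
apply/matrixP => a a'; rewrite summxE.
rewrite (eq_bigr (fun i => \sum_b (gidx a == (i, b))%:R * (gidx a' == (i, b))%:R)); last first.
  by move=> i _; rewrite mxE; apply: eq_bigr => b _; rewrite !mxE.
rewrite pair_bigA (bigD1 (gidx a)) // big1 ?addr0 => [|[i b]]; last first.
  by rewrite eq_sym => /negPf nib; rewrite nib mul0r.
rewrite -surjective_pairing eqxx mul1r mxE eq_sym.
by rewrite (inj_eq (bij_inj gidx_bij)) /= addr0.
Qed.

Lemma EtensE i j (d : 'M[F]_l) : Etens i j d = gu i *m d *m gv j.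
Proof.
apply/matrixP => a b; rewrite castmxE !mxE (bigD1 (gidx b).2) //= big1 ?addr0.
  rewrite mxE (bigD1 (gidx a).2) //= big1 ?addr0 => [|c /negPf ca].
    rewrite !mxE -!pair_eqE /= !eqxx !andbT -/(gidx a) -/(gidx b).
    by case: eqP => _; case: eqP => _; rewrite /= ?mulr0 ?mul0r ?mulr1 ?mul1r.
  by rewrite mxE -pair_eqE /= [_ == c]eq_sym ca andbF mul0r.
by move=> c /negPf cb; rewrite !mxE -pair_eqE /= [_ == c]eq_sym cb andbF mulr0.
Qed.

Lemma gu_par i : eps (gpar i) *m gu i = gu i.
Proof.
apply: mul_eps => a b; rewrite mxE; have [e _|_] := eqVneq (gidx a) (i, b); last by rewrite eqxx.
have : val (cast_ord (esym (gammaData_dim p)) a) = (i * l + b)%N.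
  by rewrite -[X in val X]mxtens_unindexK -/(gidx a) e.
move=> /= ->; rewrite /gpar -(gk0P p).
have [ki|ik] := leqP (gk0 p) i.
  by rewrite (leq_trans _ (leq_addr _ _)) // leq_mul2r ki orbT.
rewrite leqNgt (leq_trans (n := i.+1 * l)) ?leq_mul2r ?ik ?orbT //.
by rewrite mulSn addnC ltn_add2r.
Qed.

Lemma gv_par i : gv i *m eps (gpar i) = gv i.
Proof. by apply: trmx_inj; rewrite trmx_mul tr_eps trmxK gu_par. Qed.

Lemma gu_eps b i : eps b *m gu i = if b == gpar i then gu i else 0.
Proof.
by rewrite -{1}gu_par mulmxA eps_mul; case: eqP => [->|_]; rewrite ?gu_par ?mul0mx.
Qed.

Lemma gv_eps b i : gv i *m eps b = if b == gpar i then gv i else 0.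
Proof.
by rewrite -{1}gv_par -mulmxA eps_mul [gpar i == b]eq_sym; case: eqP => _; rewrite ?gv_par ?mulmx0.
Qed.

Lemma gframe_expand (x : M) :
  x = \sum_i \sum_j gu i *m (gv i *m x *m gu j) *m gv j.
Proof.
rewrite -{1}[x]mul1mx -{1}[x]mulmx1 -gu_sum mulmxA mulmx_suml mulmx_suml.
apply: eq_bigr => i _; rewrite mulmx_sumr; apply: eq_bigr => j _.
by rewrite !mulmxA.
Qed.

Lemma gframe_comp (i j i' j' : 'I_k) (d : 'M[F]_l) :
  gv i' *m (gu i *m d *m gv j) *m gu j' =
  if (i' == i) && (j == j') then d else 0.
Proof.
rewrite !mulmxA gvu -mulmxA gvu; case: eqP => _ /=; last by rewrite !mul0mx.
by rewrite mul1mx; case: eqP => _; rewrite ?mulmx1 ?mulmx0.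
Qed.

Lemma gframe_mul i j (x y : M) :
  gv i *m (x *m y) *m gu j =
  \sum_h (gv i *m x *m gu h) *m (gv h *m y *m gu j).
Proof.
transitivity (gv i *m x *m (\sum_h gu h *m gv h) *m y *m gu j).
  by rewrite gu_sum mulmx1 !mulmxA.
by rewrite mulmx_sumr !mulmx_suml; apply: eq_bigr => h _; rewrite !mulmxA.
Qed.

(** Distinct positions (i, j) do not interact, so the sum of images becomes one condition per block;
    the grading is used in this form from here on. *)
Lemma mem_GammaM g (x : M) :
  reflect (forall i j, gv i *m x *m gu j \in gD p (g - ggamma i + ggamma j))
          (x \in GammaM p g).
Proof.
apply: (iffP idP) => [/memv_sumP[x_ Dx ->] i j|Dx].
  rewrite mulmx_sumr mulmx_suml memv_suml // => i' _.
  have /memv_sumP[y_ Dy ->] := Dx i' isT.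
  rewrite mulmx_sumr mulmx_suml memv_suml // => j' _.
  have /memv_imgP[d Dd ->] := Dy j' isT.
  rewrite lfunE /= EtensE gframe_comp; case: ifP => [|_]; last by rewrite mem0v.
  by case/andP => /eqP -> /eqP <-.
rewrite [x]gframe_expand memv_sumr // => i _; apply: memv_sumr => j _.
by rewrite -EtensE; apply/memv_imgP; exists (gv i *m x *m gu j); rewrite ?lfunE.
Qed.

Lemma gD_mul g h d d' : d \in gD p g -> d' \in gD p h -> d *m d' \in gD p (g + h).
Proof. by have [gr _ _ _] := gDP p; apply: grading_mul. Qed.

Lemma GammaM_grading : is_grading (@mulmx F _ _ _) (GammaM p).
Proof.
split; last first.
  move=> g h x y /mem_GammaM Dx /mem_GammaM Dy; apply/mem_GammaM => i j.
  rewrite gframe_mul memv_suml // => k' _.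
  have -> : g + h - ggamma i + ggamma j =
      (g - ggamma i + ggamma k') + (h - ggamma k' + ggamma j).
    by rewrite [RHS](AC (3*3) (1*4*2*6*3*5)) /= addrK.
  exact: gD_mul.
have [[Dd _] _ _ _] := gDP p; have [S [pr [D0 prD prE prS]]] := is_decomp_by_exists Dd.
pose comp (x : M) i j g := pr (g - ggamma i + ggamma j) (gv i *m x *m gu j).
have shift_deg t i j : ggamma i + t - ggamma j - ggamma i + ggamma j = t.
  by rewrite [LHS](AC (3*1*1) (2*1*4*3*5)) /= addrK subrK.
pose S' := [fset x in [seq ggamma ij.1 + t - ggamma ij.2 |
  ij <- enum {: 'I_k * 'I_k}, t <- enum_fset S]]%fset.
have memS' i j t : t \in S -> ggamma i + t - ggamma j \in S'.
  by move=> St; rewrite !inE; apply/allpairsP; exists ((i, j), t); rewrite mem_enum.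
have deg_shift g i j : ggamma i + (g - ggamma i + ggamma j) - ggamma j = g.
  by rewrite [LHS](AC (1*3*1) (2*1*3*4*5)) /= !addrK.
apply: (@is_decomposition_intro _ _ _ _ S'
  (fun g x => \sum_i \sum_j gu i *m comp x i j g *m gv j)).
- move=> g x y; rewrite -big_split /=; apply: eq_bigr => i _.
  rewrite -big_split /=; apply: eq_bigr => j _.
  by rewrite /comp mulmxDr mulmxDl linearD mulmxDr mulmxDl.
- move=> g nS'; apply/eqP; rewrite -subv0; apply/subvP => x /mem_GammaM Dx.
  rewrite memv0 [x]gframe_expand big1 // => i _; rewrite big1 // => j _.
  suff -> : gv i *m x *m gu j = 0 by rewrite mulmx0 mul0mx.
  apply/eqP; rewrite -memv0 -(D0 (g - ggamma i + ggamma j)) //.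
  by apply: contraNN nS' => /(memS' i j); rewrite deg_shift.
- move=> g x; apply/mem_GammaM => i j; rewrite mulmx_sumr mulmx_suml.
  rewrite memv_suml // => i' _; rewrite mulmx_sumr mulmx_suml memv_suml // => j' _.
  rewrite gframe_comp; case: ifP => [|_]; last by rewrite mem0v.
  by case/andP => /eqP -> /eqP <-; apply: prD.
- move=> g h x /mem_GammaM Dx.
  have -> : (if h == g then x else 0) =
      \sum_i \sum_j gu i *m (if h == g then gv i *m x *m gu j else 0) *m gv j.
    case: eqP => _; first exact: gframe_expand.
    by rewrite big1 // => i _; rewrite big1 // => j _; rewrite mulmx0 mul0mx.
  apply: eq_bigr => i _; apply: eq_bigr => j _; congr (_ *m _ *m _).
  rewrite /comp (prE _ _ _ (Dx i j)).
  by rewrite (inj_eq (addIr (ggamma j))) (inj_eq (addIr (- ggamma i))).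
move=> x; rewrite [RHS]gframe_expand exchange_big /=; apply: eq_bigr => i _.
rewrite exchange_big /=; apply: eq_bigr => j _.
rewrite -mulmx_suml -mulmx_sumr; congr (_ *m _ *m _).
set y := gv i *m x *m gu j; rewrite -[RHS]prS.
have sub : ([fset ggamma i + t - ggamma j | t in S] `<=` S')%fset.
  by apply/fsubsetP => _ /imfsetP[t /= St ->]; apply: memS'.
rewrite -(big_fset_incl _ sub) => [|g _ nSg]; last first.
  apply/eqP; rewrite -memv0 -(D0 (g - ggamma i + ggamma j)) ?prD //.
  apply: contraNN nSg => St; apply/imfsetP.
  by exists (g - ggamma i + ggamma j); rewrite ?deg_shift.
rewrite big_imfset /= => [|t u _ _ /addIr /addrI //].
by apply: eq_bigr => t _; rewrite /comp shift_deg.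
Qed.

End GammaFrame.

(** f carries the components of x to those of f x, so injectivity gives x = [pr g x] when f x has
    degree g. Hence isomorphisms need checking in one direction only. *)
Lemma decomposition_reflect (F : fieldType) (G : zmodType) (V V' : vectType F)
    (W : G -> {vspace V}) (W' : G -> {vspace V'}) (f : 'Hom(V, V')) :
    is_decomposition W -> is_decomposition W' -> lker f = 0%VS ->
    (forall g x, x \in W g -> f x \in W' g) ->
  forall g x, f x \in W' g -> x \in W g.
Proof.
move=> /is_decomp_by_exists[S [pr [W0 prW _ prS]]].
move=> /is_decomp_by_exists[S' [pr' [_ prW' prE' _]]] f0 fW g x Wfx.
have finj : injective f by apply/lker0P/eqP.
suff <- : pr g x = x by [].
apply: finj; have fxE : pr' g (f x) = f x by rewrite (prE' g) // eqxx.
rewrite -fxE -[in RHS](prS x) !linear_sum /=.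
rewrite (eq_bigr (fun h => if h == g then f (pr h x) else 0)).
  rewrite sum_fset_if; case: ifP => // /negbT/W0 Wg0; have := prW g x.
  by rewrite Wg0 memv0 => /eqP ->; rewrite linear0.
by move=> h _; rewrite (prE' h) ?fW // eq_sym.
Qed.

(** * Automorphisms of A(m, n) induced from gl(m+1|n+1) *)

Section Lifts.
Variables (F : fieldType) (m n : nat).
Local Notation M := 'M[F]_(m.+1 + n.+1).
Local Notation sls := (slspace F m.+1 n.+1).

(** A section of [Acls] obtained from a linear right inverse of the quotient map; [quotv_repr] is
    not known to be linear. *)
Definition Arep : 'Hom(Alie F m n, M) :=
  (linfun vsval \o (linfun (quotv_pi (Acenter F m n)))^-1)%VF.

Lemma Arep_sl a : Arep a \in sls.
Proof. by rewrite comp_lfunE lfunE /= subvsP. Qed.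

Lemma ArepK a : Acls (Arep a) = a.
Proof.
rewrite comp_lfunE lfunE /= /Acls vsvalK.
have /memv_imgP[x _ ->] : a \in limg (linfun (quotv_pi (Acenter F m n))).
  have [x <-] := quotv_pi_surj a; by rewrite -[quotv_pi _ _]lfunE memv_img ?memvf.
rewrite -[quotv_pi _ _]lfunE limg_lfunVK //.
by rewrite memv_img ?memvf.
Qed.

Lemma Acls_eq x y : x \in sls -> y \in sls -> Acls x = Acls y :> Alie F m n ->
  exists k : F, x = y + k%:M /\ (m <> n -> k = 0).
Proof.
move=> slx sly exy; have : Acls (x - y) == 0 :> Alie F m n by rewrite linearB /= exy subrr.
rewrite Acls_eq0; last exact: memvB.
case: (m =P n) => mn.
  by move=> /vlineP[k e]; exists k; split=> //; rewrite -scalemx1 -e addrC subrK.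
by rewrite subr_eq0 => /eqP ->; exists 0; rewrite raddf0 addr0.
Qed.

Lemma Arep_Acls x : x \in sls -> exists k : F, Arep (Acls x) = x + k%:M.
Proof.
move=> slx; have [k [-> _]] := Acls_eq (Arep_sl _) slx (ArepK (Acls x)).
by exists k.
Qed.

Lemma sbracket_sl (x y : M) : sbracket x y \in sls.
Proof. by rewrite mem_slspace supertrace_sbracket. Qed.

Lemma mem_spar i (a : Alie F m n) :
  reflect (exists x, [/\ x \in sls, mxpar i x = x & a = Acls x])
          (a \in spar (Alie F m n) i).
Proof.
apply: (iffP memv_imgP) => [[x Mx ->]|[x [slx ix ->]]].
  exists (vsval x); split; first exact: subvsP.
    apply/eqP; rewrite -mem_Mpar; move: Mx; rewrite -memv_preim.
    by rewrite lfunE.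
  by rewrite lfunE /= /Acls vsvalK.
exists (vsproj sls x); last by rewrite lfunE.
rewrite -memv_preim lfunE /= vsprojK //.
by rewrite mem_Mpar ix.
Qed.

(** Automorphisms of gl under which sl and the line of scalars are stable, so that they descend to
    A(m, n). Every isomorphism of gradings constructed below comes from such lifts. *)
Definition is_lift (phi : 'End(M)) : Prop :=
  [/\ lker phi = 0%VS, forall i x, mxpar i (phi x) = phi (mxpar i x),
      forall x, x \in sls -> phi x \in sls, exists c, phi 1%:M = c%:M
    & forall x y, phi (sbracket x y) = sbracket (phi x) (phi y)].

Lemma is_lift_superaut phi : is_lift phi ->
  exists f : 'End(Alie F m n), is_superaut f /\
    {in sls, forall x, f (Acls x) = Acls (phi x)}.
Proof.
case=> phi0 phipar phisl [c phi1] phibr.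
have phiS (k : F) : phi k%:M = (k * c)%:M.
  by rewrite -[k%:M]scalemx1 linearZ /= phi1 scale_scalar_mx.
have cls0 (k : F) : k%:M \in sls -> m = n -> Acls k%:M = 0 :> Alie F m n.
  move=> slk mn; apply/eqP; rewrite Acls_eq0 // mn eqxx.
  by rewrite -[k%:M]scalemx1 memvZ // memv_line.
pose f : 'End(Alie F m n) := (linfun (@Acls F m n) \o phi \o Arep)%VF.
have fE : {in sls, forall x, f (Acls x) = Acls (phi x)}.
  have fdef a : f a = Acls (phi (Arep a)) by rewrite comp_lfunE comp_lfunE lfunE.
  move=> x slx; rewrite fdef.
  have [k [e k0]] := Acls_eq (Arep_sl _) slx (ArepK (Acls x)).
  (* When m = n the chosen representative may differ from x by a scalar; phi maps it to a scalar,
     which [Acls] kills. *)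
  have [mn|/eqP/k0 k00] := eqVneq m n; last by rewrite e k00 raddf0 addr0.
  have slk : k%:M \in sls.
    by rewrite -[k%:M](addKr x) -e addrC memvB // Arep_sl.
  rewrite e !linearD /= phiS cls0 ?addr0 //.
  by rewrite -phiS phisl.
exists f; split=> //.
have phi_inj : injective phi by apply/lker0P/eqP.
have c0 : c != 0.
  apply: contraTneq (oner_neq0 F) => c0; move: phi1; rewrite c0 raddf0.
  move/eqP; rewrite -(raddf0 phi) (inj_eq phi_inj) => /eqP.
  by move/(congr1 (fun x : M => x 0 0)); rewrite !mxE eqxx => /eqP; rewrite negbK.
have f0 : lker f = 0%VS.
  apply/eqP; rewrite -subv0; apply/subvP => a; rewrite memv_ker memv0.
  rewrite -[a]ArepK; move: (Arep a) (Arep_sl a) => x slx.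
  rewrite (fE _ slx) (Acls_eq0 slx) (Acls_eq0 (phisl _ slx)); case: (m =P n) => _; last first.
    by rewrite -{1}(raddf0 phi) (inj_eq phi_inj).
  (* As phi x = k and phi 1 = c, x must be the scalar k / c. *)
  case/vlineP => k e; apply/vlineP; exists (k / c); apply: phi_inj.
  by rewrite e linearZ /= phi1 !scale_scalar_mx divfK // mulr1.
split=> // [x y|i].
  rewrite -[x]ArepK -[y]ArepK smul_Acls ?Arep_sl // !fE ?Arep_sl ?sbracket_sl //.
  by rewrite smul_Acls ?phisl ?Arep_sl // phibr.
apply/eqP; rewrite eqEdim limg_dim_eq ?leqnn ?andbT; last by rewrite f0 capv0.
apply/subvP => _ /memv_imgP[a /mem_spar[x [slx ix ->]] ->].
by apply/mem_spar; exists (phi x); rewrite fE // phipar ix phisl.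
Qed.

Lemma mem_induced (G : zmodType) (W : G -> {vspace M}) g (a : Alie F m n) :
  reflect (exists x, [/\ x \in sls, x \in W g & a = Acls x]) (a \in induced_grading W g).
Proof.
apply: (iffP memv_imgP) => [[x]|[x [slx Wx ->]]].
  by rewrite memv_cap => /andP[slx Wx] ->; exists x; rewrite lfunE.
by exists x; rewrite ?lfunE // memv_cap slx.
Qed.

Lemma lift_isomorphic (G : zmodType) (W W' : G -> {vspace M}) phi :
    is_decomposition W -> is_decomposition W' -> is_lift phi ->
    (forall g x, x \in W g -> phi x \in W' g) ->
  isomorphic_gradings (induced_grading W : G -> {vspace Alie F m n})
                      (induced_grading W').
Proof.
move=> dW dW' lphi phiW; have [f [fP fE]] := is_lift_superaut lphi.
have [phi0 _ phisl _ _] := lphi; exists f => // g; apply/vspaceP => b.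
apply/memv_imgP/mem_induced => [[_ /mem_induced[x [slx Wx ->]] ->]|].
  by exists (phi x); rewrite fE // phisl // phiW.
case=> y [sly Wy ->].
have phi_sl : (phi @: sls = sls)%VS.
  apply/eqP; rewrite eqEdim limg_dim_eq ?leqnn ?andbT; last by rewrite phi0 capv0.
  by apply/subvP => _ /memv_imgP[x slx ->]; apply: phisl.
move: sly Wy; rewrite -{1}phi_sl => /memv_imgP[x slx ->] Wx.
exists (Acls x); last by rewrite fE.
by apply/mem_induced; exists x; split=> //; apply: decomposition_reflect Wx.
Qed.

Lemma isomorphic_gradings_trans (G : zmodType) (A B C : G -> {vspace Alie F m n}) :
  isomorphic_gradings A B -> isomorphic_gradings B C -> isomorphic_gradings A C.
Proof.
case=> f [f0 fm fp] fAB [h [h0 hm hp] hBC]; exists (h \o f)%VF => [|g].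
  split=> [|x y|i]; last by rewrite limg_comp fp hp.
    apply/eqP/lker0P => x y; rewrite !comp_lfunE => e.
    by apply: (lker0P (introT eqP f0)); apply: (lker0P (introT eqP h0)) e.
  by rewrite !comp_lfunE fm hm.
by rewrite limg_comp fAB hBC.
Qed.

End Lifts.

(** * Three lifts: even conjugation, minus the supertranspose, block exchange *)

Section LiftInstances.
Variables (F : fieldType) (m n : nat).
Local Notation M := 'M[F]_(m.+1 + n.+1).
Local Notation sls := (slspace F m.+1 n.+1).

(** Expresses the supertrace as an ordinary trace twisted by upsilon, so that facts about traces of
    homogeneous elements apply to it. *)
Lemma supertraceE r s (x : 'M[F]_(r + s)) :
  supertrace x = \tr ((eps false - eps true) *m x).
Proof.
rewrite -[x]submxK /supertrace block_mxKul block_mxKdr mulmxBl !mulmx_block.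
rewrite !(mul0mx, mul1mx, addr0, add0r) opp_block_mx add_block_mx !(oppr0, addr0, add0r).
by rewrite mxtrace_block (raddfN (@mxtrace F s)).
Qed.

Lemma even_mxP (P : M) : mxpar false P = P -> forall b, eps b *m P = P *m eps b.
Proof.
move=> <- b; rewrite mxparE /= mulmxDr mulmxDl !mulmxA -!(mulmxA _ (eps _) (eps b)).
by rewrite !eps_mul; case: b => /=; rewrite !(mul0mx, mulmx0, addr0, add0r).
Qed.

Lemma conj_lift (P Q : M) : P *m Q = 1%:M -> mxpar false P = P ->
  is_lift (linfun (mulmxr Q \o mulmx P)).
Proof.
move=> PQ ePar; have QP : Q *m P = 1%:M by apply: mulmx1C.
have eP := even_mxP ePar.
have eQ b : eps b *m Q = Q *m eps b.
  by rewrite -[LHS]mul1mx -QP -!mulmxA (mulmxA P) -eP -(mulmxA (eps b)) PQ mulmx1.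
have par i x : mxpar i (P *m x *m Q) = P *m mxpar i x *m Q.
  rewrite !mxparE mulmxDr mulmxDl !mulmxA.
  by rewrite !eP -!mulmxA -!eQ !mulmxA.
split=> [|i x|x|| x y].
- apply/eqP/lker0P => x y; rewrite !lfunE /= => /(congr1 (fun z => Q *m z *m P)).
  by rewrite !mulmxA QP !mul1mx -!mulmxA QP !mulmx1.
- by rewrite !lfunE /= par.
- rewrite !mem_slspace lfunE /= !supertraceE => /eqP <-.
  have eE : (eps false - eps true) *m P = P *m (eps false - eps true).
    by rewrite mulmxBl mulmxBr !eP.
  rewrite -[P *m x *m Q]mulmxA mulmxA eE -mulmxA mxtrace_mulC -!mulmxA QP mulmx1.
  exact: eqxx.
- by exists 1; rewrite lfunE /= mulmx1 PQ.
rewrite !lfunE /= !sbracketE !par.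
rewrite !(mulmxDr, mulmxDl, mulmxBr, mulmxBl, mulmxN, mulNmx) !mulmxA.
by rewrite -!(mulmxA _ Q P) QP !mulmx1.
Qed.

(* minus the supertranspose *)
Definition tau r s (x : 'M[F]_(r + s)) : 'M[F]_(r + s) :=
  block_mx (- (ulsubmx x)^T) ((dlsubmx x)^T) (- (ursubmx x)^T) (- (drsubmx x)^T).

Lemma tau_linear r s : linear (@tau r s).
Proof.
move=> a x y; rewrite -[x]submxK -[y]submxK scale_block_mx add_block_mx /tau.
rewrite !(block_mxKul, block_mxKur, block_mxKdl, block_mxKdr).
by rewrite scale_block_mx add_block_mx !linearD !linearZ.
Qed.
HB.instance Definition _ r s := GRing.isSemilinear.Build F _ _ _ (@tau r s)
  (GRing.semilinear_linear (@tau_linear r s)).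

Lemma tau_block r s a b c d :
  tau (block_mx a b c d : 'M[F]_(r + s)) = block_mx (- a^T) c^T (- b^T) (- d^T).
Proof. by rewrite /tau block_mxKul block_mxKur block_mxKdl block_mxKdr. Qed.

Lemma sbracket_block r s (a a' : 'M[F]_r) b b' c c' (d d' : 'M[F]_s) :
  sbracket (block_mx a b c d) (block_mx a' b' c' d') =
  block_mx (a *m a' + b *m c' - a' *m a + b' *m c)
           (a *m b' + b *m d' - b' *m d - a' *m b)
           (c *m a' + d *m c' - c' *m a - d' *m c)
           (c *m b' + d *m d' - d' *m d + c' *m b).
Proof.
rewrite sbracketE /mxpar !(block_mxKul, block_mxKur, block_mxKdl, block_mxKdr).
rewrite !mulmx_block !mulmx0 !mul0mx !addr0 !add0r.
by rewrite !opp_block_mx !add_block_mx !oppr0 !addr0.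
Qed.

Lemma tau_lift : is_lift (linfun (@tau m.+1 n.+1)).
Proof.
split=> [|i x|x||x y]; rewrite ?lfunE /=.
- apply/eqP; rewrite -subv0; apply/subvP => x; rewrite memv_ker memv0 lfunE /= /tau.
  move/eqP; rewrite -[in X in _ -> X](submxK x) -(@block_mx0 _ m.+1 n.+1 m.+1 n.+1).
  move/eq_block_mx => [] /eqP; rewrite oppr_eq0 => /eqP a [b] [].
  move/eqP; rewrite oppr_eq0 => /eqP c /eqP; rewrite oppr_eq0 => /eqP d.
  have tr0 i j (z : 'M[F]_(i, j)) : z^T = 0 -> z = 0.
    by move=> z0; rewrite -[z]trmxK z0 trmx0.
  by rewrite (tr0 _ _ _ a) (tr0 _ _ _ b) (tr0 _ _ _ c) (tr0 _ _ _ d).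
- rewrite /tau /mxpar -[x]submxK; case: i;
  by rewrite !(block_mxKul, block_mxKur, block_mxKdl, block_mxKdr) !(trmx0, oppr0).
- rewrite !mem_slspace /supertrace /tau !(block_mxKul, block_mxKdr).
  by rewrite !raddfN /= !mxtrace_tr -opprD oppr_eq0.
- exists (-1); rewrite /tau (@scalar_mx_block _ m.+1 n.+1).
  rewrite !(block_mxKul, block_mxKur, block_mxKdl, block_mxKdr).
  by rewrite !(tr_scalar_mx, trmx0, oppr0) -!raddfN -scalar_mx_block.
rewrite -[x]submxK -[y]submxK.
move: (ulsubmx x) (ursubmx x) (dlsubmx x) (drsubmx x) => a b c d.
move: (ulsubmx y) (ursubmx y) (dlsubmx y) (drsubmx y) => a' b' c' d'.
rewrite !tau_block !sbracket_block tau_block.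
have trD i j (z w : 'M[F]_(i, j)) : (z + w)^T = z^T + w^T by rewrite linearD.
have trN i j (z : 'M[F]_(i, j)) : (- z)^T = - z^T by rewrite linearN.
congr block_mx; rewrite !(trD, trN) !trmx_mul !(mulmxN, mulNmx, opprK, opprD).
- by rewrite [LHS](ACl (3*4*1*2)) /= addrAC.
- by rewrite [LHS](ACl (3*4*2*1)).
- by rewrite [LHS](ACl (4*3*1*2)).
by rewrite [LHS](ACl (4*3*2*1)).
Qed.

End LiftInstances.

Section BlockSwap.
Variables (F : fieldType) (r : nat).

(** Conjugation by the odd permutation matrix exchanging the two summands; it negates the
    supertrace, so sl is preserved. *)
Definition swapmx (x : 'M[F]_(r + r)) : 'M[F]_(r + r) :=
  block_mx (drsubmx x) (dlsubmx x) (ursubmx x) (ulsubmx x).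

Lemma swapmx_block a b c d : swapmx (block_mx a b c d) = block_mx d c b a.
Proof. by rewrite /swapmx block_mxKul block_mxKur block_mxKdl block_mxKdr. Qed.

Lemma swapmx_linear : linear swapmx.
Proof.
move=> a x y; rewrite -[x]submxK -[y]submxK scale_block_mx add_block_mx.
by rewrite !swapmx_block scale_block_mx add_block_mx.
Qed.
HB.instance Definition _ := GRing.isSemilinear.Build F _ _ _ swapmx
  (GRing.semilinear_linear swapmx_linear).

Lemma swapmxK : involutive swapmx.
Proof. by move=> x; rewrite -[x]submxK !swapmx_block. Qed.

End BlockSwap.

Lemma swapmx_lift (F : fieldType) n : @is_lift F n n (linfun (@swapmx F n.+1)).
Proof.
split=> [|i x|x||x y]; rewrite ?lfunE /=.
- by apply/eqP/lker0P => x y; rewrite !lfunE /=; apply: (inv_inj (@swapmxK F n.+1)).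
- rewrite /mxpar -[x]submxK; case: i;
  by rewrite !swapmx_block !(block_mxKul, block_mxKur, block_mxKdl, block_mxKdr).
- rewrite !mem_slspace /supertrace /swapmx !(block_mxKul, block_mxKdr).
  by rewrite -opprB oppr_eq0.
- exists 1; rewrite /swapmx (@scalar_mx_block _ n.+1 n.+1).
  by rewrite !(block_mxKul, block_mxKur, block_mxKdl, block_mxKdr).
rewrite -[x]submxK -[y]submxK !swapmx_block !sbracket_block swapmx_block.
by congr block_mx; rewrite [LHS](ACl (2*1*3*4)).
Qed.

(** * Data of the transposed and of the exchanged gradings *)

Section OppositeData.
Variables (F : fieldType) (G : zmodType) (m n : nat) (p : gammaData F G m n).
Local Notation l := (gell p).

Let D' g := (linfun (@trmx F l l) @: gD p g)%VS.

Lemma memDtr g d : (d \in D' g) = (d^T \in gD p g).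
Proof.
apply/memv_imgP/idP => [[e De ->]|De]; first by rewrite lfunE /= trmxK.
by exists d^T; rewrite // lfunE /= trmxK.
Qed.

Lemma opp_gbetaP : is_nondeg_alt_bichar (gT p) (fun u v => (gbeta p u v)^-1).
Proof.
have [nz bl br alt nd] := gbetaP p; split=> [u v Tu Tv|u v w Tu Tv Tw|u v w Tu Tv Tw|u Tu|u Tu u1].
- by rewrite invr_eq0 nz.
- by rewrite bl // invfM.
- by rewrite br // invfM.
- by rewrite alt // invr1.
by apply: nd => // v Tv; rewrite -[LHS]invrK u1 // invr1.
Qed.

Lemma opp_gDP : is_graded_division (gT p) (fun u v => (gbeta p u v)^-1) D'.
Proof.
have [[[S [D0 dD fD]] DM] Dinv Ddim Dcomm] := gDP p.
have trk : lker (linfun (@trmx F l l)) == 0%VS.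
  by apply/lker0P => x y; rewrite !lfunE; apply: trmx_inj.
have imE : (\sum_(g <- S) D' g)%VS = (linfun (@trmx F l l) @: \sum_(g <- S) gD p g)%VS.
  by rewrite limg_sum.
have dimtr (U : {vspace 'M[F]_l}) : \dim (linfun (@trmx F l l) @: U) = \dim U.
  by apply: limg_dim_eq; rewrite (eqP trk) capv0.
have dimD' g : \dim (D' g) = \dim (gD p g) by apply: dimtr.
split.
- split.
    exists S; split=> [g /D0 Dg0||].
    + by rewrite /D' Dg0 limg0.
    + rewrite directvE /= imE dimtr.
      rewrite (directvP dD) /=; apply/eqP; apply: eq_bigr => g _.
      by rewrite dimD'.
    + by apply/eqP; rewrite eqEdim subvf imE fD dimtr leqnn.
  move=> g h x y; rewrite !memDtr trmx_mul addrC => Dx Dy; exact: DM.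
- by move=> g x; rewrite memDtr => /Dinv; rewrite unitmx_tr trmx_eq0.
- by move=> g; rewrite dimD' Ddim.
move=> u v Tu Tv x y; rewrite !memDtr => Dx Dy.
have [nz _ _ _ _] := gbetaP p.
apply: trmx_inj; rewrite linearZ /= !trmx_mul.
rewrite (Dcomm u v Tu Tv _ _ Dx Dy).
by rewrite scalerA mulVf ?nz // scale1r.
Qed.

(** Transposition reverses products, which inverts beta, and moves block (j, i) to block (i, j),
    which negates the tuples: this realises delta = -1. *)
Definition oppData : gammaData F G m n :=
  @GammaData F G m n (gT p) (fun u v => (gbeta p u v)^-1) l D' (gk0 p) (gk1 p)
    [tuple of map -%R (ggamma0 p)] [tuple of map -%R (ggamma1 p)]
    (gT_subgroup p) opp_gbetaP (gell_sqr p) opp_gDP (gk0P p) (gk1P p).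

Lemma gu_opp i : gu (p := oppData) i = gu (p := p) i.
Proof. by apply/matrixP => a b; rewrite !mxE. Qed.

Lemma ggamma_opp i : ggamma (p := oppData) i = - ggamma (p := p) i.
Proof.
by rewrite /ggamma !(tnth_nth 0) /= -map_cat (nth_map 0) // size_cat !size_tuple.
Qed.

Lemma tr_GammaM g x : x \in GammaM p g -> x^T \in GammaM oppData g.
Proof.
move=> /mem_GammaM Dx; apply/mem_GammaM => i j; rewrite memDtr !trmx_mul trmxK.
rewrite /gv !gu_opp !ggamma_opp opprK trmxK mulmxA addrAC.
exact: Dx.
Qed.

End OppositeData.

Lemma GammaM_eps (F : fieldType) (G : zmodType) m n (p : gammaData F G m n) a b g x : x \in GammaM p g -> eps a *m x *m eps b \in GammaM p g.
Proof.
move/mem_GammaM => Dx; apply/mem_GammaM => i j.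
rewrite -!mulmxA gu_eps !mulmxA gv_eps; case: eqP => _; last by rewrite !mul0mx mem0v.
by case: eqP => _; rewrite ?mulmx0 ?mem0v.
Qed.

Lemma tau_GammaM (F : fieldType) (G : zmodType) m n (p : gammaData F G m n) g x : x \in GammaM p g -> tau x \in GammaM (oppData p) g.
Proof.
move=> Gx; have Gt := tr_GammaM Gx.
have -> : tau x = - (eps false *m x^T *m eps false) + eps false *m x^T *m eps true
    - eps true *m x^T *m eps false - eps true *m x^T *m eps true.
  rewrite -[x]submxK tau_block tr_block_mx /eps !mulmx_block.
  rewrite !(mulmx0, mul0mx, mulmx1, mul1mx, addr0, add0r).
  by rewrite !opp_block_mx !add_block_mx !(oppr0, addr0, add0r).
by rewrite !(memvD, memvB, memvN, GammaM_eps).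
Qed.

Lemma ord_pair_eq l i j (b c : 'I_l) : (i * l + b == j * l + c)%N = (i == j) && (b == c).
Proof.
have l0 : (0 < l)%N by apply: leq_ltn_trans (ltn_ord b).
apply/eqP/andP => [e|[/eqP-> /eqP->] //].
have := congr1 (divn^~ l) e; rewrite !divnMDl // !divn_small ?ltn_ord // !addn0 => ->.
by have := congr1 (modn^~ l) e; rewrite !modnMDl !modn_small ?ltn_ord // -val_eqE /= => ->.
Qed.

(** Stated in natural numbers so that frames indexed by k0 + k1 and by k1 + k0 can be compared when
    the blocks are exchanged. *)
Lemma guE (F : fieldType) (G : zmodType) m n (p : gammaData F G m n) i a b :
  gu (p := p) i a b = (val a == i * gell p + b)%N%:R.
Proof.
rewrite mxE /gidx; set a' := cast_ord _ a; congr (nat_of_bool _)%:R.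
have -> : val a = val a' by [].
case: (mxtens_indexP a') => i' b'; rewrite mxtens_indexK [RHS]/=.
by rewrite ord_pair_eq -val_eqE.
Qed.

Section SwapData.
Variables (F : fieldType) (G : zmodType) (n : nat) (p : gammaData F G n n).

Definition swapData : gammaData F G n n :=
  @GammaData F G n n (gT p) (gbeta p) (gell p) (gD p) (gk1 p) (gk0 p)
    (ggamma1 p) (ggamma0 p) (gT_subgroup p) (gbetaP p) (gell_sqr p) (gDP p)
    (gk1P p) (gk0P p).

Let rho (i : 'I_(gk1 p + gk0 p)) : 'I_(gk0 p + gk1 p) :=
  match split i with inl a => rshift _ a | inr b => lshift _ b end.

Let Pi : 'M[F]_(n.+1 + n.+1) := block_mx 0 1%:M 1%:M 0.

Lemma ggamma_swap i : ggamma (p := swapData) i = ggamma (p := p) (rho i).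
Proof.
rewrite /ggamma /rho; case: (split_ordP i) => j ->; rewrite ?split_lshift ?split_rshift.
  by rewrite tnth_lshift tnth_rshift.
by rewrite tnth_lshift tnth_rshift.
Qed.

Lemma gu_swap i : gu (p := swapData) i = Pi *m gu (p := p) (rho i).
Proof.
have := guE (p := p) (rho i); move: (gu (rho i)) => u uE.
rewrite -[u]vsubmxK /Pi mul_block_col !mul0mx !mul1mx add0r addr0.
have lt_l q (j : 'I_q) (b : 'I_(gell p)) : (j * gell p + b < q * gell p)%N.
  by rewrite (leq_trans (n := j.+1 * gell p)) ?leq_mul2r ?ltn_ord ?orbT // mulSn addnC ltn_add2r.
apply/matrixP => a b; rewrite guE /=.
case: (split_ordP a) => a' ->; rewrite ?col_mxEu ?col_mxEd !mxE uE /rho;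
  case: (split_ordP i) => j ->; rewrite ?split_lshift ?split_rshift /=;
  rewrite ?mulnDl ?(gk0P p) ?(gk1P p) -?addnA ?eqn_add2l //; congr (nat_of_bool _)%:R;
  have := lt_l _ j b; rewrite ?(gk0P p) ?(gk1P p) => lt_j.
- rewrite ltn_eqF ?(leq_trans (ltn_ord a')) ?leq_addr //.
  by rewrite gtn_eqF // (leq_trans lt_j) ?leq_addr.
rewrite gtn_eqF ?(leq_trans lt_j) ?leq_addr //.
by rewrite ltn_eqF // (leq_trans (ltn_ord a')) ?leq_addr.
Qed.

Lemma swap_GammaM g x : x \in GammaM p g -> swapmx x \in GammaM swapData g.
Proof.
move/mem_GammaM => Dx; apply/mem_GammaM => i j.
have swapE : swapmx x = Pi *m x *m Pi.
  rewrite -[x]submxK swapmx_block /Pi !mulmx_block.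
  by rewrite !(mulmx0, mul0mx, mulmx1, mul1mx, addr0, add0r).
have PiPi : Pi *m Pi = 1%:M.
  rewrite /Pi mulmx_block !(mulmx0, mul0mx, mulmx1, mul1mx, addr0, add0r).
  by rewrite -scalar_mx_block.
have gvE h : gv (p := swapData) h = gv (p := p) (rho h) *m Pi.
  rewrite /gv gu_swap trmx_mul; congr (_ *m _).
  by rewrite /Pi tr_block_mx !(trmx0, trmx1).
rewrite gvE gu_swap swapE !ggamma_swap !mulmxA -(mulmxA _ Pi Pi) PiPi mulmx1.
by rewrite -(mulmxA _ Pi Pi) PiPi mulmx1; exact: Dx.
Qed.

End SwapData.

Section DataIsomorphisms.
Variables (F : fieldType) (G : zmodType).

Lemma GammaM_decomposition m n (p : gammaData F G m n) : is_decomposition (GammaM p).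
Proof. by have [] := GammaM_grading p. Qed.

Lemma GammaA_opp m n (p : gammaData F G m n) :
  isomorphic_gradings (GammaA p) (GammaA (oppData p)).
Proof.
apply: (lift_isomorphic (GammaM_decomposition p) (GammaM_decomposition _) (@tau_lift F m n)).
by move=> g x /tau_GammaM; rewrite lfunE.
Qed.

Lemma GammaA_swap n (p : gammaData F G n n) :
  isomorphic_gradings (GammaA p) (GammaA (swapData p)).
Proof.
apply: (lift_isomorphic (GammaM_decomposition p) (GammaM_decomposition _) (@swapmx_lift F n)).
by move=> g x /swap_GammaM; rewrite lfunE.
Qed.

(* The matrix with block columns [u i] is even, invertible with inverse the
   matrix with block rows [v i], and conjugates W into [GammaM p]. *)
Lemma frame_isomorphic m n (p : gammaData F G m n)
    (W : G -> {vspace 'M[F]_(m.+1 + n.+1)})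
    (u : 'I_(gk0 p + gk1 p) -> 'M[F]_(m.+1 + n.+1, gell p))
    (v : 'I_(gk0 p + gk1 p) -> 'M[F]_(gell p, m.+1 + n.+1)) :
    is_decomposition W ->
    (forall i j, v i *m u j = if i == j then 1%:M else 0) ->
    (forall i, eps (gpar i) *m u i = u i) ->
    (forall g x, x \in W g ->
       forall i j, v i *m x *m u j \in gD p (g - ggamma i + ggamma j)) ->
  isomorphic_gradings (induced_grading W : G -> {vspace Alie F m n}) (GammaA p).
Proof.
move=> dW vu ueps WD.
pose Q := \sum_i u i *m gv i; pose P := \sum_i gu i *m v i.
have PQ : P *m Q = 1%:M.
  rewrite mulmx_suml -(gu_sum p); apply: eq_bigr => i _; rewrite mulmx_sumr.
  rewrite (bigD1 i) //= big1 ?addr0 => [|j /negPf ji].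
    by rewrite mulmxA -(mulmxA _ (v i)) vu eqxx mulmx1.
  by rewrite mulmxA -(mulmxA _ (v i)) vu eq_sym ji mulmx0 mul0mx.
have QP : Q *m P = 1%:M := mulmx1C PQ.
have eQ b : eps b *m Q = Q *m eps b.
  rewrite mulmx_sumr mulmx_suml; apply: eq_bigr => i _.
  rewrite -mulmxA gv_eps -{1}ueps !mulmxA eps_mul.
  by case: eqP => [->|_]; rewrite ?ueps // !mul0mx mulmx0.
have eP b : eps b *m P = P *m eps b.
  by rewrite -[RHS]mulmx1 -QP mulmxA -(mulmxA P) eQ !mulmxA PQ mul1mx.
have Ppar : mxpar false P = P.
  rewrite mxparE !eP -!mulmxA !eps_mul !eqxx -mulmxDr.
  by rewrite eps_sum mulmx1.
apply: (lift_isomorphic dW (GammaM_decomposition p) (conj_lift PQ Ppar)) => g x Wx.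
rewrite lfunE /=; apply/mem_GammaM => i j.
have -> : gv i *m (P *m x *m Q) *m gu j = v i *m x *m u j; last exact: WD.
have Qu h : Q *m gu h = u h.
  rewrite mulmx_suml (bigD1 h) //= big1 ?addr0 => [|h' /negPf hh].
    by rewrite -mulmxA gvu eqxx mulmx1.
  by rewrite -mulmxA gvu hh mulmx0.
have vP h : gv h *m P = v h.
  rewrite mulmx_sumr (bigD1 h) //= big1 ?addr0 => [|h' /negPf hh].
    by rewrite mulmxA gvu eqxx mul1mx.
  by rewrite mulmxA gvu eq_sym hh mul0mx.
by rewrite !mulmxA vP -mulmxA Qu.
Qed.

End DataIsomorphisms.

(** * Even gradings *)

Section GradingProjections.
Variables (F : fieldType) (G : zmodType) (N : nat).
Variable (W : G -> {vspace 'M[F]_N}).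
Hypothesis Wgr : is_grading (@mulmx F N N N) W.
Variables (S : {fset G}) (pr : G -> 'End('M[F]_N)).
Hypothesis Wpr : is_decomp_by W S pr.

Lemma proj_notin g x : g \notin S -> pr g x = 0.
Proof.
by case: Wpr => W0 prW _ _ nSg; apply/eqP; rewrite -memv0 -(W0 g nSg) prW.
Qed.

Lemma proj_mulr g h x y : x \in W g -> pr (h + g) (y *m x) = pr h y *m x.
Proof.
have [W0 prW prE prS] := Wpr => Wx.
rewrite -{1}(prS y) mulmx_suml linear_sum /=.
rewrite (eq_bigr (fun k => if k == h then pr k y *m x else 0)).
  by rewrite sum_fset_if; case: ifP => // /negbT/proj_notin ->; rewrite mul0mx.
move=> k _; rewrite (prE (k + g) _ (pr k y *m x)); last exact: grading_mul (prW _ _) Wx.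
by rewrite (inj_eq (addIr g)) eq_sym.
Qed.

Lemma proj_mull g h x y : x \in W g -> pr (h + g) (x *m y) = x *m pr h y.
Proof.
have [W0 prW prE prS] := Wpr => Wx.
rewrite -{1}(prS y) mulmx_sumr linear_sum /=.
rewrite (eq_bigr (fun k => if k == h then x *m pr k y else 0)).
  by rewrite sum_fset_if; case: ifP => // /negbT/proj_notin ->; rewrite mulmx0.
move=> k _; rewrite (prE (k + g) _ (x *m pr k y)); last by rewrite addrC; exact: grading_mul Wx (prW _ _).
by rewrite (inj_eq (addIr g)) eq_sym.
Qed.

End GradingProjections.

(** * Graded division algebras over an algebraically closed field *)

Section GradedDivision.
Variables (F : closedFieldType) (G : zmodType) (l : nat).
Variable (D : G -> {vspace 'M[F]_l}).
Hypothesis Dgr : is_grading (@mulmx F l l l) D.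
Hypothesis l_gt0 : (0 < l)%N.
Hypothesis Dinv : forall g x, x \in D g -> x != 0 -> x \in unitmx.

Lemma grading_invmx g x : x \in D g -> x \in unitmx -> invmx x \in D (- g).
Proof.
have [S [pr Dpr]] := is_decomp_by_exists Dgr.1; have [_ prD prE _] := Dpr.
move=> Dx ux; have := proj_mull Dgr Dpr (- g) (invmx x) Dx.
rewrite addNr mulmxV // (prE 0) ?grading_one // eqxx => /(congr1 (mulmx (invmx x))).
by rewrite mulmx1 mulKmx // => ->.
Qed.

Lemma degree_eq g h x : x \in D g -> x \in D h -> x != 0 -> g = h.
Proof.
have [S [pr [_ prD prE _]]] := is_decomp_by_exists Dgr.1.
move=> Dg Dh x0; apply/eqP; apply: contraNT x0 => gh.
by have := prE _ g _ Dg; rewrite (prE h) // eqxx (negPf gh) => ->.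
Qed.

(** For an eigenvalue a of x, the element x - a has degree 0 and is singular, hence is zero. *)
Lemma degree0_scalar x : x \in D 0 -> exists a, x = a%:M.
Proof.
move=> Dx; have /closed_rootP[a] : size (char_poly x) != 1%N.
  by rewrite size_char_poly; case: (l) l_gt0.
rewrite -eigenvalue_root_char => /eigenvalueP[w wx w0]; exists a.
apply/eqP; rewrite -subr_eq0; apply: contraNT w0 => xa.
have ux : x - a%:M \in unitmx.
  apply: (@Dinv 0) xa; rewrite memvB // -scalemx1 memvZ //.
  exact: grading_one.
have e : w *m (x - a%:M) = 0 by rewrite mulmxBr wx mul_mx_scalar subrr.
by rewrite -(mulmxK ux w) e mul0mx.
Qed.

Lemma component_line g x y : x \in D g -> y \in D g -> x != 0 -> exists a, y = a *: x.
Proof.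
move=> Dx Dy x0; have ux := Dinv Dx x0.
have [a e] : exists a, y *m invmx x = a%:M.
  by apply: degree0_scalar; rewrite -(subrr g); apply: (grading_mul Dgr Dy (grading_invmx Dx ux)).
by exists a; rewrite -(mulmxKV ux y) e mul_scalar_mx.
Qed.

(** T is the support; the components are lines, so their commutation defines beta. It is
    nondegenerate because a homogeneous element commuting with every component is scalar, hence of
    degree 0; counting dimensions gives l^2 = |T|. *)
Lemma graded_division_data : exists (T : {fset G}) (beta : G -> G -> F),
  [/\ is_subgroup T, is_nondeg_alt_bichar T beta, (l * l = #|` T|)%N
    & is_graded_division T beta D].
Proof.
have [S [D0 dD fD]] := Dgr.1.
pose T := [fset t in S | D t != 0%VS]%fset.
have TP t : reflect (exists2 x, x \in D t & x != 0) (t \in T).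
  rewrite !inE /=; apply: (iffP andP) => [[_ Dt]|[x Dx x0]].
    by exists (vpick (D t)); rewrite ?memv_pick // vpick0.
  have Dt : D t != 0%VS by apply: contraNneq x0 => Dt; rewrite -memv0 -Dt.
  by split=> //; apply: contraNT Dt => /D0/eqP.
have mulT u v x y : x \in D u -> y \in D v -> x != 0 -> y != 0 -> x *m y != 0.
  move=> Dx Dy x0 y0; apply: contraNneq y0 => xy0.
  by rewrite -(mulKmx (Dinv Dx x0) y) xy0 mulmx0.
have [[u v]|beta betaP] := @boolp.choice _ _ (fun uv (b : F) => b != 0 /\
  forall x y, x \in D uv.1 -> y \in D uv.2 -> x *m y = b *: (y *m x)).
  have [/andP[/TP[x Dx x0] /TP[y Dy y0]]|nT] := boolP ((u \in T) && (v \in T)).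
    have xy : x *m y \in D (u + v) by apply: grading_mul.
    have yx : y *m x \in D (u + v) by rewrite addrC; apply: grading_mul.
    have [b xyE] := component_line yx xy (mulT _ _ _ _ Dy Dx y0 x0).
    exists b; split.
      apply: contraNneq (mulT _ _ _ _ Dx Dy x0 y0) => b0.
      by rewrite xyE b0 scale0r.
    move=> x' y' /(component_line Dx)/(_ x0)[a ->] /(component_line Dy)/(_ y0)[c ->].
    rewrite -!scalemxAl -!scalemxAr xyE !scalerA.
    by congr (_ *: _); ring.
  (* Default value outside T x T, where one of the two components is zero. *)
  exists 1; split=> [|x y Dx Dy]; first exact: oner_neq0.
  suff [->|->] : x = 0 \/ y = 0 by rewrite ?mul0mx ?mulmx0 scaler0.
  move: nT; rewrite negb_and => /orP[nT|nT]; [left | right]; apply/eqP;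
    apply: contraNT nT => nz; apply/TP; [by exists x | by exists y].
have bcomm u v x y : x \in D u -> y \in D v -> x *m y = beta (u, v) *: (y *m x).
  by move=> Dx Dy; have [_] := betaP (u, v); apply.
have scal_inj (x : 'M[F]_l) a b : x != 0 -> a *: x = b *: x -> a = b.
  move=> x0 /eqP; rewrite -subr_eq0 -scalerBl scaler_eq0 (negPf x0) orbF subr_eq0.
  by move/eqP.
have T0 : 0 \in T.
  apply/TP; exists 1%:M; first exact: grading_one.
  by rewrite -mxrank_eq0 mxrank1 -lt0n.
have dimT g : \dim (D g) = (g \in T).
  have [/TP[x Dx x0]|nT] := boolP (g \in T).
    suff -> : D g = <[x]>%VS by rewrite dim_vline x0.
    apply/eqP; rewrite eqEsubv -memvE Dx andbT; apply/subvP => y Dy.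
    by have [a ->] := component_line Dx Dy x0; rewrite memvZ // memv_line.
  suff -> : D g = 0%VS by rewrite dimv0.
  by apply/eqP; rewrite -vpick0; apply: contraNT nT => nz; apply/TP;
    exists (vpick (D g)); rewrite ?memv_pick.
exists T, (fun u v => beta (u, v)); split.
- split=> // u v /TP[x Dx x0] /TP[y Dy y0]; have uy := Dinv Dy y0.
  apply/TP; exists (x *m invmx y); first exact: grading_mul (grading_invmx Dy uy).
  by rewrite -(mul0mx _ (invmx y)) (can_eq (mulmxK (_ : invmx y \in unitmx))) ?unitmx_inv.
- split=> [u v _ _|u v w /TP[x Dx x0] /TP[y Dy y0] /TP[z Dz z0]
    |u v w /TP[x Dx x0] /TP[y Dy y0] /TP[z Dz z0]|u /TP[x Dx x0]|u /TP[x Dx x0] u1].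
  + by have [] := betaP (u, v).
  + have Dxy := grading_mul Dgr Dx Dy.
    apply: (scal_inj (z *m (x *m y))).
      by apply: (mulT w (u + v)) => //; apply: (mulT u v).
    rewrite -(bcomm _ _ _ _ Dxy Dz) -mulmxA (bcomm _ _ _ _ Dy Dz) -scalemxAr.
    by rewrite [x *m (z *m y)]mulmxA (bcomm _ _ _ _ Dx Dz) -scalemxAl scalerA mulrC mulmxA.
  + have Dyz := grading_mul Dgr Dy Dz.
    apply: (scal_inj (y *m z *m x)).
      by apply: (mulT (v + w) u) => //; apply: (mulT v w).
    rewrite -(bcomm _ _ _ _ Dx Dyz) [x *m _]mulmxA (bcomm _ _ _ _ Dx Dy) -scalemxAl.
    by rewrite -mulmxA (bcomm _ _ _ _ Dx Dz) -scalemxAr scalerA mulmxA.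
  + by apply: (scal_inj (x *m x)); rewrite ?(mulT u u) // -bcomm // scale1r.
  have [c xc] : exists c, x = c%:M.
    apply: commutant_scalar => y; have [S' [pr [_ prD _ prS]]] := is_decomp_by_exists Dgr.1.
    rewrite -(prS y) mulmx_sumr mulmx_suml; apply: eq_bigr => h _.
    have [Th|nTh] := boolP (h \in T).
      by rewrite (bcomm _ _ _ _ Dx (prD h y)) u1 // scale1r.
    suff -> : pr h y = 0 by rewrite mulmx0 mul0mx.
    by apply/eqP; apply: contraNT nTh => nz; apply/TP; exists (pr h y).
  apply: (degree_eq Dx _ x0); rewrite xc -scalemx1 memvZ //.
  exact: grading_one.
- have -> : (l * l = \dim (fullv : {vspace 'M[F]_l}))%N by rewrite dimvf.
  rewrite -fD (directvP dD) /= -sum1_size.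
  rewrite [RHS]big_fset /= [RHS]big_mkcond /=.
  apply: eq_bigr => g _; rewrite dimT.
  have [/TP[x Dx x0]|nT] := boolP (g \in T).
    by rewrite ifT //; apply: contraNneq x0 => Dg0; rewrite -memv0 -Dg0.
  case: ifP => // Dg0; case/TP: nT; exists (vpick (D g)); rewrite ?memv_pick //.
  by rewrite vpick0.
split=> // u v _ _ x y; exact: bcomm.
Qed.

End GradedDivision.

(** * The degree of upsilon *)

Section Existence.
Variables (F : closedFieldType) (G : zmodType) (m n : nat).
Hypothesis charF0 : [pchar F] =i pred0.
Local Notation N := (m.+1 + n.+1)%N.
Local Notation M := 'M[F]_N.
Local Notation sls := (slspace F m.+1 n.+1).
Variable (W : G -> {vspace M}).
Hypothesis Wgr : is_grading (@mulmx F N N N) W.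

Let upsilon : M := eps false - eps true.

Lemma natr_char0 k : (k.+1)%:R != 0 :> F.
Proof. by rewrite (pcharf0P _).1. Qed.

Lemma upsilon2 : upsilon *m upsilon = 1%:M.
Proof.
rewrite /upsilon mulmxBl !mulmxBr !eps_mul /= subr0 sub0r opprK.
exact: eps_sum.
Qed.

Lemma upsilon_neq0 : upsilon != 0.
Proof.
apply: contra_eqN upsilon2 => /eqP ->; rewrite mul0mx eq_sym.
by rewrite -mxrank_eq0 mxrank1.
Qed.

Lemma conj_upsilon (x : M) : upsilon *m x *m upsilon = mxpar false x - mxpar true x.
Proof.
rewrite !mxparE [upsilon *m x]mulmxBl mulmxBr !mulmxBl opprB opprD.
by rewrite [LHS](AC (2*2) ((1*3)*(4*2))).
Qed.

Hypothesis Wsup : forall g, W g = (W g :&: Mpar F m.+1 n.+1 false + W g :&: Mpar F m.+1 n.+1 true)%VS.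

(** Conjugation by [upsilon] is the parity automorphism, and each component is spanned by its even
    and odd elements. *)
Lemma conj_upsilon_mem g x : x \in W g -> upsilon *m x *m upsilon \in W g.
Proof.
rewrite {1}Wsup => /memv_addP[x0]; rewrite memv_cap => /andP[Wx0 p0] [x1].
rewrite memv_cap => /andP[Wx1 p1] ->.
move: p0 p1; rewrite !mem_Mpar => /eqP p0 /eqP p1.
have par_par i j (z : M) : mxpar i (mxpar j z) = if i == j then mxpar i z else 0.
  by case: i j => [] []; rewrite /mxpar !(block_mxKul, block_mxKur, block_mxKdl,
    block_mxKdr) ?block_mx0.
have p10 : mxpar true x0 = 0 by rewrite -p0 par_par.
have p01 : mxpar false x1 = 0 by rewrite -p1 par_par.
have parD i (z w : M) : mxpar i (z + w) = mxpar i z + mxpar i w by exact: linearD.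
rewrite conj_upsilon !parD p0 p1 p10 p01.
rewrite addr0 add0r.
by rewrite memvB.
Qed.

(* Since [upsilon x = x' upsilon] with x' of the same degree as x, every
   component of [upsilon] is central up to the factor [upsilon]. *)
Lemma upsilon_homogeneous : exists t, upsilon \in W t.
Proof.
have [S [pr Wpr]] := is_decomp_by_exists Wgr.1; have [W0 prW prE prS] := Wpr.
have [h prh] : exists h, pr h upsilon != 0.
  apply: boolp.contrapT => nh; case/eqP: upsilon_neq0.
  rewrite -(prS upsilon) big1 // => h _; apply/eqP/negPn/negP => prh.
  by case: nh; exists h.
exists h; have [c hE] : exists c, upsilon *m pr h upsilon = c%:M.
  apply: commutant_scalar => y; rewrite -(prS y) mulmx_sumr mulmx_suml.
  apply: eq_bigr => g _; move: (pr g y) (prW g y) => x Wx.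
  (* With u_h the h-component of [upsilon] and x' its conjugate of x, comparing terms of degree h +
     g in upsilon x = x' upsilon gives u_h x = x' u_h; a further factor [upsilon] turns x' back into
     x. *)
  have Wx' := conj_upsilon_mem Wx.
  have e : upsilon *m x = upsilon *m x *m upsilon *m upsilon.
    by rewrite -mulmxA upsilon2 mulmx1.
  have := congr1 (pr (h + g)) e.
  rewrite (proj_mulr Wgr Wpr _ _ Wx) (proj_mull Wgr Wpr _ _ Wx').
  move/(congr1 (mulmx upsilon)); rewrite !mulmxA => ->.
  by rewrite upsilon2 mul1mx.
have uh : pr h upsilon = c *: upsilon.
  by rewrite -[LHS]mul1mx -upsilon2 -mulmxA hE mul_mx_scalar.
have c0 : c != 0 by apply: contraNneq prh => c0; rewrite uh c0 scale0r.
by rewrite -(scalerK c0 upsilon) -uh memvZ.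
Qed.

Variable t : G.
Hypothesis Wt : upsilon \in W t.

Lemma supertrace_component g x : x \in W g -> g != - t -> supertrace x = 0.
Proof.
move=> Wx gt; rewrite supertraceE (grading_trace0 Wgr (natr_char0 _) (g := t + g)) //.
  by rewrite addrC addr_eq0.
exact: grading_mul.
Qed.

(** Only the component of degree -t can have nonzero supertrace, and the supertraces of all
    components add up to that of E_ij, which is 0. This provides enough homogeneous elements of
    sl. *)
Lemma delta_components_sl S pr i j : is_decomp_by W S pr -> i != j ->
  forall g, pr g (delta_mx i j : M) \in sls.
Proof.
move=> Wpr ij g; have [W0 prW prE prS] := Wpr; rewrite mem_slspace.
have [gt|gt] := eqVneq g (- t); last by rewrite (supertrace_component (prW _ _) gt).
have : supertrace (delta_mx i j : M) = 0.
  rewrite supertraceE mxtrace_mul_delta mxE [X in _ + X]mxE !epsE eq_sym (negPf ij) /=.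
  exact: subrr.
rewrite -{1}(prS (delta_mx i j)) linear_sum /=.
rewrite (eq_bigr (fun h => if h == g then supertrace (pr h (delta_mx i j : M)) else 0)).
  rewrite sum_fset_if; case: ifP => [_ -> //|/negbT nSg _].
  by rewrite (proj_notin Wpr _ nSg) raddf0.
move=> h _; case: eqP => // /eqP hg; apply: (supertrace_component (prW _ _)).
by rewrite -gt.
Qed.

(* The trace of x rules out the scalar ambiguity in psl. *)
Lemma conj_on_sl (f : 'End(Alie F m n)) (P : M) (chi : G -> F) g x :
    is_character chi -> P \in unitmx ->
    {in sls, forall x, f (Acls x) = Acls (P *m x *m invmx P)} ->
    (forall a, a \in induced_grading W g -> f a = chi g *: a) ->
    P *m x *m invmx P \in sls -> x \in sls -> x \in W g ->
  P *m x *m invmx P = chi g *: x.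
Proof.
move=> [chi0 chiD] uP fP fchi slPx slx Wx.
have := fchi (Acls x); rewrite fP // -linearZ /= => e.
have [|||k [xE _]] := @Acls_eq F m n (P *m x *m invmx P) (chi g *: x).
- by [].
- by rewrite memvZ.
- by apply: e; apply/mem_induced; exists x.
suff k0 : k = 0 by rewrite xE k0 raddf0 addr0.
have := congr1 mxtrace xE.
rewrite mxtrace_mulC mulmxA mulVmx // mul1mx mxtraceD mxtraceZ mxtrace_scalar.
have trE : \tr x = chi g * \tr x.
  have [g0|g0] := eqVneq g 0; last by rewrite (grading_trace0 Wgr (natr_char0 _) g0 Wx) mulr0.
  have /eqP := chiD 0 0; rewrite addr0 -{1}[chi 0]mulr1 (inj_eq (mulfI (chi0 0))).
  by rewrite g0 eq_sym => /eqP ->; rewrite mul1r.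
rewrite -trE -{1}[\tr x]addr0 => /addrI /esym/eqP.
by rewrite -mulr_natl mulf_eq0 (negPf (natr_char0 _)) => /eqP.
Qed.

End Existence.

Section EvenGradings.
Variables (F : closedFieldType) (G : zmodType) (m n : nat).
Hypothesis charF0 : [pchar F] =i pred0.
Local Notation N := (m.+1 + n.+1)%N.
Local Notation M := 'M[F]_N.
Local Notation sls := (slspace F m.+1 n.+1).
Variable (W : G -> {vspace M}).
Hypothesis Wgr : is_grading (@mulmx F N N N) W.
Local Notation upsilon := (eps false - eps true : M).

(** Conjugation by P is known to act by chi on sl only. Each E_ii is E_ij E_ji with j != i, so its
    component of degree t is a sum of products of components lying in sl, on which P acts by chi(t).
    As [upsilon] is diagonal of degree t, P multiplies it by chi(t); but P is even and commutes with
    it. *)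
Lemma character_upsilon t (f : 'End(Alie F m n)) (P : M) (chi : G -> F) :
    upsilon \in W t -> is_character chi -> P \in unitmx -> mxpar false P = P ->
    {in sls, forall x, f (Acls x) = Acls (P *m x *m invmx P)} ->
    (forall g a, a \in induced_grading W g -> f a = chi g *: a) ->
  chi t = 1.
Proof.
move=> Wt chiP uP Ppar fP fchi; have PV := mulmxV uP; have VP := mulVmx uP.
have [S [pr Wpr]] := is_decomp_by_exists Wgr.1; have [W0 prW prE prS] := Wpr.
have [_ _ Psl _ _] := conj_lift PV Ppar.
have homog g x : x \in sls -> x \in W g -> P *m x *m invmx P = chi g *: x.
  move=> slx Wx; apply: (conj_on_sl charF0 Wgr chiP uP fP (fchi g)) => //.
  by have := Psl _ slx; rewrite lfunE.
have diag i : P *m pr t (delta_mx i i) *m invmx P = chi t *: pr t (delta_mx i i).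
  have [j ij] : exists j, i != j.
    have [->|i0] := eqVneq i (lshift n.+1 ord0); last by exists (lshift n.+1 ord0).
    by exists (rshift m.+1 ord0); rewrite eq_lrshift.
  have -> : pr t (delta_mx i i) =
      \sum_(g <- S) pr g (delta_mx i j) *m pr (t - g) (delta_mx j i).
    rewrite -{1}(mul_delta_mx j) -{1}(prS (delta_mx i j)) mulmx_suml linear_sum /=.
    apply: eq_bigr => g _; rewrite -(proj_mull Wgr Wpr _ _ (prW g _)).
    by rewrite subrK.
  rewrite mulmx_sumr mulmx_suml scaler_sumr; apply: eq_bigr => g _.
  have sl1 := delta_components_sl charF0 Wgr Wt Wpr ij g.
  have sl2 : pr (t - g) (delta_mx j i : M) \in sls.
    by apply: (delta_components_sl charF0 Wgr Wt Wpr); rewrite eq_sym.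
  have [_ chiD] := chiP; rewrite -[in chi t](subrK g t) chiD mulrC.
  move: (homog _ _ sl1 (prW g _)) (homog _ _ sl2 (prW _ _)).
  set x := pr g _; set y := pr _ _ => ex ey.
  rewrite -scalerA scalemxAr -ey scalemxAl -ex.
  by rewrite !mulmxA -(mulmxA _ (invmx P) P) VP mulmx1.
have ut : pr t upsilon = upsilon by rewrite (prE t) // eqxx.
have uE : upsilon = \sum_i upsilon i i *: delta_mx i i.
  rewrite [LHS]matrix_sum_delta; apply: eq_bigr => i _.
  rewrite (bigD1 i) //= big1 ?addr0 // => j /negPf ji.
  have -> : upsilon i j = 0.
    by rewrite mxE [X in _ + X]mxE !epsE eq_sym ji /= subrr.
  by rewrite scale0r.
have : P *m upsilon *m invmx P = chi t *: upsilon.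
  rewrite -ut {1 2}uE linear_sum mulmx_sumr mulmx_suml scaler_sumr.
  apply: eq_bigr => i _; rewrite !linearZ /= -scalemxAl diag.
  by rewrite !scalerA mulrC.
have -> : P *m upsilon *m invmx P = upsilon.
  by rewrite mulmxBr -!(even_mxP Ppar) -mulmxBl -mulmxA PV mulmx1.
move/eqP; rewrite -{1}[upsilon]scale1r -subr_eq0 -scalerBl scaler_eq0.
by rewrite (negPf (upsilon_neq0 _ _ _)) orbF subr_eq0 => /eqP <-.
Qed.

Hypothesis Wups : upsilon \in W 0.

Lemma eps_degree0 b : eps b \in W 0.
Proof.
have two : 2%:R != 0 :> F by exact: (natr_char0 charF0 1).
have e1 := eps_sum F m.+1 n.+1; have W1 := grading_one Wgr.
have -> : eps b = 2%:R^-1 *: (1%:M + (-1) ^+ b *: upsilon) :> M.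
  apply: (scalerI two); rewrite scalerA divff // scale1r scaler_nat mulr2n -e1.
  case: b; rewrite ?expr0 ?expr1 ?scale1r ?scaleN1r ?opprB.
    by rewrite [eps false + _]addrC addrACA subrr addr0.
  by rewrite addrACA subrr addr0.
by rewrite memvZ // memvD // memvZ.
Qed.

End EvenGradings.

Lemma natr_inj_char0 (F : fieldType) : [pchar F] =i pred0 ->
  injective (fun k : nat => k%:R : F).
Proof.
move=> charF0 a b; wlog ab : a b / (a <= b)%N => [th ab|ab_eq].
  by have [/th->|/ltnW/th->] := leqP a b.
have /eqP : (b - a)%:R = 0 :> F by rewrite natrB // ab_eq subrr.
by rewrite (pcharf0P F).1 // subn_eq0 => ba; apply/eqP; rewrite eqn_leq ab.
Qed.

(** A rank factorisation, which identifies the corner e M e with M_l(F) through d |-> u d v; the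
    size l of the future D is the rank of e. *)
Lemma idempotent_factor (F : fieldType) N (e : 'M[F]_N) : e *m e = e -> e != 0 ->
  exists (l : nat) (u : 'M[F]_(N, l)) (v : 'M[F]_(l, N)),
    [/\ (0 < l)%N, u *m v = e & v *m u = 1%:M].
Proof.
move=> ee e0; exists (\rank e), (col_base e), (row_base e); rewrite mulmx_base.
split=> //; first by rewrite lt0n mxrank_eq0.
have /row_fullP[A Au] : row_full (col_base e) by apply: col_base_full.
have /row_freeP[B vB] : row_free (row_base e) by apply: row_base_free.
have : col_base e *m row_base e *m (col_base e *m row_base e) = col_base e *m row_base e.
  by rewrite mulmx_base.
move: (col_base e) (row_base e) Au vB => C R AC RB /(congr1 (fun z => A *m z *m B)).
by rewrite !mulmxA AC !mul1mx -!mulmxA RB !mulmx1.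
Qed.

(** * Construction of the data of an even grading *)

Section EvenClassification.
Variables (F : closedFieldType) (G : zmodType) (m n : nat).
Hypothesis charF0 : [pchar F] =i pred0.
Local Notation N := (m.+1 + n.+1)%N.
Local Notation M := 'M[F]_N.
Variable (W : G -> {vspace M}).
Hypothesis Wgr : is_grading (@mulmx F N N N) W.
Hypothesis Wups : (eps false - eps true : M) \in W 0.

(** Concatenating decompositions of the two diagonal projections makes the parity of an idempotent
    readable from its position. *)
Lemma primitive_frame : exists (k0 k1 : nat) (e : 'I_(k0 + k1) -> M),
  [/\ forall i, primitive W (e i),
      forall i j, e i *m e j = if i == j then e i else 0,
      forall i : 'I_(k0 + k1), eps (k0 <= i)%N *m e i = e i,
      \sum_(i < k0) e (lshift k1 i) = eps false
    & \sum_(i < k1) e (rshift k0 i) = eps true].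
Proof.
have Weps b : eps b \in W 0 by apply: eps_degree0.
have idem b : eps b *m eps b = eps b :> M by rewrite eps_mul eqxx.
have [s0 [us0 ps0 os0 sum0]] := primitive_decomposition (Weps false) (idem false).
have [s1 [us1 ps1 os1 sum1]] := primitive_decomposition (Weps true) (idem true).
have par0 a : a \in s0 -> eps false *m a = a /\ a *m eps false = a.
  by move=> sa; rewrite -sum0; apply: sum_orthogonal_mul => //; have [] := ps0 _ sa.
have par1 a : a \in s1 -> eps true *m a = a /\ a *m eps true = a.
  by move=> sa; rewrite -sum1; apply: sum_orthogonal_mul => //; have [] := ps1 _ sa.
exists (size s0), (size s1), (fun i => nth 0 (s0 ++ s1) i).
have nthl (i : 'I_(size s0)) : nth 0 (s0 ++ s1) (lshift (size s1) i) = nth 0 s0 i.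
  by rewrite nth_cat /= ltn_ord.
have nthr (i : 'I_(size s1)) : nth 0 (s0 ++ s1) (rshift (size s0) i) = nth 0 s1 i.
  by rewrite nth_cat /= ltnNge leq_addr /= addKn.
have m0 (i : 'I_(size s0)) : nth 0 s0 i \in s0 by rewrite mem_nth.
have m1 (i : 'I_(size s1)) : nth 0 s1 i \in s1 by rewrite mem_nth.
have cross b (a c : M) : a *m eps b = a -> eps (~~ b) *m c = c -> a *m c = 0.
  move=> <- <-; rewrite mulmxA -(mulmxA a) eps_mul.
  by case: b; rewrite mulmx0 mul0mx.
split.
- by move=> i; case: (split_ordP i) => j ->; rewrite ?nthl ?nthr; [apply: ps0 | apply: ps1].
- move=> i j; case: (split_ordP i) => i' ->; case: (split_ordP j) => j' ->;
    rewrite ?nthl ?nthr ?eq_lshift ?eq_rshift ?eq_lrshift ?eq_rlshift.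
  + case: eqP => [->|/eqP ij]; first by have [] := ps0 _ (m0 j').
    by apply: os0; rewrite // nth_uniq.
  + exact: (cross false _ _ (par0 _ (m0 i')).2 (par1 _ (m1 j')).1).
  + exact: (cross true _ _ (par1 _ (m1 i')).2 (par0 _ (m0 j')).1).
  case: eqP => [->|/eqP ij]; first by have [] := ps1 _ (m1 j').
  by apply: os1; rewrite // nth_uniq.
- move=> i; case: (split_ordP i) => j ->; rewrite ?nthl ?nthr /=.
    by rewrite leqNgt ltn_ord; have [] := par0 _ (m0 j).
  by rewrite leq_addr; have [] := par1 _ (m1 j).
- by rewrite -sum0 (big_nth 0) big_mkord; apply: eq_bigr => i _; rewrite nthl.
by rewrite -sum1 (big_nth 0) big_mkord; apply: eq_bigr => i _; rewrite nthr.
Qed.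

(** The matrix algebra is prime, so e z e' is nonzero for some z; as e and e' have degree 0, cutting
    z into components keeps one of them nonzero, and primitivity inverts it. *)
Lemma corner_inverse e e' : primitive W e -> primitive W e' -> exists gxy : G * M * M,
  [/\ gxy.1.2 \in W gxy.1.1, gxy.2 \in W (- gxy.1.1),
      [/\ e *m gxy.1.2 = gxy.1.2, gxy.1.2 *m e' = gxy.1.2,
          e' *m gxy.2 = gxy.2 & gxy.2 *m e = gxy.2],
      gxy.1.2 *m gxy.2 = e & gxy.2 *m gxy.1.2 = e'].
Proof.
move=> pe pe'; have [We ee e0 _] := pe; have [We' e'e' e'0 _] := pe'.
have [z ze0] := mx_prime e0 e'0.
have [S [pr [W0 prW prE prS]]] := is_decomp_by_exists Wgr.1.
have [g xg0] : exists g, e *m pr g z *m e' != 0.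
  apply: boolp.contrapT => ng; case/eqP: ze0; rewrite -(prS z) mulmx_sumr mulmx_suml.
  rewrite big1 // => g _; apply/eqP/negPn/negP => xg; by case: ng; exists g.
have Wx : e *m pr g z *m e' \in W g.
  exact: grading_corner.
have ex : e *m (e *m pr g z *m e') = e *m pr g z *m e' by rewrite !mulmxA ee.
have xe' : e *m pr g z *m e' *m e' = e *m pr g z *m e' by rewrite -mulmxA e'e'.
have [y [Wy e'y ye xy yx]] :=
  primitive_inverse Wgr (natr_char0 charF0 _) pe pe' Wx xg0 ex xe'.
by exists (g, e *m pr g z *m e', y).
Qed.

Lemma even_grading_GammaA : exists p : gammaData F G m n,
  isomorphic_gradings (induced_grading W : G -> {vspace Alie F m n}) (GammaA p).
Proof.
have [k0 [k1 [e [pe ee epar sum0 sum1]]]] := primitive_frame.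
have k0_gt0 : (0 < k0)%N.
  rewrite lt0n; apply: contra_eq_neq sum0 => k00.
  rewrite big1 => [|i _]; last by have := ltn_ord i; rewrite [X in (_ < X)%N]k00.
  apply/eqP => /(congr1 (fun x : M => x ord0 ord0)).
  by rewrite epsE !mxE => /esym/eqP; rewrite oner_eq0.
pose i0 : 'I_(k0 + k1) := lshift k1 (Ordinal k0_gt0).
have We i : e i \in W 0 by have [] := pe i.
have eei i : e i *m e i = e i by rewrite ee eqxx.
(* x_i and y_i link e_i to the reference idempotent at [i0]; the degree of x_i becomes the entry g_i
   of the tuples. *)
have [gxy gxyP] := boolp.choice (fun i => corner_inverse (pe i) (pe i0)).
pose gam i := (gxy i).1.1; pose x i := (gxy i).1.2; pose y i := (gxy i).2.
have Wx i : x i \in W (gam i) by have [] := gxyP i.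
have Wy i : y i \in W (- gam i) by have [] := gxyP i.
have ex i : e i *m x i = x i by have [_ _ []] := gxyP i.
have xe i : x i *m e i0 = x i by have [_ _ []] := gxyP i.
have ey i : e i0 *m y i = y i by have [_ _ []] := gxyP i.
have ye i : y i *m e i = y i by have [_ _ []] := gxyP i.
have xy i : x i *m y i = e i by have [] := gxyP i.
have yx i : y i *m x i = e i0 by have [] := gxyP i.
have [l [u [v [l_gt0 uv vu]]]] : exists (l : nat) (u : 'M[F]_(N, l)) (v : 'M[F]_(l, N)),
    [/\ (0 < l)%N, u *m v = e i0 & v *m u = 1%:M].
  by apply: idempotent_factor; have [] := pe i0.
(* All e_i have the same trace l, so taking traces in the two decompositions yields k0 l = m + 1 and
   k1 l = n + 1, first in F and then in the integers by characteristic 0. *)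
have tre i : \tr (e i) = l%:R.
  by rewrite -xy mxtrace_mulC yx -uv mxtrace_mulC vu mxtrace1.
have k0P : (k0 * l = m.+1)%N.
  apply: (natr_inj_char0 charF0); rewrite natrM.
  have <- : \tr (eps false : M) = m.+1%:R by rewrite mxtrace_block mxtrace1 mxtrace0 addr0.
  rewrite -sum0 linear_sum /= (eq_bigr (fun=> l%:R)) // sumr_const card_ord.
  by rewrite mulr_natl.
have k1P : (k1 * l = n.+1)%N.
  apply: (natr_inj_char0 charF0); rewrite natrM.
  have <- : \tr (eps true : M) = n.+1%:R by rewrite mxtrace_block mxtrace1 mxtrace0 add0r.
  rewrite -sum1 linear_sum /= (eq_bigr (fun=> l%:R)) // sumr_const card_ord.
  by rewrite mulr_natl.
(* The corner at the reference idempotent, transported to M_l(F); primitivity makes its homogeneous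
   elements invertible. *)
pose D t := (linfun (mulmxr u \o mulmx v) @: W t)%VS.
have memD t d : (d \in D t) = (u *m d *m v \in W t).
  apply/memv_imgP/idP => [[z Wz ->]|Wd].
    rewrite lfunE /= !mulmxA uv -!mulmxA uv !mulmxA.
    exact: grading_corner.
  by exists (u *m d *m v); rewrite // lfunE /= !mulmxA vu mul1mx -mulmxA vu mulmx1.
have Dgr : is_grading (@mulmx F l l l) D.
  split; last first.
    move=> g h a b; rewrite !memD => Wa Wb.
    have := grading_mul Wgr Wa Wb; rewrite !mulmxA -(mulmxA _ v u) vu mulmx1.
    by [].
  have [S [pr [W0 prW prE prS]]] := is_decomp_by_exists Wgr.1.
  have comp d : v *m (u *m d *m v) *m u = d.
    by rewrite !mulmxA vu mul1mx -mulmxA vu mulmx1.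
  apply: (@is_decomposition_intro _ _ _ _ S (fun g d => v *m pr g (u *m d *m v) *m u)).
  - by move=> g a b; rewrite mulmxDr mulmxDl linearD mulmxDr mulmxDl.
  - move=> g /W0 Wg0; apply/eqP; rewrite -subv0; apply/subvP => d.
    by rewrite memD Wg0 !memv0 => /eqP d0; rewrite -(comp d) d0 mulmx0 mul0mx.
  - move=> g d; rewrite memD !mulmxA uv -!mulmxA uv !mulmxA.
    exact: grading_corner.
  - move=> g h d; rewrite memD => Wd; rewrite (prE g) //.
    by case: eqP => _; rewrite ?mulmx0 ?mul0mx.
  by move=> d; rewrite -mulmx_suml -mulmx_sumr prS.
have Dinv g d : d \in D g -> d != 0 -> d \in unitmx.
  rewrite memD => Wd d0.
  have comp : v *m (u *m d *m v) *m u = d.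
    by rewrite !mulmxA vu mul1mx -mulmxA vu mulmx1.
  have ud0 : u *m d *m v != 0.
    by apply: contraNneq d0 => d0; rewrite -comp d0 mulmx0 mul0mx.
  have [||z [_ _ _ dz _]] := primitive_inverse Wgr (natr_char0 charF0 _) (pe i0) (pe i0) Wd ud0.
  - by rewrite -uv !mulmxA -(mulmxA u) vu mulmx1.
  - by rewrite -uv !mulmxA -(mulmxA _ v u) vu mulmx1.
  have : d *m (v *m z *m u) = 1%:M.
    transitivity (v *m (u *m d *m v *m z) *m u).
      by rewrite !mulmxA vu mul1mx.
    by rewrite dz -uv !mulmxA vu mul1mx vu.
  by case/mulmx1_unit.
have [T [beta [Tsub betaP ellP DP]]] := graded_division_data Dgr l_gt0 Dinv.
pose p := GammaData [tuple gam (lshift k1 i) | i < k0] [tuple gam (rshift k0 i) | i < k1]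
  Tsub betaP ellP DP k0P k1P.
have gamE i : ggamma (p := p) i = gam i.
  by rewrite /ggamma; case: (split_ordP i) => j ->;
    rewrite ?tnth_lshift ?tnth_rshift tnth_mktuple.
exists p; apply: (@frame_isomorphic _ _ _ _ p W (fun i => x i *m u) (fun i => v *m y i)).
- by have [] := Wgr.
- move=> i j; rewrite mulmxA -(mulmxA v); case: eqP => [->|/eqP ij].
    by rewrite yx -uv !mulmxA vu mul1mx vu.
  have -> : y i *m x j = 0; last by rewrite mulmx0 mul0mx.
  by rewrite -(ye i) -(ex j) mulmxA -(mulmxA (y i)) ee (negPf ij) mulmx0 mul0mx.
- by move=> i; rewrite -ex !mulmxA epar.
move=> g z Wz i j; rewrite [_ \in _]memD !gamE.
have -> : u *m (v *m y i *m z *m (x j *m u)) *m v = y i *m z *m x j.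
  by rewrite !mulmxA uv ey -!mulmxA uv xe.
have -> : g - gam i + gam j = - gam i + g + gam j by rewrite [g - _]addrC.
by rewrite !(grading_mul Wgr).
Qed.

End EvenClassification.

Lemma even_typeI_GammaA (F : closedFieldType) (charF0 : [pchar F] =i pred0)
    (G : zmodType) m n (A : G -> {vspace Alie F m n}) :
  is_even_typeI A -> exists p : gammaData F G m n, isomorphic_gradings A (GammaA p).
Proof.
case=> [[W [Wgr Wsup] AW]] Achi.
have [t Wt] := upsilon_homogeneous Wgr Wsup.
have t0 : t = 0.
  (* The square of upsilon is 1, of degree 0. This makes -1 an admissible value of a character at a
     nonzero t. *)
  have tt0 : t + t = 0.
    apply: (degree_eq Wgr (grading_mul Wgr Wt Wt)); rewrite upsilon2.
      exact: grading_one.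
    by rewrite -mxrank_eq0 mxrank1.
  apply/eqP/negPn/negP => t0.
  have [chi chiP] := character_neq1 (natr_char0 charF0 1) t0 tt0.
  apply/negP; rewrite negbK; apply/eqP.
  have [f [_ [P [uP Peven fP]]] fchi] := Achi chi chiP.
  apply: (character_upsilon charF0 Wgr Wt chiP uP _ fP).
    by apply/eqP; rewrite -mem_Mpar.
  by move=> g a; rewrite -AW; apply: fchi.
rewrite t0 in Wt.
have [p pP] := even_grading_GammaA charF0 Wgr Wt.
exists p; have [f fa fW] := pP; exists f => // g.
by rewrite AW fW.
Qed.

(** * Isomorphic data give isomorphic gradings *)

(** Induction on the list: U is cut down to its intersection with an eigenspace of the first matrix,
    which the remaining ones preserve by commutativity. *)
Lemma common_eigenvector_stable (F : closedFieldType) n (As : seq 'M[F]_n) k (U : 'M[F]_(k, n)) :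
    U != 0 -> {in As &, forall A B, A *m B = B *m A} ->
    {in As, forall A, (U *m A <= U)%MS} ->
  exists w : 'rV_n, [/\ w != 0, (w <= U)%MS & {in As, forall A, exists a, w *m A = a *: w}].
Proof.
elim: As k U => [|A As IH] k U U0 comm stab.
  have [i /negPn Ui] : exists i, ~~ (row i U == 0).
    apply/existsP; rewrite -negb_forall; apply: contra U0 => /forallP rowU0.
    by apply/eqP/row_matrixP => i; rewrite row0; apply/eqP.
  by exists (row i U); rewrite row_sub; split=> //; apply/negPn.
have /submxP[R RE] : (row_base U *m A <= row_base U)%MS.
  rewrite (eqmxMr _ (eq_row_base U)) eq_row_base.
  by apply: stab; rewrite inE eqxx.
have /closed_rootP[a] : size (char_poly R) != 1%N.
  by rewrite size_char_poly eqSS mxrank_eq0.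
rewrite -eigenvalue_root_char => /eigenvalueP[w wR w0].
have wA : w *m row_base U *m A = a *: (w *m row_base U).
  by rewrite -mulmxA RE mulmxA wR -scalemxAl.
have wU0 : w *m row_base U != 0 by rewrite mulmx_free_eq0 ?row_base_free.
pose U' := (U :&: eigenspace A a)%MS.
have wU' : (w *m row_base U <= U')%MS.
  rewrite sub_capmx (submx_trans (submxMl _ _)) ?eq_row_base //.
  exact/eigenspaceP.
have [|B C AsB AsC|B AsB|v [v0 vU' vAs]] := IH _ U'.
- by apply: contraNneq wU0 => U'0; move: wU'; rewrite U'0 submx0.
- by apply: comm; rewrite inE ?AsB ?AsC orbT.
- rewrite sub_capmx (submx_trans (submxMr _ (capmxSl _ _))) ?stab ?inE ?AsB ?orbT //=.
  apply/eigenspaceP; have /eigenspaceP U'A : (U' <= eigenspace A a)%MS by apply: capmxSr.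
  by rewrite -mulmxA (comm B A) ?inE ?eqxx ?AsB ?orbT // mulmxA U'A -scalemxAl.
exists v; move: vU'; rewrite sub_capmx => /andP[vU /eigenspaceP vA].
split=> // B; rewrite inE => /predU1P[->|/vAs //].
by exists a.
Qed.

(** Both X_i X_j z Y_j Y_i and X_j X_i z Y_i Y_j equal a X_j X_i z Y_j Y_i, so the operators z |->
    X_i z Y_i commute. *)
Lemma common_eigenmatrix (F : closedFieldType) (I : eqType) (s : seq I) l l'
    (X : I -> 'M[F]_l') (Y : I -> 'M[F]_l) : (0 < l)%N -> (0 < l')%N ->
    {in s &, forall i j, exists a, X i *m X j = a *: (X j *m X i) /\
                                   Y i *m Y j = a *: (Y j *m Y i)} ->
  exists2 z : 'M[F]_(l', l), z != 0 & {in s, forall i, exists a, X i *m z *m Y i = a *: z}.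
Proof.
move=> l0 l'0 comm; pose A i := lin_mx (mulmxr (Y i) \o mulmx (X i)).
have AE i z : mxvec z *m A i = mxvec (X i *m z *m Y i) by rewrite mul_vec_lin.
have [|B C /mapP[i si ->] /mapP[j sj ->]|B _|w [w0 _ wA]] :=
  @common_eigenvector_stable F (l' * l) [seq A i | i <- s] _ 1%:M.
- by rewrite -mxrank_eq0 mxrank1 -lt0n muln_gt0 l0 l'0.
- apply/row_matrixP => r; rewrite !rowE !mulmxA -[delta_mx _ _]vec_mxK !AE.
  set z := vec_mx _; have [a [Xij Yij]] := comm _ _ si sj.
  congr mxvec; rewrite !mulmxA -!(mulmxA _ (Y _)).
  by rewrite Xij Yij -scalemxAr -!scalemxAl.
- by rewrite submx1.
exists (vec_mx w); first by rewrite -(inj_eq (can_inj mxvecK)) vec_mxK linear0.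
move=> i si; have [a wAi] := wA _ (map_f A si); exists a.
by apply: (can_inj mxvecK); rewrite linearZ /= vec_mxK -wAi -{2}(vec_mxK w) AE.
Qed.

(** * Uniqueness of D for given T and beta *)

Section GradedDivisionUnique.
Variables (F : closedFieldType) (G : zmodType) (T : {fset G}) (beta : G -> G -> F).

Lemma graded_division_pick l (D : G -> {vspace 'M[F]_l}) t :
  is_graded_division T beta D -> t \in T ->
  [/\ vpick (D t) \in D t, vpick (D t) \in unitmx
    & forall d, d \in D t -> exists a, d = a *: vpick (D t)].
Proof.
move=> [_ Dinv Ddim _] Tt; have Dt1 : \dim (D t) = 1%N by rewrite Ddim Tt.
have X0 : vpick (D t) != 0 by rewrite vpick0 -dimv_eq0 Dt1.
split; first exact: memv_pick; first exact: Dinv (memv_pick _) X0.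
move=> d Dd; apply/vlineP; suff -> : <[vpick (D t)]>%VS = D t by [].
by apply/eqP; rewrite eqEdim -memvE memv_pick dim_vline X0 Dt1.
Qed.

(* With X t and X' t spanning the components, the operators
   z |-> X' t z (X t)^-1 commute, since both commutation factors are beta.  A
   common eigenvector z intertwines D and D', and it is invertible as its kernel
   and cokernel are stable under the full matrix algebras. *)
Lemma graded_division_iso l l' (D : G -> {vspace 'M[F]_l}) (D' : G -> {vspace 'M[F]_l'}) :
    (0 < l)%N -> (0 < l')%N ->
    is_graded_division T beta D -> is_graded_division T beta D' ->
  exists (z : 'M[F]_(l', l)) (z' : 'M[F]_(l, l')),
    [/\ z *m z' = 1%:M, z' *m z = 1%:M
      & forall t d, d \in D t -> z *m d *m z' \in D' t].
Proof.
move=> l0 l'0 DP D'P; have [[Dd DM] Dinv Ddim Dcomm] := DP.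
have [[D'd D'M] D'inv D'dim D'comm] := D'P.
pose X t := vpick (D t); pose X' t := vpick (D' t).
have [|z z0 zX] := @common_eigenmatrix F _ (T : seq G) _ _ X' (fun t => invmx (X t)) l0 l'0.
  move=> u v Tu Tv; exists (beta u v).
  have [Xu Xu1 _] := graded_division_pick DP Tu.
  have [Xv Xv1 _] := graded_division_pick DP Tv.
  have [X'u _ _] := graded_division_pick D'P Tu.
  have [X'v _ _] := graded_division_pick D'P Tv.
  split; first exact: D'comm.
  have invM (a b : 'M[F]_l) : a \in unitmx -> b \in unitmx ->
      invmx a *m invmx b = invmx (b *m a).
    move=> ua ub; have uba : b *m a \in unitmx by rewrite unitmx_mul ub.
    apply: (can_inj (mulmxK uba)); rewrite mulVmx // mulmxA -(mulmxA _ _ b) mulVmx //.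
    by rewrite mulmx1 mulVmx.
  have uvu : X v *m X u \in unitmx by rewrite unitmx_mul Xv1.
  rewrite !invM // (Dcomm u v Tu Tv _ _ Xu Xv).
  have b0 : beta u v != 0.
    have : X u *m X v \in unitmx by rewrite unitmx_mul Xu1.
    rewrite (Dcomm u v Tu Tv _ _ Xu Xv); apply: contraTneq => ->.
    by rewrite scale0r -row_free_unit /row_free mxrank0 eq_sym -lt0n.
  rewrite invmxZ; first by rewrite scalerA divff // scale1r.
  by rewrite -(Dcomm u v Tu Tv _ _ Xu Xv) unitmx_mul Xu1.
have X'z t : t \in T -> exists2 a, a != 0 & X' t *m z = a *: (z *m X t).
  move=> Tt; have [_ Xt1 _] := graded_division_pick DP Tt.
  have [_ X't1 _] := graded_division_pick D'P Tt.
  have [a e] := zX t Tt; exists a.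
    apply: contraNneq z0 => a0; move: e; rewrite a0 scale0r.
    move/(congr1 (fun y => invmx (X' t) *m (y *m X t))).
    by rewrite mulmxKV // mulKmx // mul0mx mulmx0 => ->.
  by rewrite scalemxAl -e mulmxKV.
have [S [pr [_ prD _ prS]]] := is_decomp_by_exists Dd.
have [S' [pr' [_ prD' _ prS']]] := is_decomp_by_exists D'd.
have notT l2 (E : G -> {vspace 'M[F]_l2}) t d :
    is_graded_division T beta E -> d \in E t -> t \notin T -> d = 0.
  move=> [_ _ Edim _] Ed /negPf nTt; have /eqP := Edim t.
  by rewrite nTt dimv_eq0 => /eqP E0; apply/eqP; rewrite -memv0 -E0.
have fz : row_free z.
  rewrite -kermx_eq0; apply/negPn/negP => /mx_prime/(_ z0)[y].
  case/eqP; rewrite -(prS' y) mulmx_sumr mulmx_suml big1 // => t _.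
  have [Tt|nTt] := boolP (t \in T); last first.
    by rewrite (notT _ D' t (pr' t y)) // mulmx0 mul0mx.
  have [_ _ /(_ _ (prD' t y))[b ->]] := graded_division_pick D'P Tt.
  have [a _ e] := X'z t Tt.
  by rewrite -scalemxAr -scalemxAl -mulmxA e -scalemxAr mulmxA mulmx_ker mul0mx !scaler0.
have rz : row_full z.
  rewrite -cokermx_eq0; apply/negPn/negP => /(mx_prime z0)[y].
  case/eqP; rewrite -(prS y) mulmx_sumr mulmx_suml big1 // => t _.
  have [Tt|nTt] := boolP (t \in T); last first.
    by rewrite (notT _ D t (pr t y)) // mulmx0 mul0mx.
  have [_ _ /(_ _ (prD t y))[b ->]] := graded_division_pick DP Tt.
  have [a a0 /(canLR (scalerK a0)) e] := X'z t Tt.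
  by rewrite -scalemxAr -e -!scalemxAl -mulmxA mulmx_coker mulmx0 !scaler0.
have [B zB] := row_freeP fz; have [B' B'z] := row_fullP rz.
have BB : B' = B by rewrite -[B']mulmx1 -zB mulmxA B'z mul1mx.
exists z, B; split=> //; first by rewrite -BB.
move=> t d Dd'; have [Tt|nTt] := boolP (t \in T); last first.
  by rewrite (notT _ D t d) // mulmx0 mul0mx mem0v.
have [_ _ /(_ _ Dd')[b ->]] := graded_division_pick DP Tt.
have [a a0 /(canLR (scalerK a0)) e] := X'z t Tt.
rewrite -scalemxAr -e -!scalemxAl -mulmxA zB mulmx1 !memvZ //.
exact: memv_pick.
Qed.
End GradedDivisionUnique.

(** * Multisets of cosets *)

Section Multisets.
Variables (G : zmodType) (T : {fset G}).
Hypothesis Tsub : is_subgroup T.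

Lemma translate_eq a b : (translate a T == translate b T) = (a - b \in T).
Proof.
have [T0 TB] := Tsub.
have memT c x : (x \in translate c T) = (x - c \in T).
  apply/imfsetP/idP => [[y /= Ty ->]|Tx]; first by rewrite addrC addKr.
  by exists (x - c); rewrite //= addrC subrK.
apply/eqP/idP => [e|Tab].
  by rewrite -memT -e memT subrr.
apply/fsetP => x; rewrite !memT; apply/idP/idP => Tx.
  have -> : x - b = (x - a) - (0 - (a - b)); last exact: TB (TB _ _ T0 Tab).
  by rewrite sub0r opprK addrA subrK.
have -> : x - a = (x - b) - (a - b); last exact: TB.
by rewrite opprB addrA subrK.
Qed.

Lemma mtranslate_XiE g s s' :
  mtranslate g (Xi T s) = Xi T s' <->
  perm_eq [seq translate (g + x) T | x <- s] [seq translate x T | x <- s'].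
Proof.
have tt a b : translate a (translate b T) = translate (a + b) T.
  apply/fsetP => x; apply/imfsetP/imfsetP => /= [[_ /imfsetP[y /= Ty ->] ->]|[y Ty ->]].
    by exists y; rewrite // addrA.
  by exists (b + y); rewrite ?addrA //; apply/imfsetP; exists y.
have -> : [seq translate (g + x) T | x <- s] =
    [seq translate g C | C <- [seq translate x T | x <- s]].
  by rewrite -map_comp; apply: eq_map => x /=; rewrite tt.
have pe : perm_eq [seq translate g C | C <- Xi T s]
    [seq translate g C | C <- [seq translate x T | x <- s]].
  by apply: perm_map; apply: perm_eq_seq_mset.
rewrite /mtranslate; split=> [/eq_seq_msetP|e].
  by rewrite (permPl pe).
by apply/eq_seq_msetP; rewrite (permPl pe).
Qed.

Lemma perm_cosets_index k k' (c : k.-tuple G) (c' : k'.-tuple G) g :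
    perm_eq [seq translate (g + x) T | x <- c] [seq translate x T | x <- c'] ->
  exists2 s : 'I_k' -> 'I_k, injective s
    & forall j, tnth c' j - (g + tnth c (s j)) \in T.
Proof.
rewrite perm_sym => /(perm_iotaP (translate 0 T))[Is pIs tE].
have sIs : size Is = k' by have := congr1 size tE; rewrite !size_map size_tuple => ->.
have uIs : uniq Is by rewrite (perm_uniq pIs) iota_uniq.
have ltI (j : 'I_k') : (nth 0%N Is j < k)%N.
  have : nth 0%N Is j \in Is by rewrite mem_nth // sIs.
  by rewrite (perm_mem pIs) mem_iota size_map size_tuple.
exists (fun j => Ordinal (ltI j)) => [i j /(congr1 val)/eqP|j].
  by rewrite /= nth_uniq ?sIs // => /eqP/val_inj.
rewrite -translate_eq; have := congr1 (fun s => nth (translate 0 T) s j) tE.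
rewrite (nth_map 0) ?size_tuple // (nth_map 0%N) ?sIs // (nth_map 0) ?size_tuple ?ltI //.
by rewrite !(tnth_nth 0) => ->.
Qed.

End Multisets.

Lemma gell_gt0 (F : fieldType) (G : zmodType) m n (p : gammaData F G m n) : (0 < gell p)%N.
Proof. by have := gk0P p; case: (gell p) => //; rewrite muln0. Qed.

Section SufficientCondition.
Variables (F : closedFieldType) (G : zmodType).

(** After permuting the positions, g'_j and g + g_j differ by an element t_j of T, which a
    homogeneous unit of D of that degree absorbs into the j-th frame vector. The common shift g
    disappears because only differences of the g_i occur in degrees. *)
Lemma GammaA_isomorphic_shift m n (p p' : gammaData F G m n) g :
    gT p = gT p' -> {in gT p &, forall u v, gbeta p u v = gbeta p' u v} ->
    perm_eq [seq translate (g + x) (gT p) | x <- ggamma0 p]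
            [seq translate x (gT p) | x <- ggamma0 p'] ->
    perm_eq [seq translate (g + x) (gT p) | x <- ggamma1 p]
            [seq translate x (gT p) | x <- ggamma1 p'] ->
  isomorphic_gradings (GammaA p) (GammaA p').
Proof.
move=> TT bb pe0 pe1; have Tsub := gT_subgroup p.
have D'P : is_graded_division (gT p) (gbeta p) (gD p').
  have [D'gr D'inv D'dim D'comm] := gDP p'; split=> //; first by rewrite TT.
  by move=> u v Tu Tv x y Dx Dy; rewrite bb //; apply: D'comm; rewrite -?TT.
have [z [z' [zz' z'z zD]]] :=
  graded_division_iso (gell_gt0 p) (gell_gt0 p') (gDP p) D'P.
have [s0 s0_inj s0T] := perm_cosets_index Tsub pe0.
have [s1 s1_inj s1T] := perm_cosets_index Tsub pe1.
pose s (j : 'I_(gk0 p' + gk1 p')) : 'I_(gk0 p + gk1 p) :=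
  match split j with inl a => lshift _ (s0 a) | inr b => rshift _ (s1 b) end.
have s_inj : injective s.
  move=> i j; rewrite /s; case: (split_ordP i) => i' ->; case: (split_ordP j) => j' ->;
    rewrite ?split_lshift ?split_rshift => /eqP;
    rewrite ?eq_lshift ?eq_rshift ?eq_lrshift ?eq_rlshift // => /eqP.
    by move/s0_inj => ->.
  by move/s1_inj => ->.
pose t j := ggamma (p := p') j - (g + ggamma (p := p) (s j)).
have tT j : t j \in gT p.
  rewrite /t /ggamma /s; case: (split_ordP j) => i ->; rewrite ?split_lshift ?split_rshift.
    by rewrite !tnth_lshift; apply: s0T.
  by rewrite !tnth_rshift; apply: s1T.
have spar j : gpar (p := p) (s j) = gpar (p := p') j.
  rewrite /gpar /s; case: (split_ordP j) => i ->; rewrite ?split_lshift ?split_rshift /=.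
    by rewrite leqNgt ltn_ord leqNgt ltn_ord.
  by rewrite !leq_addr.
pose X j := vpick (gD p (t j)).
have DX j : X j \in gD p (t j) by apply: memv_pick.
have uX j : X j \in unitmx by have [] := graded_division_pick (gDP p) (tT j).
have DXV j : invmx (X j) \in gD p (- t j).
  by have [Dgr _ _ _] := gDP p; apply: grading_invmx.
apply: (@frame_isomorphic _ _ _ _ p' (GammaM p)
  (fun j => gu (s j) *m X j *m z') (fun j => z *m invmx (X j) *m gv (s j))).
- exact: GammaM_decomposition.
- move=> i j; rewrite !mulmxA -(mulmxA _ (gv _)) gvu (inj_eq s_inj).
  case: eqP => [->|_]; last by rewrite mulmx0 !mul0mx.
  by rewrite mulmx1 mulmxKV.
- by move=> j; rewrite -spar !mulmxA gu_par.
move=> h x /mem_GammaM Dx i j.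
have -> : z *m invmx (X i) *m gv (s i) *m x *m (gu (s j) *m X j *m z') =
    z *m (invmx (X i) *m (gv (s i) *m x *m gu (s j)) *m X j) *m z'.
  by rewrite !mulmxA.
apply: zD.
have -> : h - ggamma i + ggamma j =
    - t i + (h - ggamma (s i) + ggamma (s j)) + t j.
  rewrite /t opprB opprD.
  by rewrite [RHS](AC (3*3*(1*2)) (4*3*7*(2*5)*(6*9)*(1*8))) /= !subrr !addr0.
apply: gD_mul; first apply: gD_mul; [exact: DXV | exact: Dx | exact: DX].
Qed.

Lemma GammaA_isomorphic_delta m n (p p' : gammaData F G m n) (delta : int) g :
    delta = 1 \/ delta = -1 -> gT p = gT p' ->
    {in gT p &, forall u v, gbeta p u v ^ delta = gbeta p' u v} ->
    mtranslate g (Xi (gT p) (tuple_pow (ggamma0 p) delta)) = Xi (gT p') (ggamma0 p') ->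
    mtranslate g (Xi (gT p) (tuple_pow (ggamma1 p) delta)) = Xi (gT p') (ggamma1 p') ->
  isomorphic_gradings (GammaA p) (GammaA p').
Proof.
move=> deltaP TT bb; rewrite -TT => /mtranslate_XiE e0 /mtranslate_XiE e1.
case: deltaP bb e0 e1 => -> bb e0 e1.
  apply: (GammaA_isomorphic_shift (g := g) TT) => [u v Tu Tv||].
  - by rewrite -bb // expr1z.
  - by move: e0; rewrite /tuple_pow (eq_map (fun x => mulr1z x)) map_id.
  by move: e1; rewrite /tuple_pow (eq_map (fun x => mulr1z x)) map_id.
apply: (isomorphic_gradings_trans (GammaA_opp p)).
apply: (@GammaA_isomorphic_shift _ _ (oppData p) p' g TT) => [u v Tu Tv||] //=.
by rewrite -bb // exprN1.
Qed.

End SufficientCondition.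

(** * Isomorphic gradings have isomorphic data *)

Section MatrixEntries.
Variable F : fieldType.

Lemma mul_mx_delta_E m n p (A : 'M[F]_(m, n)) i (j : 'I_p) k l :
  (A *m delta_mx i j) k l = A k i *+ (j == l).
Proof.
rewrite mxE (bigD1 i) //= big1 ?addr0 => [|h /negPf hi].
  by rewrite mxE eqxx eq_sym mulr_natr.
by rewrite mxE hi /= mulr0.
Qed.

Lemma mul_delta_mx_E m n p (B : 'M[F]_(n, p)) (i : 'I_m) j k l :
  (delta_mx i j *m B) k l = B j l *+ (k == i).
Proof.
rewrite mxE (bigD1 j) //= big1 ?addr0 => [|h /negPf hj].
  by rewrite mxE eqxx andbT mulr_natl.
by rewrite mxE hj andbF mul0r.
Qed.

(** Off-diagonal matrix units generate the algebra together with scalars, as E_ii = E_ik E_ki; in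
    size 1 scalars suffice. Unlike E_ii, they have trace 0, as equivariance requires. *)
Lemma offdiag_ind n (P : 'M[F]_n -> Prop) :
    (forall c : F, P c%:M) -> (forall a b, P a -> P b -> P (a + b)) ->
    (forall a b, P a -> P b -> P (a *m b)) ->
    (forall i j, i != j -> P (delta_mx i j)) ->
  forall a, P a.
Proof.
move=> Pc PD PM Pd a.
have PZ c b : P b -> P (c *: b) by move=> Pb; rewrite -mul_scalar_mx; apply: PM.
have P0 : P 0 by have := Pc 0; rewrite raddf0.
rewrite [a]matrix_sum_delta; elim/big_ind: _ => // i _.
elim/big_ind: _ => // j _; apply: PZ.
have [<-|/Pd //] := eqVneq i j.
have [/existsP[k ik]|nk] := boolP [exists k, i != k].
  by rewrite -(mul_delta_mx k); apply: PM; apply: Pd; rewrite // eq_sym.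
have ii k : k = i by apply/eqP; rewrite eq_sym -[_ == _]negbK; move: nk; rewrite negb_exists => /forallP.
rewrite (_ : delta_mx i i = 1%:M) //; apply/matrixP => k l.
by rewrite !mxE (ii k) (ii l) !eqxx.
Qed.

End MatrixEntries.

(** * Maps equivariant under the even part *)

Section EquivariantMaps.
Variable F : fieldType.

(** The trace condition says that diag(a, b) lies in sl, and a x - x b is its bracket with the upper
    block x. Nothing is asked of the dependence of (a', b') on (a, b). *)
Definition equivariant r s r' s' (h : 'M[F]_(r, s) -> 'M[F]_(r', s')) : Prop :=
  forall a b, \tr a = \tr b -> exists a' b',
    forall x, h (a *m x - x *m b) = a' *m h x - h x *m b'.

(** For i != j the pairs (E_ij, 0) and (0, - E_ij) satisfy the trace condition, so the kernel is
    stable under left and right multiplication by off-diagonal units, hence by all matrices; one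
    nonzero x then generates everything. *)
Lemma equivariant_ker r s r' s' (h : 'M[F]_(r, s) -> 'M[F]_(r', s')) :
    linear h -> equivariant h -> forall x, x != 0 -> h x = 0 -> forall y, h y = 0.
Proof.
move=> hlin heq x /mx_neq0P[k [l xkl]] hx y.
have h0 : h 0 = 0.
  have := hlin (-1) 0 0; rewrite scaler0 addr0 scaleN1r => {1}->.
  by rewrite addNr.
have hZ c z : h (c *: z) = c *: h z by rewrite -[c *: z]addr0 hlin h0 addr0.
have hD z w : h (z + w) = h z + h w by rewrite -[z]scale1r hlin !scale1r.
have left_ker a z : h z = 0 -> h (a *m z) = 0.
  elim/offdiag_ind: a z => [c|a b IHa IHb|a b IHa IHb|i j ij] z hz.
  - by rewrite mul_scalar_mx hZ hz scaler0.
  - by rewrite mulmxDl hD IHa // IHb // addr0.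
  - by rewrite -mulmxA IHa // IHb.
  have [|a' [b' e]] := heq (delta_mx i j) 0.
    by rewrite -[delta_mx i j]mul1mx mxtrace_mul_delta mxE (negPf (_ : j != i)) ?mxtrace0 // eq_sym.
  by have := e z; rewrite mulmx0 subr0 hz mulmx0 mul0mx subrr.
have right_ker a z : h z = 0 -> h (z *m a) = 0.
  elim/offdiag_ind: a z => [c|a b IHa IHb|a b IHa IHb|i j ij] z hz.
  - by rewrite mul_mx_scalar hZ hz scaler0.
  - by rewrite mulmxDr hD IHa // IHb // addr0.
  - by rewrite mulmxA IHb // IHa.
  have [|a' [b' e]] := heq 0 (- delta_mx i j).
    rewrite mxtrace0 raddfN /= -[delta_mx i j]mul1mx mxtrace_mul_delta mxE.
    by rewrite (negPf (_ : j != i)) ?oppr0 // eq_sym.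
  by have := e z; rewrite mul0mx sub0r mulmxN opprK hz mulmx0 mul0mx subrr.
rewrite [y]matrix_sum_delta (big_morph h hD h0) big1 // => i _.
rewrite (big_morph h hD h0) big1 // => j _.
suff /eqP : x k l *: h (delta_mx i j) = 0.
  by rewrite scaler_eq0 (negPf xkl) hZ => /eqP ->; rewrite scaler0.
by rewrite -hZ -mul_delta_mxE right_ker // left_ker.
Qed.

Hypothesis F2 : 2%:R != 0 :> F.

(* The equation is a^2 (x) 1 - 2 a (x) b + 1 (x) b^2 = 0; compare entries. *)
Lemma square_zero_operator r s (a : 'M[F]_r.+1) (b : 'M[F]_s.+1) :
    (forall y, a *m (a *m y - y *m b) - (a *m y - y *m b) *m b = 0) ->
  (exists c, a = c%:M) \/ (exists c, b = c%:M).
Proof.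
move=> ab0.
have entry k i j l : (a *m a) k i *+ (j == l) + (b *m b) j l *+ (k == i) =
    2%:R * (a k i * b j l).
  have := congr1 (fun y : 'M_(r.+1, s.+1) => y k l) (ab0 (delta_mx i j)).
  rewrite mulmxBr mulmxBl !mulmxA.
  have subE (A B : 'M[F]_(r.+1, s.+1)) : (A - B) k l = A k l - B k l by rewrite !mxE.
  rewrite !subE mul_mx_delta_E -[delta_mx i j *m b *m b]mulmxA mul_delta_mx_E.
  have -> : (a *m delta_mx i j *m b) k l = a k i * b j l.
    rewrite mxE (bigD1 j) //= big1 ?addr0 => [|h /negPf hj].
      by rewrite mul_mx_delta_E eqxx.
    by rewrite mul_mx_delta_E eq_sym hj mul0r.
  by rewrite [X in _ = X]mxE => e; rewrite -[RHS]addr0 -e; ring.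
(* A nonzero entry a_ki with k != i removes the b^2 term from [entry], leaving b_jl proportional to
   the Kronecker symbol. *)
have [/existsP[ki /andP[ne aki]]|/existsPn da] :=
  boolP [exists ki : 'I_r.+1 * 'I_r.+1, (ki.1 != ki.2) && (a ki.1 ki.2 != 0)].
  right; exists ((a *m a) ki.1 ki.2 / (2%:R * a ki.1 ki.2)).
  apply/matrixP => j l; rewrite mxE; have := entry ki.1 ki.2 j l.
  rewrite (negPf ne) addr0 mulrA => /esym; case: eqP => [_|_] /=.
    by rewrite mulr1n mulrC => /(canRL (mulfK _)) ->; rewrite // mulf_neq0.
  by move/eqP; rewrite mulr0n mulf_eq0 (negPf (mulf_neq0 F2 aki)) => /eqP.
have [/existsP[jl /andP[ne bjl]]|/existsPn db] :=
  boolP [exists jl : 'I_s.+1 * 'I_s.+1, (jl.1 != jl.2) && (b jl.1 jl.2 != 0)].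
  left; exists ((b *m b) jl.1 jl.2 / (2%:R * b jl.1 jl.2)).
  apply/matrixP => k i; rewrite mxE; have := entry k i jl.1 jl.2.
  rewrite (negPf ne) add0r mulrCA => /esym; case: eqP => [_|_] /=.
    by rewrite mulr1n => /(canRL (mulfK _)) ->; rewrite // mulf_neq0.
  by move/eqP; rewrite mulr0n mulf_eq0 (negPf (mulf_neq0 F2 bjl)) orbF => /eqP.
(* Now a and b are diagonal, and the entries with k = i, j = l read (a_kk - b_jj)^2 = 0. *)
have aE k i : a k i = a k k *+ (k == i).
  case: eqP => [->|/eqP ki]; rewrite ?mulr1n // mulr0n.
  by have := da (k, i); rewrite ki /= negbK => /eqP.
have bE j l : b j l = b j j *+ (j == l).
  case: eqP => [->|/eqP ki]; rewrite ?mulr1n // mulr0n.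
  by have := db (j, l); rewrite ki /= negbK => /eqP.
have sqE q (d : 'M[F]_q.+1) k : (forall i j, d i j = d i i *+ (i == j)) ->
    (d *m d) k k = d k k ^+ 2.
  move=> dE; rewrite mxE (bigD1 k) //= big1 ?addr0 // => i ik.
  by rewrite [d k i]dE eq_sym (negPf ik) mulr0n mul0r.
have ab k j : a k k = b j j.
  apply/eqP; rewrite -subr_eq0 -sqrf_eq0; apply/eqP.
  have := entry k k j j; rewrite !eqxx !mulr1n !sqE // => e.
  have -> : (a k k - b j j) ^+ 2 = a k k ^+ 2 + b j j ^+ 2 - 2%:R * (a k k * b j j) by ring.
  by rewrite e subrr.
left; exists (b 0 0); apply/matrixP => k i; rewrite aE mxE.
by rewrite (ab k 0).
Qed.

End EquivariantMaps.

Section Intertwiners.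
Variable F : fieldType.

Lemma sum_delta_linear m n p q (h : 'M[F]_(m, n) -> 'M[F]_(p, q)) :
  linear h -> forall x, h x = \sum_i \sum_j x i j *: h (delta_mx i j).
Proof.
move=> hlin x; have h0 : h 0 = 0.
  by have := hlin (-1) 0 0; rewrite scaler0 addr0 scaleN1r => {1}->; rewrite addNr.
have hZ c z : h (c *: z) = c *: h z by rewrite -[c *: z]addr0 hlin h0 addr0.
have hD z w : h (z + w) = h z + h w by rewrite -[z]scale1r hlin !scale1r.
rewrite {1}[x]matrix_sum_delta (big_morph h hD h0); apply: eq_bigr => i _.
by rewrite (big_morph h hD h0); apply: eq_bigr => j _.
Qed.

(** P is read off from one entry column of h on the matrices E_{i j0}, which turns h (a x) = a' h x
    into a' P = P a. A right kernel K of P satisfies P a K = a' P K = 0 for all a, so it vanishes by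
    primeness. Sizes may differ: full rank of P then bounds r by r'. *)
Lemma left_intertwiner r s r' s' (h : 'M[F]_(r, s) -> 'M[F]_(r', s')) x0 :
    linear h -> h x0 != 0 ->
    (forall a, exists a', forall x, h (a *m x) = a' *m h x) ->
  exists P : 'M[F]_(r', r), row_full P /\
    forall a, exists a', a' *m P = P *m a /\ forall x, h (a *m x) = a' *m h x.
Proof.
move=> hlin hx0 hLL; have hE := sum_delta_linear hlin.
have [i0 [j0 hij]] : exists i j, h (delta_mx i j) != 0.
  apply: boolp.contrapT => nij; case/eqP: hx0; rewrite hE big1 // => i _.
  rewrite big1 // => j _; have [->|ne] := eqVneq (h (delta_mx i j)) 0.
    by rewrite scaler0.
  by case: nij; exists i, j.
have [a0 [b0 hab]] := mx_neq0P hij.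
pose P : 'M[F]_(r', r) := \matrix_(c, i) h (delta_mx i j0) c b0.
have P0 : P != 0.
  by apply: contraNneq hab => /(congr1 (fun z : 'M_(r', r) => z a0 i0)); rewrite !mxE => ->.
have PLL a : exists a', a' *m P = P *m a /\ forall x, h (a *m x) = a' *m h x.
  have [a' a'E] := hLL a; exists a'; split=> //; apply/matrixP => c i.
  have -> : (a' *m P) c i = h (a *m delta_mx i j0) c b0.
    by rewrite a'E !mxE; apply: eq_bigr => k _; rewrite mxE.
  rewrite hE summxE [RHS]mxE; apply: eq_bigr => k _.
  rewrite (bigD1 j0) //= big1 ?addr0 => [|j /negPf jj].
    by rewrite mul_mx_delta_E eqxx mxE mulrC mulr1n mxE.
  by rewrite mul_mx_delta_E eq_sym jj mulr0n scale0r.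
exists P; split=> //; rewrite -cokermx_eq0; apply/negPn/negP => K0.
have [a /eqP[]] := mx_prime P0 K0; have [a' [<- _]] := PLL a.
by rewrite -mulmxA mulmx_coker mulmx0.
Qed.

Lemma commute_left_mul r s s' (k : 'M[F]_(r.+1, s) -> 'M[F]_(r.+1, s')) :
  linear k -> (forall a x, k (a *m x) = a *m k x) -> exists Q, forall x, k x = x *m Q.
Proof.
move=> klin kL; exists (\matrix_(j, l) k (delta_mx 0 j) 0 l) => x.
rewrite (sum_delta_linear klin) [in RHS](matrix_sum_delta x) mulmx_suml.
apply: eq_bigr => i _; rewrite mulmx_suml; apply: eq_bigr => j _.
rewrite -scalemxAl -(mul_delta_mx (0 : 'I_r.+1)) kL; congr (_ *: _).
apply/matrixP => c d; rewrite mul_delta_mx_E -mulmxA !mul_delta_mx_E.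
by rewrite mxE eqxx mulr1n.
Qed.

(** The map x |-> P^-1 h x commutes with all left multiplications, hence is a right multiplication
    by some Q; injectivity makes Q invertible. *)
Lemma left_intertwined_form r s (h : 'M[F]_(r.+1, s.+1) -> 'M[F]_(r.+1, s.+1)) :
    linear h -> (forall x, h x = 0 -> x = 0) ->
    (forall a, exists a', forall x, h (a *m x) = a' *m h x) ->
  exists P Q, [/\ P \in unitmx, Q \in unitmx & forall x, h x = P *m x *m Q].
Proof.
move=> hlin h0 hLL.
have one0 : (1%:M : 'M[F]_r.+1) != 0 by rewrite -mxrank_eq0 mxrank1.
have hx0 : h (delta_mx 0 0) != 0.
  apply/eqP => /h0/matrixP/(_ 0 0); rewrite !mxE !eqxx => /eqP.
  by rewrite oner_eq0.
have [P [fP PLL]] := left_intertwiner hlin hx0 hLL.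
have uP : P \in unitmx by rewrite -row_full_unit.
have [||Q QE] := @commute_left_mul r s.+1 s.+1 (fun x => invmx P *m h x).
- by move=> c x y; rewrite hlin mulmxDr -scalemxAr.
- move=> a x; have [a' [a'P ->]] := PLL a.
  by rewrite mulmxA -[in LHS](mulmxK uP a') a'P !mulmxA mulVmx // mul1mx -mulmxA.
have hE x : h x = P *m x *m Q by rewrite -mulmxA -QE mulKVmx.
exists P, Q; split=> //; rewrite -row_free_unit -kermx_eq0; apply/negPn/negP => K0.
have [z] := mx_prime one0 K0; rewrite mul1mx => /eqP[]; apply: h0.
by rewrite hE -(mulmxA P) -(mulmxA z) mulmx_ker !mulmx0.
Qed.

Hypothesis F2 : 2%:R != 0 :> F.

(* Each operator [x |-> E_ij x] with i != j squares to zero, so it is turned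
   by h into a left or into a right multiplication, and the two kinds cannot
   coexist since left and right multiplications commute. *)
Lemma equivariant_left_type r s r' s'
    (h : 'M[F]_(r.+1, s.+1) -> 'M[F]_(r'.+1, s'.+1)) :
    linear h -> injective h -> (forall y, exists x, h x = y) -> equivariant h ->
  (forall a, exists a', forall x, h (a *m x) = a' *m h x) \/
  (forall a, exists b', forall x, h (a *m x) = h x *m b').
Proof.
move=> hlin hinj hsurj heq.
have h0 : h 0 = 0.
  by have := hlin (-1) 0 0; rewrite scaler0 addr0 scaleN1r => {1}->; rewrite addNr.
have hZ c z : h (c *: z) = c *: h z by rewrite -[c *: z]addr0 hlin h0 addr0.
have hD z w : h (z + w) = h z + h w by rewrite -[z]scale1r hlin !scale1r.
pose LL a := exists a', forall x, h (a *m x) = a' *m h x.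
pose LR a := exists b', forall x, h (a *m x) = h x *m b'.
have off i j : i != j -> LL (delta_mx i j) \/ LR (delta_mx i j).
  move=> ij; have [|a' [b' e]] := heq (delta_mx i j) 0.
    by rewrite -[delta_mx i j]mul1mx mxtrace_mul_delta mxE (negPf (_ : j != i)) ?mxtrace0 // eq_sym.
  have {}e x : h (delta_mx i j *m x) = a' *m h x - h x *m b'.
    by rewrite -e mulmx0 subr0.
  have [|[c cE]|[c cE]] := @square_zero_operator F F2 r' s' a' b'.
  - move=> y; have [x <-] := hsurj y; rewrite -!e mulmxA mul_delta_mx_cond.
    by rewrite eq_sym (negPf ij) mulr0n mul0mx h0.
  - right; exists (c%:M - b') => x; rewrite e cE mulmxBr.
    by rewrite scalar_mxC.
  left; exists (a' - c%:M) => x; rewrite e cE mulmxBl.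
  by rewrite scalar_mxC.
(* E_ij and E_kl do not commute when j = k or i = l. *)
have conflict (i j k l : 'I_r.+1) : i != j -> k != l -> (j == k) || (i == l) ->
    LL (delta_mx i j) -> LR (delta_mx k l) -> False.
  move=> ij kl jkil [a' aE] [b' bE].
  have comm x : delta_mx i j *m (delta_mx k l *m x) = delta_mx k l *m (delta_mx i j *m x) :> 'M[F]_(r.+1, s.+1).
    by apply: hinj; rewrite aE !bE aE mulmxA.
  have delta0 (q : 'I_r.+1) : (delta_mx q 0 : 'M[F]_(r.+1, s.+1)) <> 0.
    by move/matrixP/(_ q 0); rewrite !mxE !eqxx => /eqP; rewrite oner_eq0.
  case/orP: jkil => [/eqP jk|/eqP il].
    have := comm (delta_mx l 0); rewrite -jk !mul_delta_mx mul_delta_mx_cond.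
    by rewrite jk (negPf kl) mulr0n mulmx0; apply: delta0.
  have := comm (delta_mx j 0); rewrite -il !mul_delta_mx mul_delta_mx_cond.
  by rewrite (negPf ij) mulr0n mulmx0 => /esym; apply: delta0.
have step i j m : i != j -> LR (delta_mx i j) -> j != m -> LR (delta_mx j m).
  move=> ij Rij jm; have [Ljm|//] := off j m jm.
  by case: (conflict j m i j jm ij _ Ljm Rij); rewrite eqxx orbT.
have [LLall|nall] := boolp.EM (forall i j, i != j -> LL (delta_mx i j)).
  left; elim/offdiag_ind => [c|a b [a' aE] [b' bE]|a b [a' aE] [b' bE]|i j /LLall //].
  + by exists c%:M => x; rewrite !mul_scalar_mx hZ.
  + by exists (a' + b') => x; rewrite !mulmxDl hD aE bE.
  + by exists (a' *m b') => x; rewrite -!mulmxA aE bE.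
have [i [j [ij nLL]]] : exists i j, i != j /\ ~ LL (delta_mx i j).
  apply: boolp.contrapT => nn; apply: nall => i j ij; apply: boolp.contrapT => nL.
  by apply: nn; exists i, j.
have Rij : LR (delta_mx i j) by have [] := off i j ij.
have ji : j != i by rewrite eq_sym.
right; elim/offdiag_ind => [c|a b [a' aE] [b' bE]|a b [a' aE] [b' bE]|k l kl].
- by exists c%:M => x; rewrite mul_scalar_mx mul_mx_scalar hZ.
- by exists (a' + b') => x; rewrite mulmxDl mulmxDr hD aE bE.
- by exists (b' *m a') => x; rewrite -mulmxA aE bE mulmxA.
(* From E_ij of right type, [step] reaches a unit of right type that fails to commute with E_kl:
   E_lk if j = k, and E_jk otherwise. *)
have [Lkl|//] := off k l kl; exfalso.
have [jk|jk] := eqVneq j k.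
  have lk : l != k by rewrite eq_sym.
  have Rkl : LR (delta_mx k l) by rewrite -jk; apply: (step i j l ij Rij); rewrite jk.
  apply: (conflict k l l k kl lk _ Lkl (step _ _ _ kl Rkl lk)).
  by rewrite eqxx.
apply: (conflict k l j k kl jk _ Lkl (step _ _ _ ij Rij jk)).
by rewrite eqxx orbT.
Qed.

Lemma equivariant_trmx r s (h : 'M[F]_(r, s) -> 'M[F]_(r, s)) :
  equivariant h -> equivariant (fun x : 'M[F]_(s, r) => (h x^T)^T).
Proof.
move=> heq a b tab; have [|a' [b' e]] := heq (- b^T) (- a^T).
  by rewrite !raddfN /= !mxtrace_tr tab.
exists (- b'^T), (- a'^T) => x.
have -> : (a *m x - x *m b)^T = - b^T *m x^T - x^T *m - a^T.
  by rewrite linearB /= !trmx_mul mulNmx mulmxN opprK addrC.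
by rewrite e linearB /= !trmx_mul mulNmx mulmxN opprK addrC.
Qed.

(* If h exchanges left and right multiplications then both sizes inject into
   each other, so the matrices are square and transposition repairs h. *)
Lemma equivariant_form r s (h : 'M[F]_(r.+1, s.+1) -> 'M[F]_(r.+1, s.+1)) :
    linear h -> injective h -> (forall y, exists x, h x = y) -> equivariant h ->
  (exists P Q, [/\ P \in unitmx, Q \in unitmx & forall x, h x = P *m x *m Q]) \/
  (r = s /\ forall a, exists a', forall x, (h (a *m x))^T = a' *m (h x)^T).
Proof.
move=> hlin hinj hsurj heq.
pose hT (x : 'M[F]_(s.+1, r.+1)) := (h x^T)^T.
have hTlin : linear hT by move=> c x y; rewrite /hT linearP hlin linearP.
have hTinj : injective hT by move=> x y /trmx_inj/hinj/trmx_inj.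
have hTsurj y : exists x, hT x = y.
  by have [x hx] := hsurj y^T; exists x^T; rewrite /hT trmxK hx trmxK.
have hTeq : equivariant hT by apply: equivariant_trmx.
have inj0 r1 s1 (k : 'M[F]_(r1, s1) -> 'M[F]_(r1, s1)) :
    linear k -> injective k -> forall x, k x = 0 -> x = 0.
  move=> klin kinj x kx; apply: kinj; rewrite kx.
  by have := klin (-1) 0 0; rewrite scaler0 addr0 scaleN1r => ->; rewrite addNr.
have [hLL|hLR] := equivariant_left_type hlin hinj hsurj heq.
  by left; apply: left_intertwined_form hlin (inj0 _ _ _ hlin hinj) hLL.
have [hTLL|hTLR] := equivariant_left_type hTlin hTinj hTsurj hTeq.
  left; have [P [Q [uP uQ hE]]] := left_intertwined_form hTlin (inj0 _ _ _ hTlin hTinj) hTLL.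
  exists Q^T, P^T; rewrite !unitmx_tr; split=> // x.
  by rewrite -[LHS]trmxK -{1}[x]trmxK -/(hT _) hE !trmx_mul trmxK mulmxA.
right; pose g (x : 'M[F]_(r.+1, s.+1)) : 'M[F]_(s.+1, r.+1) := (h x)^T.
have glin : linear g by move=> c x y; rewrite /g hlin linearP.
have gLL a : exists a', forall x, g (a *m x) = a' *m g x.
  by have [b' e] := hLR a; exists b'^T => x; rewrite /g e trmx_mul.
pose gT (x : 'M[F]_(s.+1, r.+1)) : 'M[F]_(r.+1, s.+1) := h x^T.
have gTlin : linear gT by move=> c x y; rewrite /gT linearP hlin.
have gTLL a : exists a', forall x, gT (a *m x) = a' *m gT x.
  have [b' e] := hTLR a; exists b'^T => x; apply: trmx_inj.
  by rewrite -/(hT _) e trmx_mul trmxK.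
have d0 r1 s1 : (delta_mx 0 0 : 'M[F]_(r1.+1, s1.+1)) <> 0.
  by move/matrixP/(_ 0 0); rewrite !mxE !eqxx => /eqP; rewrite oner_eq0.
have rs : r = s.
  apply/eqP; rewrite -eqSS eqn_leq; apply/andP; split.
    have [|P [/eqP rP _]] := left_intertwiner (x0 := delta_mx 0 0) glin _ gLL;
      last by have := rank_leq_row P; rewrite rP.
    apply/eqP; rewrite /g => /(congr1 trmx); rewrite trmxK trmx0.
    by move/(inj0 _ _ _ hlin hinj); apply: d0.
  have [|P [/eqP rP _]] := left_intertwiner (x0 := delta_mx 0 0) gTlin _ gTLL;
    last by have := rank_leq_row P; rewrite rP.
  apply/eqP; rewrite /gT => /(inj0 _ _ _ hlin hinj)/(congr1 trmx).
  by rewrite trmxK trmx0; apply: d0.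
by split.
Qed.

End Intertwiners.

Definition urmx (F : fieldType) r s (x : 'M[F]_(r, s)) : 'M[F]_(r + s) := block_mx 0 x 0 0.

Lemma urmx_eps (F : fieldType) r s (z : 'M[F]_(r + s)) :
  eps false *m z *m eps true = urmx (ursubmx z).
Proof.
rewrite -[z in LHS]submxK /eps !mulmx_block.
by rewrite !(mulmx0, mul0mx, mulmx1, mul1mx, addr0, add0r).
Qed.

(** * From the upper block to the whole matrix superalgebra *)

Section EvenConjugation.
Variables (F : fieldType) (G : zmodType) (m n : nat) (p p' : gammaData F G m n).
Local Notation N := (m.+1 + n.+1)%N.
Local Notation M := 'M[F]_N.
Hypothesis charF0 : [pchar F] =i pred0.

Lemma gframe_mem (p0 : gammaData F G m n) i j t d :
  d \in gD p0 t -> gu i *m d *m gv j \in GammaM p0 (ggamma i + t - ggamma j).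
Proof.
move=> Dd; apply/mem_GammaM => i' j'; rewrite gframe_comp.
case: ifP => [/andP[/eqP-> /eqP<-]|_]; last exact: mem0v.
by rewrite [X in gD p0 X](AC (3*1*1) (2*1*4*3*5)) /= addrK subrK.
Qed.

Lemma gk0_gt0 (p0 : gammaData F G m n) : (0 < gk0 p0)%N.
Proof. by have := gk0P p0; case: (gk0 p0). Qed.

Lemma gk1_gt0 (p0 : gammaData F G m n) : (0 < gk1 p0)%N.
Proof. by have := gk1P p0; case: (gk1 p0). Qed.

(* The lower off-diagonal block follows from the upper one by duality for the
   trace form, and the diagonal blocks by taking products. *)
Lemma upper_conjugation (R R' : M) : R *m R' = 1%:M ->
    (forall b, eps b *m R = R *m eps b) ->
    (forall g z, z \in GammaM p g -> eps false *m z *m eps true = z ->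
       R *m z *m R' \in GammaM p' g) ->
  forall g z, z \in GammaM p g -> R *m z *m R' \in GammaM p' g.
Proof.
move=> RR' eR U; have R'R : R' *m R = 1%:M := mulmx1C RR'.
have eR' b : eps b *m R' = R' *m eps b.
  by rewrite -[LHS]mul1mx -R'R -!mulmxA (mulmxA R) -eR -(mulmxA (eps b)) RR' mulmx1.
pose c z := R *m z *m R'; pose c' z := R' *m z *m R.
have cK z : c' (c z) = z.
  by rewrite /c /c' !mulmxA R'R mul1mx -mulmxA R'R mulmx1.
have c'K z : c (c' z) = z.
  by rewrite /c /c' !mulmxA RR' mul1mx -mulmxA RR' mulmx1.
have cM z w : c z *m c w = c (z *m w).
  by rewrite /c !mulmxA -(mulmxA _ R' R) R'R mulmx1.
have ceps a b z : eps a *m c z *m eps b = c (eps a *m z *m eps b).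
  by rewrite /c !mulmxA eR -!mulmxA -eR' !mulmxA.
have c'eps a b z : eps a *m c' z *m eps b = c' (eps a *m z *m eps b).
  by rewrite /c' !mulmxA eR' -!mulmxA -eR !mulmxA.
have ctr z : \tr (c z) = \tr z by rewrite /c mxtrace_mulC mulmxA R'R mul1mx.
have N0 : N%:R != 0 :> F by rewrite (pcharf0P F).1.
have gr := GammaM_grading p; have gr' := GammaM_grading p'.
have [S [pr Wpr]] := is_decomp_by_exists gr.1; have [_ prW _ prS] := Wpr.
have [S' [pr' Wpr']] := is_decomp_by_exists gr'.1; have [_ prW' prE' prS'] := Wpr'.
have eps0 (q : gammaData F G m n) b : eps b \in GammaM q 0.
  have -> : eps b = eps b *m 1%:M *m eps b :> M by rewrite mulmx1 eps_mul eqxx.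
  by apply: GammaM_eps; apply: (grading_one (GammaM_grading q)).
have preps a b g z : pr g (eps a *m z *m eps b) = eps a *m pr g z *m eps b.
  by rewrite -{1}[g]addr0 (proj_mulr gr Wpr) // -{1}[g]addr0 (proj_mull gr Wpr).
have preps' a b g z : pr' g (eps a *m z *m eps b) = eps a *m pr' g z *m eps b.
  by rewrite -{1}[g]addr0 (proj_mulr gr' Wpr') // -{1}[g]addr0 (proj_mull gr' Wpr').
(* The components of an upper block stay in that block, so U applies to each of them and degrees are
   also reflected. *)
have Uinv g z : eps false *m z *m eps true = z -> c z \in GammaM p' g -> z \in GammaM p g.
  move=> zU cz; suff <- : pr g z = z by [].
  apply: (can_inj cK); have -> : c z = pr' g (c z) by rewrite (prE' g) // eqxx.
  have -> : c z = \sum_(h <- S) c (pr h z) by rewrite -{1}(prS z) /c mulmx_sumr mulmx_suml.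
  rewrite linear_sum /= (eq_bigr (fun h => if h == g then c (pr h z) else 0)).
    rewrite sum_fset_if; case: ifP => // /negbT nS.
    by rewrite (proj_notin Wpr _ nS) /c mulmx0 mul0mx.
  move=> h _; rewrite (prE' h) 1?eq_sym //; apply: U => //.
  by rewrite -preps zU.
have L g z : z \in GammaM p g -> eps true *m z *m eps false = z -> c z \in GammaM p' g.
  move=> Wz zL; rewrite -(prS' (c z)) memv_suml // => h _.
  have [->|hg] := eqVneq h g; first exact: prW'.
  (* A nonzero component of degree h != g would pair nontrivially with some v of degree -h, which
     may be cut down to the upper block; but tr (c z v) = tr (z c'(v)) is the trace of an element of
     degree g - h. *)
  suff -> : pr' h (c z) = 0 by apply: mem0v.
  apply/eqP/negPn/negP => /(grading_trace_pairing gr' N0 (prW' h (c z)))[w Ww].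
  have czL : eps true *m c z *m eps false = c z by rewrite ceps zL.
  rewrite -[in pr' h _]czL preps' -!mulmxA mxtrace_mulC -!mulmxA => /eqP[].
  rewrite [eps false *m _]mulmxA; set v := eps false *m w *m eps true.
  have Wv : v \in GammaM p' (- h) by apply: GammaM_eps.
  have vU : eps false *m v *m eps true = v.
    by rewrite /v !mulmxA eps_mul -!mulmxA eps_mul.
  have Wc'v : c' v \in GammaM p (- h) by apply: Uinv; rewrite ?c'K // c'eps vU.
  have -> : \tr (pr' h (c z) *m v) = \tr (c z *m v).
    rewrite -[in RHS](prS' (c z)) mulmx_suml linear_sum /=.
    rewrite (eq_bigr (fun k => if k == h then \tr (pr' k (c z) *m v) else 0)).
      rewrite sum_fset_if; case: ifP => // /negbT nS.
      by rewrite (proj_notin Wpr' _ nS) mul0mx mxtrace0.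
    move=> k _; case: eqP => // /eqP kh.
    apply: (grading_trace0 gr' N0 (g := k - h)); first by rewrite subr_eq0.
    exact: grading_mul (prW' _ _) Wv.
  rewrite -(c'K v) cM ctr; apply: (grading_trace0 gr N0 (g := g - h)).
    by rewrite subr_eq0 eq_sym.
  exact: grading_mul.
move=> g z /mem_GammaM Dz; rewrite -/(c z) (gframe_expand p z).
pose U_ := gu (p := p); pose V_ := gv (p := p).
have -> : c (\sum_i \sum_j U_ i *m (V_ i *m z *m U_ j) *m V_ j) =
    \sum_i \sum_j c (U_ i *m (V_ i *m z *m U_ j) *m V_ j).
  rewrite /c mulmx_sumr mulmx_suml; apply: eq_bigr => i _.
  by rewrite mulmx_sumr mulmx_suml.
rewrite memv_suml // => i _; rewrite memv_suml // => j _.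
move: (V_ i *m z *m U_ j) (Dz i j) => d Dd; rewrite /U_ /V_.
have offdiag (i1 j1 : 'I_(gk0 p + gk1 p)) t d1 : d1 \in gD p t -> gpar i1 != gpar j1 ->
    c (gu (p := p) i1 *m d1 *m gv j1) \in GammaM p' (ggamma (p := p) i1 + t - ggamma (p := p) j1).
  move=> Dd1 par; have mem := gframe_mem i1 j1 Dd1.
  have e a b : eps a *m (gu i1 *m d1 *m gv j1) *m eps b =
      (if a == gpar i1 then gu i1 else 0) *m d1 *m (if b == gpar j1 then gv j1 else 0).
    by rewrite !mulmxA gu_eps -!mulmxA gv_eps.
  case ei: (gpar i1) (par) => /= parj.
    by apply: L => //; rewrite e ei; case: (gpar j1) parj.
  by apply: U => //; rewrite e ei; case: (gpar j1) parj.
have deg : g = ggamma (p := p) i + (g - ggamma i + ggamma j) - ggamma j.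
  by rewrite [RHS](AC (1*3*1) (2*1*3*4*5)) /= !addrK.
have [par|par] := boolP (gpar i != gpar j); first by rewrite [in X in GammaM _ X]deg; apply: offdiag.
(* Positions of equal parity are factored as E_ij = E_ik E_kj through an index k of the other
   parity. *)
have [k kpar] : exists k : 'I_(gk0 p + gk1 p), gpar (p := p) k = ~~ gpar (p := p) i.
  case: (gpar i); [exists (lshift _ (Ordinal (gk0_gt0 p))) | exists (rshift _ (Ordinal (gk1_gt0 p)))].
    by rewrite /gpar /= leqNgt gk0_gt0.
  by rewrite /gpar /= addn0 leqnn.
have D1 : 1%:M \in gD p 0 by have [Dgr _ _ _] := gDP p; apply: grading_one.
have -> : gu i *m d *m gv j = (gu i *m 1%:M *m gv k) *m (gu k *m d *m gv j).
  by rewrite mulmx1 !mulmxA -(mulmxA _ (gv k)) gvu eqxx mulmx1.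
have -> : g = (ggamma i + 0 - ggamma k) + (ggamma k + (g - ggamma i + ggamma j) - ggamma j).
  rewrite addr0 [RHS](AC (2*(1*3*1)) (4*(1*5)*(2*3)*(6*7))) /=.
  by rewrite subrr addNr subrr !addr0.
rewrite -cM; apply: (grading_mul gr'); apply: offdiag => //; rewrite kpar.
  by case: (gpar i).
by move: par; rewrite negbK => /eqP <-; case: (gpar i).
Qed.

End EvenConjugation.

(** * Recovering T, beta and the cosets *)

Section FrameColumns.
Variables (F : fieldType) (G : zmodType) (m n : nat) (p : gammaData F G m n).
Local Notation K := (gk0 p + gk1 p)%N.

(* The columns of parity b and degree h in the left ideal M (E_{i1 i1} (x) 1). *)
Definition gcolumns (b : bool) (h : G) (i1 : 'I_K) : {vspace 'M[F]_(m.+1 + n.+1, gell p)} :=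
  (\sum_(j | gpar j == b)
     linfun (mulmx (gu j)) @: gD p (h - ggamma j + ggamma i1))%VS.

Lemma mem_gcolumns b h i1 y :
  reflect (eps b *m y = y /\ forall j, gv j *m y \in gD p (h - ggamma j + ggamma i1))
          (y \in gcolumns b h i1).
Proof.
apply: (iffP idP) => [/memv_sumP[y_ Dy ->]|[yb Dy]].
  split=> [|j].
    rewrite mulmx_sumr; apply: eq_bigr => j /eqP jb.
    have /memv_imgP[d _ ->] := Dy j (introT eqP jb).
    by rewrite lfunE /= mulmxA gu_eps jb eqxx.
  rewrite mulmx_sumr memv_suml // => i ib.
  have /memv_imgP[d Dd ->] := Dy i ib; rewrite lfunE /= mulmxA gvu.
  by case: eqP => [->|_]; rewrite ?mul1mx // mul0mx mem0v.
have -> : y = \sum_(j | gpar (p := p) j == b) gu (p := p) j *m (gv (p := p) j *m y).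
  rewrite -[LHS]mul1mx -(gu_sum p) mulmx_suml [RHS]big_mkcond /=; apply: eq_bigr => j _.
  case: eqP => [_|jb]; first by rewrite mulmxA.
  rewrite -mulmxA -yb (mulmxA (gv j)) gv_eps eq_sym.
  by case: eqP => // _; rewrite mul0mx mulmx0.
apply: memv_sumr => j _; apply/memv_imgP; exists (gv j *m y) => //.
by rewrite lfunE.
Qed.

(** Nonzero components of D are lines, so each position j of parity b contributes 1 exactly when its
    degree lies in the support. *)
Lemma dim_gcolumns b h i1 :
  \dim (gcolumns b h i1) =
    (\sum_(j | gpar (p := p) j == b) ((h - ggamma j + ggamma i1)%R \in gT p))%N.
Proof.
have gu_inj j : injective (mulmx (gu (p := p) j) : 'M[F]_(gell p, gell p) -> _).
  move=> d e /(congr1 (mulmx (gv j))).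
  by rewrite !mulmxA gvu eqxx !mul1mx.
have dirS : directv (\sum_(j | gpar (p := p) j == b)
    linfun (mulmx (gu (p := p) j)) @: gD p (h - ggamma j + ggamma i1)).
  apply/directv_sum_independent => y_ Dy y0 j jb.
  have /memv_imgP[d _ dE] := Dy j jb.
  have := congr1 (mulmx (gv j)) y0; rewrite mulmx0 mulmx_sumr (bigD1 j) //= big1.
    by rewrite addr0 dE lfunE /= mulmxA gvu eqxx mul1mx => ->; rewrite mulmx0.
  move=> i /andP[ib /negPf ij]; have /memv_imgP[e _ ->] := Dy i ib.
  by rewrite lfunE /= mulmxA gvu eq_sym ij mul0mx.
rewrite (directvP dirS) /=; apply: eq_bigr => j _.
rewrite limg_dim_eq; first by have [_ _ -> _] := gDP p.
apply/eqP; rewrite -subv0; apply/subvP => d; rewrite memv_cap memv_ker lfunE /= memv0.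
by move=> /andP[_ /eqP e]; apply/eqP; apply: (gu_inj j); rewrite e mulmx0.
Qed.

Lemma count_cosets (b : bool) (g a : G) (s : seq G) :
    s = (if b then ggamma1 p : seq G else ggamma0 p : seq G) ->
  (\sum_(j < K | gpar (p := p) j == b) ((g + ggamma j - a)%R \in gT p))%N =
  count_mem (translate a (gT p)) [seq translate (g + x) (gT p) | x <- s].
Proof.
move=> ->; rewrite count_map -sum1_count.
have lp i : gpar (p := p) (lshift (gk1 p) i) = false by rewrite /gpar /= leqNgt ltn_ord.
have rp i : gpar (p := p) (rshift (gk0 p) i) = true by rewrite /gpar /= leq_addr.
have te x : (translate (g + x) (gT p) == translate a (gT p)) = (g + x - a \in gT p).
  exact: translate_eq (gT_subgroup p) _ _.
rewrite big_split_ord /=; case: b => /=.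
  rewrite big_pred0 ?add0n => [|i]; last by rewrite lp.
  rewrite big_tuple big_mkcond [RHS]big_mkcond; apply: eq_bigr => i _.
  by rewrite rp eqxx te /ggamma tnth_rshift; case: (_ \in _).
rewrite [X in (_ + X)%N]big_pred0 ?addn0 => [|i]; last by rewrite rp.
rewrite big_tuple big_mkcond [RHS]big_mkcond; apply: eq_bigr => i _.
by rewrite lp eqxx te /ggamma tnth_lshift; case: (_ \in _).
Qed.

End FrameColumns.

Section Uniqueness.
Variables (F : closedFieldType) (G : zmodType) (m n : nat).
Local Notation N := (m.+1 + n.+1)%N.
Local Notation M := 'M[F]_N.
Hypothesis charF0 : [pchar F] =i pred0.

Lemma corner_transport (p p' : gammaData F G m n) (R R' : M) i1 i t d :
    (forall g z, z \in GammaM p g -> R *m z *m R' \in GammaM p' g) ->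
  d \in gD p t ->
  (gv (p := p') i *m R *m gu (p := p) i1) *m d *m (gv i1 *m R' *m gu i) \in gD p' t.
Proof.
move=> RG Dd; have /RG/mem_GammaM/(_ i i) := gframe_mem i1 i1 Dd.
rewrite !mulmxA => H; apply: etrans H; congr (_ \in gD p' _).
by rewrite subrK addrAC subrr add0r.
Qed.

Lemma column_transport (p p' : gammaData F G m n) (R R' : M) i1 i b h y :
    (forall g z, z \in GammaM p g -> R *m z *m R' \in GammaM p' g) ->
    eps b *m R = R *m eps b ->
  y \in gcolumns b h i1 -> R *m y *m (gv (p := p) i1 *m R' *m gu (p := p') i) \in gcolumns b h i.
Proof.
move=> RG eR /mem_gcolumns[yb Dy]; apply/mem_gcolumns; split=> [|j].
  by rewrite mulmxA (mulmxA (eps b) R) eR -(mulmxA R (eps b)) yb.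
have yG : y *m gv (p := p) i1 \in GammaM p h.
  apply/mem_GammaM => j' k; rewrite mulmxA -mulmxA gvu.
  case: eqP => [<-|_]; first by rewrite mulmx1.
  by rewrite mulmx0 mem0v.
by have /mem_GammaM/(_ j i) := RG _ _ yG; rewrite !mulmxA.
Qed.

(* The corners of the idempotents E_11 (x) 1 of p and E_ii (x) 1 of p', for a
   suitable i, are related by multiplication with z and w; the coset
   multiplicities are dimensions of homogeneous components of the columns. *)
Lemma GammaM_unique (p p' : gammaData F G m n) (R R' : M) : R *m R' = 1%:M ->
    (forall b, eps b *m R = R *m eps b) ->
    (forall g z, z \in GammaM p g -> R *m z *m R' \in GammaM p' g) ->
  [/\ gT p = gT p', {in gT p &, forall u v, gbeta p u v = gbeta p' u v}
    & exists g,
      perm_eq [seq translate (g + x) (gT p) | x <- ggamma0 p]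
              [seq translate x (gT p) | x <- ggamma0 p'] /\
      perm_eq [seq translate (g + x) (gT p) | x <- ggamma1 p]
              [seq translate x (gT p) | x <- ggamma1 p']].
Proof.
move=> RR' eR RG; have R'R : R' *m R = 1%:M := mulmx1C RR'.
have eR' b : eps b *m R' = R' *m eps b.
  by rewrite -[LHS]mul1mx -R'R -!mulmxA (mulmxA R) -eR -(mulmxA (eps b)) RR' mulmx1.
have R'G g z : z \in GammaM p' g -> R' *m z *m R \in GammaM p g.
  move=> Wz; pose c := linfun (mulmxr R' \o mulmx R).
  have cE x : c x = R *m x *m R' by rewrite lfunE.
  apply: (@decomposition_reflect _ _ _ _ (GammaM p) (GammaM p') c).
  - exact: GammaM_decomposition.
  - exact: GammaM_decomposition.
  - apply/eqP/lker0P => x y; rewrite !cE => /(congr1 (fun z => R' *m z *m R)).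
    by rewrite !mulmxA R'R !mul1mx -!mulmxA R'R !mulmx1.
  - by move=> h x; rewrite cE; apply: RG.
  by rewrite cE !mulmxA RR' mul1mx -mulmxA RR' mulmx1.
pose i1 : 'I_(gk0 p + gk1 p) := lshift _ (Ordinal (gk0_gt0 p)).
pose z i := gv (p := p') i *m R *m gu (p := p) i1.
pose w i := gv (p := p) i1 *m R' *m gu (p := p') i.
(* The trace of this sum is l, nonzero in F, so some w_i z_i has nonzero trace. *)
have wz1 : \sum_i w i *m z i = 1%:M.
  transitivity (gv (p := p) i1 *m R' *m (\sum_i gu (p := p') i *m gv (p := p') i) *m R *m gu (p := p) i1).
    rewrite mulmx_sumr !mulmx_suml; apply: eq_bigr => i _.
    by rewrite /w /z !mulmxA.
  by rewrite gu_sum mulmx1 -(mulmxA _ R') R'R mulmx1 gvu eqxx.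
have l0 : (gell p)%:R != 0 :> F by rewrite (pcharf0P F).1 // -lt0n gell_gt0.
have [i tri] : exists i, \tr (w i *m z i) != 0.
  apply: boolp.contrapT => ni; case/eqP: l0.
  rewrite -(mxtrace1 F (gell p)) -wz1 linear_sum /= big1 // => i _.
  by apply/eqP/negPn/negP => ti; apply: ni; exists i.
have zD t d : d \in gD p t -> z i *m d *m w i \in gD p' t := corner_transport i1 i RG.
have wD t d : d \in gD p' t -> w i *m d *m z i \in gD p t := corner_transport i i1 R'G.
have wC b h y : y \in gcolumns b h i1 -> R *m y *m w i \in gcolumns b h i.
  exact: column_transport.
have zC b h y : y \in gcolumns b h i -> R' *m y *m z i \in gcolumns b h i1.
  exact: column_transport.
move: (z i) (w i) tri zD wD wC zC => {wz1}{}z {}w tri zD wD wC zC.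
have D1 (q : gammaData F G m n) : 1%:M \in gD q 0.
  by have [Dgr _ _ _] := gDP q; apply: grading_one.
have scal (q : gammaData F G m n) d : d \in gD q 0 -> exists a, d = a%:M.
  by have [Dgr Dinv _ _] := gDP q; apply: (degree0_scalar Dgr (gell_gt0 q) Dinv).
(* z w and w z have degree 0, hence are scalars. They coincide and are nonzero by the choice of i,
   so z and w are inverse up to c, although the two sizes have not been compared. *)
have [c zwE] : exists c, z *m w = c%:M.
  by apply: (scal p'); have := zD _ _ (D1 p); rewrite mulmx1.
have [c' wzE] : exists c', w *m z = c'%:M.
  by apply: (scal p); have := wD _ _ (D1 p'); rewrite mulmx1.
have w0 : w != 0 by apply: contraNneq tri => ->; rewrite mul0mx mxtrace0.
have cc : c = c'.
  apply/eqP; rewrite -subr_eq0; have : (c - c') *: w == 0.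
    rewrite scalerBl -[c *: _]mul_mx_scalar -[c' *: _]mul_scalar_mx -zwE -wzE mulmxA subrr.
    exact: eqxx.
  by rewrite scaler_eq0 (negPf w0) orbF.
have c0 : c != 0.
  by apply: contraNneq tri => c0; rewrite wzE -cc c0 raddf0 mxtrace0.
rewrite -cc in wzE.
have zdw0 d : d != 0 -> z *m d *m w != 0.
  apply: contraNneq => e; have : w *m (z *m d *m w) *m z == 0 by rewrite e mulmx0 mul0mx.
  rewrite !mulmxA wzE -mulmxA wzE mul_scalar_mx mul_mx_scalar scalerA scaler_eq0.
  by rewrite mulf_eq0 (negPf c0).
have wdz0 d : d != 0 -> w *m d *m z != 0.
  apply: contraNneq => e; have : z *m (w *m d *m z) *m w == 0 by rewrite e mulmx0 mul0mx.
  rewrite !mulmxA zwE -mulmxA zwE mul_scalar_mx mul_mx_scalar scalerA scaler_eq0.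
  by rewrite mulf_eq0 (negPf c0).
have TP (q : gammaData F G m n) t d : d \in gD q t -> d != 0 -> t \in gT q.
  have [_ _ Ddim _] := gDP q => Dd d0; apply: contraNT d0 => nT.
  have /eqP := Ddim t; rewrite (negPf nT) dimv_eq0 => /eqP Dt0.
  by rewrite -memv0 -Dt0.
have pick (q : gammaData F G m n) t : t \in gT q -> vpick (gD q t) != 0.
  by have [_ _ Ddim _] := gDP q => Tt; rewrite vpick0 -dimv_eq0 Ddim Tt.
have TT : gT p = gT p'.
  apply/fsetP => t; apply/idP/idP => Tt.
    apply: TP (zD _ _ (memv_pick _)) _.
    by apply: zdw0 (pick _ _ Tt).
  apply: TP (wD _ _ (memv_pick _)) _.
  by apply: wdz0 (pick _ _ Tt).
split=> //.
  move=> u v Tu Tv; have [_ Dinv _ Dcomm] := gDP p; have [_ _ _ D'comm] := gDP p'.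
  pose x := vpick (gD p u); pose y := vpick (gD p v).
  have Dx : x \in gD p u := memv_pick _; have Dy : y \in gD p v := memv_pick _.
  have ux : x \in unitmx by apply: Dinv Dx (pick _ _ Tu).
  have yx0 : y *m x != 0.
    apply: contraNneq (pick _ _ Tv) => yx0; rewrite -/y.
    by rewrite -(mulmxK ux y) yx0 mul0mx.
  have := D'comm u v; rewrite -TT => /(_ Tu Tv _ _ (zD _ _ Dx) (zD _ _ Dy)).
  move=> e.
  have mulE a b : z *m a *m w *m (z *m b *m w) = c *: (z *m (a *m b) *m w).
    rewrite !mulmxA -(mulmxA _ (w) (z)) wzE mul_mx_scalar.
    by rewrite -!scalemxAl.
  move: e; rewrite !mulE (Dcomm u v Tu Tv _ _ Dx Dy) -scalemxAr -scalemxAl !scalerA.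
  move/eqP; rewrite -subr_eq0 -scalerBl scaler_eq0 (negPf (zdw0 _ yx0)) orbF.
  by rewrite mulrC -mulrBl mulf_eq0 (negPf c0) orbF subr_eq0 => /eqP.
exists (ggamma (p := p') i - ggamma (p := p) i1).
have Rinj k (x y : 'M[F]_(N, k)) : R *m x = R *m y -> x = y.
  by move/(congr1 (mulmx R')); rewrite !mulmxA R'R !mul1mx.
have R'inj k (x y : 'M[F]_(N, k)) : R' *m x = R' *m y -> x = y.
  by move/(congr1 (mulmx R)); rewrite !mulmxA RR' !mul1mx.
(* The maps y |-> R y w and y |-> R' y z are injective in both directions because w z = z w = c. *)
have dimE b h : \dim (gcolumns b h i1) = \dim (gcolumns b h i).
  apply/eqP; rewrite eqn_leq; apply/andP; split.
    pose f := linfun (mulmxr (w) \o mulmx R : 'M[F]_(N, gell p) -> 'M[F]_(N, gell p')).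
    rewrite -(@limg_dim_eq _ _ _ f (gcolumns b h i1)).
      apply: dimvS; apply/subvP => _ /memv_imgP[y Sy ->]; rewrite lfunE /=.
      exact: wC.
    apply/eqP; rewrite -subv0; apply/subvP => y; rewrite memv_cap memv_ker lfunE /= memv0.
    move=> /andP[_ /eqP e]; have : R *m (c *: y) = R *m 0.
      by rewrite mulmx0 -mul_mx_scalar -wzE mulmxA mulmxA e mul0mx.
    by move/Rinj/eqP; rewrite scaler_eq0 (negPf c0).
  pose f := linfun (mulmxr (z) \o mulmx R' : 'M[F]_(N, gell p') -> 'M[F]_(N, gell p)).
  rewrite -(@limg_dim_eq _ _ _ f (gcolumns b h i)).
    apply: dimvS; apply/subvP => _ /memv_imgP[y Sy ->]; rewrite lfunE /=.
    exact: zC.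
  apply/eqP; rewrite -subv0; apply/subvP => y; rewrite memv_cap memv_ker lfunE /= memv0.
  move=> /andP[_ /eqP e]; have : R' *m (c *: y) = R' *m 0.
    by rewrite mulmx0 -mul_mx_scalar -zwE mulmxA mulmxA e mul0mx.
  by move/R'inj/eqP; rewrite scaler_eq0 (negPf c0).
set g := _ - _.
have [_ TB] := gT_subgroup p; have T0 : 0 \in gT p by have [] := gT_subgroup p.
have TN x : (- x \in gT p) = (x \in gT p).
  by apply/idP/idP => Tx; have := TB _ _ T0 Tx; rewrite sub0r ?opprK.
have permE b s s' : s = (if b then ggamma1 p : seq G else ggamma0 p : seq G) ->
    s' = (if b then ggamma1 p' : seq G else ggamma0 p' : seq G) ->
    perm_eq [seq translate (g + x) (gT p) | x <- s] [seq translate x (gT p) | x <- s'].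
  move=> sE s'E; apply/allP => C; rewrite mem_cat => CP; apply/eqP.
  have [a ->] : exists a, C = translate a (gT p).
    by case/orP: CP => /mapP[a _ ->]; [exists (g + a) | exists a].
  rewrite -(count_cosets (p := p) g a sE).
  have -> : [seq translate x (gT p) | x <- s'] = [seq translate (0 + x) (gT p') | x <- s'].
    by rewrite TT; apply: eq_map => x; rewrite add0r.
  rewrite [in RHS]TT -(count_cosets (p := p') 0 a s'E) -TT.
  (* In this degree, position j contributes when a - (g + g_j), respectively a - g'_j, lies in T:
     both sides count the coset of a. *)
  have := dimE b (a - ggamma (p := p') i); rewrite !dim_gcolumns -TT => e.
  transitivity (\sum_(j | gpar (p := p) j == b)
    ((a - ggamma (p := p') i - ggamma (p := p) j + ggamma (p := p) i1)%R \in gT p))%N.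
    apply: eq_bigr => j _; rewrite -TN; congr (nat_of_bool _).
    suff -> : - (g + ggamma j - a) = a - ggamma i - ggamma j + ggamma i1 by [].
    by rewrite /g !opprD !opprK [LHS](AC (2*1*1) (4*1*3*2)).
  rewrite e; apply: eq_bigr => j _; rewrite -TN; congr (nat_of_bool _).
  suff -> : - (a - ggamma i - ggamma j + ggamma i) = 0 + ggamma j - a by [].
  by rewrite add0r !opprD !opprK [LHS](AC (3*1) (3*1*(2*4))) /= subrr addr0.
by split; [apply: (permE false) | apply: (permE true)].
Qed.

End Uniqueness.

Section NecessaryCondition.
Variables (F : closedFieldType) (G : zmodType).
Hypothesis charF0 : [pchar F] =i pred0.

(** The criterion with delta = 1 and no exchange; the other cases are reduced to it by replacing q
    with its opposite or exchanged data. *)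
Definition same_data m n (p q : gammaData F G m n) : Prop :=
  [/\ gT p = gT q, {in gT p &, forall u v, gbeta p u v = gbeta q u v}
    & exists g,
      perm_eq [seq translate (g + x) (gT p) | x <- ggamma0 p]
              [seq translate x (gT p) | x <- ggamma0 q] /\
      perm_eq [seq translate (g + x) (gT p) | x <- ggamma1 p]
              [seq translate x (gT p) | x <- ggamma1 q]].

Lemma injective_surjective r s (k : 'M[F]_(r, s) -> 'M[F]_(r, s)) :
  linear k -> injective k -> forall y, exists x, k x = y.
Proof.
move=> klin kinj y; have kE := sum_delta_linear klin.
pose K := \matrix_(i < r * s) mxvec (k (vec_mx (delta_mx 0 i))).
have KE x : mxvec x *m K = mxvec (k x).
  have klin' : linear (fun x : 'rV[F]_(r * s) => mxvec (k (vec_mx x))).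
    by move=> c a b; rewrite linearP klin linearP.
  rewrite -[x in RHS]mxvecK (sum_delta_linear klin') mulmx_sum_row big_ord1.
  by apply: eq_bigr => i _; rewrite rowK.
have uK : K \in unitmx.
  rewrite -row_free_unit -kermx_eq0; apply/eqP/row_matrixP => i; rewrite row0.
  have /row_matrixP/(_ i) := mulmx_ker K; rewrite row_mul row0.
  rewrite -[row i _]vec_mxK KE => /(canRL mxvecK); rewrite linear0.
  have k0 : k 0 = 0.
    by have := klin (-1) 0 0; rewrite scaler0 addr0 scaleN1r => {1}->; rewrite addNr.
  by rewrite -[X in _ = X]k0 => /kinj ->; rewrite linear0.
exists (vec_mx (mxvec y *m invmx K)); apply: (can_inj mxvecK).
by rewrite -KE vec_mxK mulmxKV.
Qed.

Lemma same_data_of_form m n (p q : gammaData F G m n) (P : 'M[F]_m.+1) (Q : 'M[F]_n.+1) :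
    P \in unitmx -> Q \in unitmx ->
    (forall g x, urmx x \in GammaM p g -> urmx (P *m x *m Q) \in GammaM q g) ->
  same_data p q.
Proof.
move=> uP uQ PQG.
pose R : 'M[F]_(m.+1 + n.+1) := block_mx P 0 0 (invmx Q).
pose R' : 'M[F]_(m.+1 + n.+1) := block_mx (invmx P) 0 0 Q.
have RR' : R *m R' = 1%:M.
  rewrite mulmx_block !(mulmx0, mul0mx, addr0, add0r) mulmxV // mulVmx //.
  by rewrite -scalar_mx_block.
have eR b : eps b *m R = R *m eps b.
  by case: b; rewrite /eps !mulmx_block !(mulmx0, mul0mx, mulmx1, mul1mx, addr0, add0r).
have RG : forall g z, z \in GammaM p g -> R *m z *m R' \in GammaM q g.
  apply: upper_conjugation => // g z Wz; rewrite urmx_eps => zE.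
  have := PQG g (ursubmx z); rewrite zE => /(_ Wz).
  rewrite -[in X in _ -> X]zE /urmx !mulmx_block.
  by rewrite !(mulmx0, mul0mx, mulmx1, mul1mx, addr0, add0r).
exact: GammaM_unique RR' eR RG.
Qed.

(** If (k x)^T = P x Q, transposing k x lands in the lower block of the opposite data, and
    exchanging the blocks returns it to the upper one. The [ecast] merely transports q along m =
    n. *)
Lemma same_data_of_equivariant m n (p q : gammaData F G m n)
    (k : 'M[F]_(m.+1, n.+1) -> 'M[F]_(m.+1, n.+1)) :
    linear k -> injective k -> equivariant k ->
    (forall g x, urmx x \in GammaM p g -> urmx (k x) \in GammaM q g) ->
  same_data p q \/ exists mn : m = n,
    same_data p (ecast j (gammaData F G j n) (esym mn)
      (swapData (oppData (ecast j (gammaData F G j n) mn q)))).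
Proof.
move=> klin kinj keq kG.
have [[P [Q [uP uQ kE]]]|[mn kLL]] :=
  equivariant_form (natr_char0 charF0 1) klin kinj (injective_surjective klin kinj) keq.
  by left; apply: (same_data_of_form uP uQ) => g x /kG; rewrite kE.
right; exists mn; case: n / mn p q k klin kinj keq kG kLL => p q k klin kinj keq kG kLL /=.
have k0 : k 0 = 0.
  by have := klin (-1) 0 0; rewrite scaler0 addr0 scaleN1r => {1}->; rewrite addNr.
have kTlin : linear (fun x => (k x)^T) by move=> c x y; rewrite klin linearP.
have [|P [Q [uP uQ kE]]] := left_intertwined_form kTlin _ kLL.
  by move=> x kx; apply: kinj; rewrite k0; apply: trmx_inj; rewrite trmx0.
apply: (same_data_of_form uP uQ) => g x /kG; rewrite -kE => /tr_GammaM/swap_GammaM.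
by rewrite /urmx tr_block_mx !trmx0 swapmx_block.
Qed.

End NecessaryCondition.

(** * The action of an automorphism on the upper block *)

Section OddPart.
Variables (F : closedFieldType) (G : zmodType) (m n : nat).
Hypothesis charF0 : [pchar F] =i pred0.
Variables (p p' : gammaData F G m n) (f : 'End(Alie F m n)).
Hypothesis fauto : is_superaut f.
Hypothesis fG : forall g, (f @: GammaA p g)%VS = GammaA p' g.
Local Notation M := 'M[F]_(m.+1 + n.+1).
Local Notation sls := (slspace F m.+1 n.+1).
Local Notation rep := (Arep F m n).
Implicit Types x : 'M[F]_(m.+1, n.+1).

(** f maps the upper block into the odd part but may mix the two blocks, so both parts are recorded;
    the lower one is transposed to have the same format, at the price of being graded by the
    opposite data. Scalar ambiguity does not affect off-diagonal blocks. *)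
Definition upper_part x : 'M[F]_(m.+1, n.+1) := ursubmx (rep (f (Acls (urmx x)))).
Definition lower_part x : 'M[F]_(m.+1, n.+1) := (dlsubmx (rep (f (Acls (urmx x)))))^T.

Lemma urmx_sl x : urmx x \in sls.
Proof. by rewrite mem_slspace /supertrace block_mxKul block_mxKdr !mxtrace0 subrr. Qed.

Lemma urmx_linear r s : linear (@urmx F r s).
Proof. by move=> a x y; rewrite /urmx scale_block_mx add_block_mx !scaler0 !addr0. Qed.

Lemma f_urmx_linear : linear (fun x => rep (f (Acls (urmx x)))).
Proof. by move=> a x y; rewrite urmx_linear !linearP. Qed.

Lemma upper_part_linear : linear upper_part.
Proof.
move=> a x y; rewrite /upper_part f_urmx_linear; apply/matrixP => i j.
by rewrite !mxE.
Qed.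

Lemma lower_part_linear : linear lower_part.
Proof.
move=> a x y; rewrite /lower_part f_urmx_linear; apply/matrixP => i j.
by rewrite !mxE.
Qed.

Lemma Arep_offdiag (y : M) : y \in sls ->
  ursubmx (rep (Acls y)) = ursubmx y /\ dlsubmx (rep (Acls y)) = dlsubmx y.
Proof.
move=> sly; have [k ->] := Arep_Acls sly.
rewrite (@scalar_mx_block _ m.+1 n.+1) -[y]submxK add_block_mx.
by rewrite !(block_mxKur, block_mxKdl) !addr0.
Qed.

Lemma f_urmx x : f (Acls (urmx x)) =
  Acls (block_mx 0 (upper_part x) (lower_part x)^T 0).
Proof.
have [_ _ /(_ true) fpar] := fauto.
have : f (Acls (urmx x)) \in spar (Alie F m n) true.
  rewrite -fpar memv_img //; apply/mem_spar; exists (urmx x); split=> //.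
    exact: urmx_sl.
  by rewrite /mxpar block_mxKur block_mxKdl.
rewrite /upper_part /lower_part trmxK => /mem_spar[y [sly yodd ->]].
have [-> ->] := Arep_offdiag sly.
by rewrite -[in LHS]yodd.
Qed.

Lemma f_even (a : 'M[F]_m.+1) (b : 'M[F]_n.+1) : \tr a = \tr b ->
  block_mx a 0 0 b \in sls /\ exists a' b',
    block_mx a' 0 0 b' \in sls /\
    f (Acls (block_mx a 0 0 b)) = Acls (block_mx a' 0 0 b').
Proof.
move=> tab; have slab : block_mx a 0 0 b \in sls.
  by rewrite mem_slspace /supertrace block_mxKul block_mxKdr tab subrr.
split=> //; have [_ _ /(_ false) fpar] := fauto.
have : f (Acls (block_mx a 0 0 b)) \in spar (Alie F m n) false.
  rewrite -fpar memv_img //; apply/mem_spar; exists (block_mx a 0 0 b); split=> //.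
  by rewrite /mxpar block_mxKul block_mxKdr.
case/mem_spar => y [sly yeven ->]; exists (ulsubmx y), (drsubmx y).
by rewrite -/(mxpar false y) yeven.
Qed.

Lemma odd_sl r s (y1 : 'M[F]_(r, s)) y2 : block_mx 0 y1 y2 0 \in slspace F r s.
Proof. by rewrite mem_slspace /supertrace block_mxKul block_mxKdr !mxtrace0 subrr. Qed.

(** f sends diag(a, b) to some diag(a', b') and preserves its bracket with the upper block;
    transposing the lower part turns (a', b') into (- a'^T, - b'^T). *)
Lemma odd_parts_equivariant (a : 'M[F]_m.+1) (b : 'M[F]_n.+1) : \tr a = \tr b ->
  exists a' b', forall x,
    upper_part (a *m x - x *m b) = a' *m upper_part x - upper_part x *m b' /\
    lower_part (a *m x - x *m b) = lower_part x *m b'^T - a'^T *m lower_part x.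
Proof.
move=> tab; have [slab [a' [b' [slab' fab]]]] := f_even tab.
exists a', b' => x; have [_ fM _] := fauto.
have : f (Acls (urmx (a *m x - x *m b))) =
    Acls (block_mx 0 (a' *m upper_part x - upper_part x *m b')
       (b' *m (lower_part x)^T - (lower_part x)^T *m a') 0).
  have -> : urmx (a *m x - x *m b) = sbracket (block_mx a 0 0 b) (urmx x).
    by rewrite /urmx sbracket_block !(mulmx0, mul0mx, subr0, addr0, add0r, oppr0).
  rewrite -smul_Acls ?urmx_sl // fM fab f_urmx smul_Acls ?odd_sl // sbracket_block.
  by rewrite !(mulmx0, mul0mx, subr0, addr0, add0r, oppr0).
rewrite /upper_part /lower_part => ->.
have [-> ->] := Arep_offdiag (odd_sl (a' *m upper_part x - upper_part x *m b')
       (b' *m (lower_part x)^T - (lower_part x)^T *m a')).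
rewrite block_mxKur block_mxKdl; split=> //.
by rewrite linearB /= !trmx_mul trmxK.
Qed.

Lemma upper_part_equivariant : equivariant upper_part.
Proof.
by move=> a b /odd_parts_equivariant[a' [b' e]]; exists a', b' => x; have [] := e x.
Qed.

Lemma lower_part_equivariant : equivariant lower_part.
Proof.
move=> a b /odd_parts_equivariant[a' [b' e]]; exists (- a'^T), (- b'^T) => x.
by have [_ ->] := e x; rewrite mulNmx mulmxN opprK addrC.
Qed.

Lemma odd_parts_graded g x : urmx x \in GammaM p g ->
  urmx (upper_part x) \in GammaM p' g /\ urmx (lower_part x) \in GammaM (oppData p') g.
Proof.
move=> Wx; have : f (Acls (urmx x)) \in GammaA p' g.
  rewrite -fG memv_img //; apply/mem_induced; exists (urmx x); split=> //.
  exact: urmx_sl.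
case/mem_induced => y [sly Wy fE].
rewrite /upper_part /lower_part fE; have [-> ->] := Arep_offdiag sly.
split; first by rewrite -urmx_eps; apply: GammaM_eps.
suff -> : (dlsubmx y)^T = ursubmx y^T by rewrite -urmx_eps; apply/GammaM_eps/tr_GammaM.
by rewrite -[in RHS](submxK y) tr_block_mx block_mxKur.
Qed.

Lemma f_urmx_eq0 x : upper_part x = 0 -> lower_part x = 0 -> x = 0.
Proof.
move=> x1 x2; have [f0 _ _] := fauto.
have := f_urmx x; rewrite x1 x2 trmx0 block_mx0 linear0 => /eqP.
rewrite -(linear0 f) (inj_eq (lker0P (introT eqP f0))) Acls_eq0 ?urmx_sl //.
case: (m =P n) => _; last by rewrite -(block_mx0 _ m.+1 n.+1 m.+1 n.+1) => /eqP/eq_block_mx[].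
case/vlineP => c; rewrite scalemx1 (@scalar_mx_block _ m.+1 n.+1).
by case/eq_block_mx.
Qed.

(* The kernel of either part is stable under the even part of A(m, n), hence
   zero or everything. *)
Lemma odd_part_injective : injective upper_part \/ injective lower_part.
Proof.
have inj0 (k : 'M[F]_(m.+1, n.+1) -> 'M[F]_(m.+1, n.+1)) :
    linear k -> (forall x, k x = 0 -> x = 0) -> injective k.
  move=> klin k0 x y e; apply/eqP; rewrite -subr_eq0; apply/eqP/k0.
  by rewrite -[x - y]addrC -scaleN1r klin e scaleN1r addNr.
have [ker0|nker0] := boolp.EM (forall x, upper_part x = 0 -> x = 0).
  by left; apply: inj0 upper_part_linear ker0.
right; apply: (inj0 _ lower_part_linear) => y y2; apply: f_urmx_eq0 => //.
have [x [x1 x0]] : exists x, upper_part x = 0 /\ x != 0.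
  apply: boolp.contrapT => nx; apply: nker0 => x x1; apply/eqP/negPn/negP => x0.
  by apply: nx; exists x.
exact: (equivariant_ker upper_part_linear upper_part_equivariant x0 x1).
Qed.

End OddPart.

(** * Matching signs and translations *)

Section CosetReversal.
Variables (G : zmodType) (T : {fset G}).
Hypothesis Tsub : is_subgroup T.

Lemma perm_cosets_opp g (s s' : seq G) :
    perm_eq [seq translate (g + x) T | x <- s] [seq translate x T | x <- map -%R s'] ->
  perm_eq [seq translate (- g + x) T | x <- map -%R s] [seq translate x T | x <- s'].
Proof.
have [T0 TB] := Tsub.
have TN x : (- x \in T) = (x \in T).
  by apply/idP/idP => Tx; have := TB _ _ T0 Tx; rewrite sub0r ?opprK.
pose nu (C : {fset G}) : {fset G} := [fset - x | x in C]%fset.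
have nuE a : nu (translate a T) = translate (- a) T.
  apply/fsetP => x; apply/imfsetP/imfsetP => /= [[_ /imfsetP[t /= Tt ->] ->]|[t /= Tt ->]].
    by exists (- t); rewrite ?TN // opprD.
  exists (a - t); last by rewrite opprB addrC.
  by apply/imfsetP; exists (- t); rewrite //= TN.
move/(perm_map nu); rewrite -!map_comp.
rewrite (eq_map (f := nu \o _) (g := fun x => translate (- g - x) T)); last first.
  by move=> x /=; rewrite nuE opprD.
rewrite (eq_map (f := nu \o _) (g := fun x => translate x T)) //.
by move=> x /=; rewrite nuE opprK.
Qed.

End CosetReversal.

(** Moves delta from the second tuple to the first; for delta = -1 all cosets are negated, which
    turns the translation g into -g. *)
Lemma mtranslate_of_perm (G : zmodType) (T : {fset G}) (delta : int) g (s s' : seq G) :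
    is_subgroup T -> delta = 1 \/ delta = -1 ->
    perm_eq [seq translate (g + x) T | x <- s] [seq translate x T | x <- tuple_pow s' delta] ->
  mtranslate (g *~ delta) (Xi T (tuple_pow s delta)) = Xi T s'.
Proof.
move=> Tsub [] -> pe; apply/mtranslate_XiE.
  by move: pe; rewrite /tuple_pow !(eq_map (fun x => mulr1z x)) !map_id mulr1z.
by rewrite mulrNz mulr1z; apply: perm_cosets_opp.
Qed.

Lemma tuple_pow1 (G : zmodType) (s : seq G) : tuple_pow s 1 = s.
Proof. by rewrite /tuple_pow (eq_map (fun x => mulr1z x)) map_id. Qed.

(** Common end of the four outcomes: q is p' altered by [delta] and [swap], and the sign is moved
    over to p using that delta is its own inverse. *)
Lemma same_data_conclusion (F : closedFieldType) (G : zmodType) m n (p p' q : gammaData F G m n)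
    (delta : int) (swap : bool) :
    delta = 1 \/ delta = -1 -> (swap -> m = n) -> same_data p q -> gT q = gT p' ->
    (forall u v, gbeta q u v = gbeta p' u v ^ delta) ->
    ggamma0 q = tuple_pow (if swap then ggamma1 p' : seq G else ggamma0 p') delta :> seq G ->
    ggamma1 q = tuple_pow (if swap then ggamma0 p' : seq G else ggamma1 p') delta :> seq G ->
  gT p = gT p' /\
  exists (delta : int) (g : G),
    [/\ delta = 1 \/ delta = -1,
        {in gT p &, forall u v, gbeta p u v ^ delta = gbeta p' u v},
        m <> n ->
          mtranslate g (Xi (gT p) (tuple_pow (ggamma0 p) delta)) = Xi (gT p') (ggamma0 p') /\
          mtranslate g (Xi (gT p) (tuple_pow (ggamma1 p) delta)) = Xi (gT p') (ggamma1 p')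
      & m = n ->
          (mtranslate g (Xi (gT p) (tuple_pow (ggamma0 p) delta)) = Xi (gT p') (ggamma0 p') /\
           mtranslate g (Xi (gT p) (tuple_pow (ggamma1 p) delta)) = Xi (gT p') (ggamma1 p')) \/
          (mtranslate g (Xi (gT p) (tuple_pow (ggamma0 p) delta)) = Xi (gT p') (ggamma1 p') /\
           mtranslate g (Xi (gT p) (tuple_pow (ggamma1 p) delta)) = Xi (gT p') (ggamma0 p'))].
Proof.
move=> deltaP swapP [TT bb [g [e0 e1]]] Tq bq g0 g1.
have Tpp : gT p = gT p' by rewrite TT.
split=> //; exists delta, (g *~ delta).
rewrite -Tpp; rewrite {}g0 in e0; rewrite {}g1 in e1.
have {}e0 := mtranslate_of_perm (gT_subgroup p) deltaP e0.
have {}e1 := mtranslate_of_perm (gT_subgroup p) deltaP e1.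
split=> [//|u v Tu Tv|mn|mn].
- rewrite bb // bq; case: deltaP => ->; rewrite ?expr1z //.
  by rewrite !exprN1 invrK.
- by case: swap swapP e0 e1 => // swapP; case: mn; apply: swapP.
by case: swap swapP e0 e1 => swapP e0 e1; [right | left].
Qed.

Theorem theorem5p7 (F : closedFieldType) (charF0 : [pchar F] =i pred0)
    (G : zmodType) (m n : nat) (mn_neq0 : (m != 0%N) || (n != 0%N)) :
  (forall A_ : G -> {vspace Alie F m n}, is_even_typeI A_ ->
     exists p : gammaData F G m n, isomorphic_gradings A_ (GammaA p))
  /\
  (forall p p' : gammaData F G m n,
     isomorphic_gradings (GammaA p) (GammaA p') <->
     gT p = gT p' /\
     exists (delta : int) (g : G),
       [/\ delta = 1 \/ delta = -1,
           {in gT p &, forall u v, gbeta p u v ^ delta = gbeta p' u v},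
           m <> n ->
             mtranslate g (Xi (gT p) (tuple_pow (ggamma0 p) delta))
               = Xi (gT p') (ggamma0 p') /\
             mtranslate g (Xi (gT p) (tuple_pow (ggamma1 p) delta))
               = Xi (gT p') (ggamma1 p')
         & m = n ->
             (mtranslate g (Xi (gT p) (tuple_pow (ggamma0 p) delta))
                = Xi (gT p') (ggamma0 p') /\
              mtranslate g (Xi (gT p) (tuple_pow (ggamma1 p) delta))
                = Xi (gT p') (ggamma1 p')) \/
             (mtranslate g (Xi (gT p) (tuple_pow (ggamma0 p) delta))
                = Xi (gT p') (ggamma1 p') /\
              mtranslate g (Xi (gT p) (tuple_pow (ggamma1 p) delta))
                = Xi (gT p') (ggamma0 p'))]).
Proof.
split=> [A_|p p']; first exact: even_typeI_GammaA.
split=> [[f fauto fG]|[TT [delta [g [deltaP bb neq eq]]]]]; last first.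
  have [mn|/eqP mn] := eqVneq m n; last first.
    have [e0 e1] := neq mn.
    exact: GammaA_isomorphic_delta deltaP TT bb e0 e1.
  have [[e0 e1]|[e0 e1]] := eq mn.
    exact: GammaA_isomorphic_delta deltaP TT bb e0 e1.
  (* With exchanged tuples, the block exchange of p reduces to the case without exchange. *)
  clear neq eq mn_neq0; case: n / mn p p' TT bb e0 e1 => p p' TT bb e0 e1.
  apply: (isomorphic_gradings_trans (GammaA_swap p)).
  exact: (@GammaA_isomorphic_delta _ _ _ _ (swapData p) p' delta g deltaP TT bb e1 e0).
(* An injective upper part gives delta = 1 without exchange or, if it transposes, delta = -1 with
   exchange. *)
have [uinj|linj] := odd_part_injective fauto.
  have [|[mn]] := same_data_of_equivariant charF0 (upper_part_linear f) uinj
      (upper_part_equivariant fauto) (fun g x H => (odd_parts_graded fG H).1).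
    move=> sd; apply: (same_data_conclusion (delta := 1) (swap := false) _ _ sd);
      rewrite ?tuple_pow1 //; first by left.
  clear f fauto fG uinj mn_neq0; case: n / mn p p' => p p' /= sd.
  apply: (same_data_conclusion (delta := -1) (swap := true) _ _ sd) => //=; by right.
(* The lower part compares p with the opposite of p', so both signs are reversed: delta = -1 without
   exchange, delta = 1 with it, where two negations cancel. *)
have [|[mn]] := same_data_of_equivariant charF0 (lower_part_linear f) linj
    (lower_part_equivariant fauto) (fun g x H => (odd_parts_graded fG H).2).
  move=> sd; apply: (same_data_conclusion (delta := -1) (swap := false) _ _ sd) => //.
  by right.
clear f fauto fG linj mn_neq0; case: n / mn p p' => p p' /= sd.
apply: (same_data_conclusion (delta := 1) (swap := true) _ _ sd) => //=.
- by left.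
- by move=> u v; rewrite expr1z invrK.
- by rewrite -map_comp tuple_pow1 (eq_map (g := id)) ?map_id // => x /=; rewrite opprK.
by rewrite -map_comp tuple_pow1 (eq_map (g := id)) ?map_id // => x /=; rewrite opprK.
Qed.
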